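(* Let $\alpha>0$. The random graph $G(n,n^{-\alpha})$ does not obey the FO zero-one $3$-law if and only if $\alpha\in\{1,\frac{7}{6},\frac{6}{5},\frac{5}{4},\frac{4}{3},\frac{3}{2},2\}$.
   Context: $G(n,p)$ denotes the Erdős–Rényi random graph on vertex set $V_n=\{1,\dots,n\}$ in which each pair of vertices is joined by an edge independently with probability $p$. First order (FO) formulae of graphs are built from the relations $\sim$ (adjacency) and $=$ between vertex variables, logical connectives, and quantifiers $\forall,\exists$ over vertices. The quantifier depth of a formula is the maximum number of nested quantifiers in it. $G(n,p)$ obeys the FO zero-one $k$-law if every FO sentence (formula without free variables) of quantifier depth $k$ is either true asymptotically almost surely (with probability tending to $1$ as $n\to\infty$) or false asymptotically almost surely for $G(n,p)$. *)

(* Defs.v *)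
From HB Require Import structures.
From mathcomp Require Import all_boot all_order all_algebra.
From mathcomp Require Import all_classical all_reals all_analysis.

Set Implicit Arguments.
Unset Strict Implicit.
Unset Printing Implicit Defensive.

Import Order.TTheory GRing.Theory Num.Theory.
Import numFieldNormedType.Exports.

Local Open Scope ring_scope.

(* [fo m] is the type of first order formulae of graphs whose free variables
   are among m given ones (well-scoped de Bruijn indices; variable [ord0] is
   the one bound by the innermost enclosing quantifier). *)
Inductive fo : nat -> Type :=
| FEq m : 'I_m -> 'I_m -> fo m
| FAdj m : 'I_m -> 'I_m -> fo m
| FNot m : fo m -> fo m
| FAnd m : fo m -> fo m -> fo m
| FOr m : fo m -> fo m -> fo m
| FImp m : fo m -> fo m -> fo m
| FIff m : fo m -> fo m -> fo m
| FAll m : fo m.+1 -> fo m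
| FEx m : fo m.+1 -> fo m.

Definition sentence := fo 0.

Fixpoint qdepth m (f : fo m) : nat :=
  match f with
  | FEq _ _ _ | FAdj _ _ _ => 0
  | FNot _ g => qdepth g
  | FAnd _ g h | FOr _ g h | FImp _ g h | FIff _ g h =>
      maxn (qdepth g) (qdepth h)
  | FAll _ g | FEx _ g => (qdepth g).+1
  end.

Definition extend (T : Type) m (x : T) (v : 'I_m -> T) : 'I_m.+1 -> T :=
  fun i => if unlift ord0 i is Some j then v j else x.

Fixpoint eval (V : finType) (adj : rel V) m (f : fo m) : ('I_m -> V) -> bool :=
  match f in fo m return ('I_m -> V) -> bool with
  | FEq _ i j => fun v => v i == v j
  | FAdj _ i j => fun v => adj (v i) (v j)
  | FNot _ g => fun v => ~~ eval adj g v
  | FAnd _ g h => fun v => eval adj g v && eval adj h v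
  | FOr _ g h => fun v => eval adj g v || eval adj h v
  | FImp _ g h => fun v => eval adj g v ==> eval adj h v
  | FIff _ g h => fun v => eval adj g v == eval adj h v
  | FAll _ g => fun v => [forall x, eval adj g (extend x v)]
  | FEx _ g => fun v => [exists x, eval adj g (extend x v)]
  end.

Definition no_vars (T : Type) : 'I_0 -> T :=
  fun i => False_rect T (notF (ltn_ord i)).

Definition holds (V : finType) (adj : rel V) (f : sentence) : bool :=
  eval adj f (@no_vars V).

Definition vpairs n : {set {set 'I_n}} := [set e : {set 'I_n} | #|e| == 2].

(* A simple graph on 'I_n is given by its edge set G \subset vpairs n. *)
Definition adj_of n (G : {set {set 'I_n}}) : rel 'I_n :=
  fun x y => [set x; y] \in G.

(* Probability that G(n, p) satisfies A; each pair in [vpairs n] is an edge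
   with probability p, independently of the others. *)
Definition Gnp_prob (R : realType) n (p : R) (A : rel 'I_n -> bool) : R :=
  \sum_(G in powerset (vpairs n) | A (adj_of G))
     \prod_(e in vpairs n) (if e \in G then p else 1 - p).

Local Open Scope classical_set_scope.

Definition aas (R : realType) (p : R^nat)
    (A : forall n, rel 'I_n -> bool) : Prop :=
  (fun n => Gnp_prob (p n) (@A n)) @ \oo --> (1 : R).

Definition zero_one_law (R : realType) (p : R^nat) (k : nat) : Prop :=
  forall f : sentence, qdepth f = k ->
    aas p (fun n E => holds E f) \/ aas p (fun n E => ~~ holds E f).

(* Main.v *)
(* By Ehrenfeucht games, two graphs agree on sentences of depth 3 as soon as every
   vertex of one has a counterpart in the other with the same depth 2 type, and
   this type is read off from the vertices y, their adjacency to x, and which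
   patterns of adjacency to (x, y) are realized by a third vertex.

   For alpha < 1 all patterns other than a common neighbour occur around every
   pair. If alpha < 1/2 common neighbours always exist. If 1/2 <= alpha < 1 every
   vertex has neighbours and non-neighbours without common neighbour, and the
   only question left is which vertices lie in triangles: all of them if
   alpha < 2/3, some but not all if alpha >= 2/3.

   For 1 < alpha < 2 the graph has no short cycles, and the depth 2 type of a vertex
   is one of twelve. Each type forces a smallest tree, with k <= 6 edges, and any
   component isomorphic to that tree realizes it; so the type occurs or not
   according to whether alpha < (k+1)/k or alpha > (k+1)/k. At alpha = (k+1)/k the
   number of such trees has bounded mean, and both outcomes keep a positive
   probability, by the second moment method and by Harris' inequality. The triangles play
   this role at alpha = 1, and for alpha > 2 there are no edges. *)

From HB Require Import structures.
From mathcomp Require Import all_boot all_order all_algebra.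
From mathcomp Require Import all_classical all_reals all_analysis.
From mathcomp Require Import zify ring lra.
From mathcomp Require Import fintype finset bigop.
Require Import Defs.

Set Implicit Arguments.
Unset Strict Implicit.
Unset Printing Implicit Defensive.

Import Order.TTheory GRing.Theory Num.Theory.
Import numFieldNormedType.Exports.

Local Open Scope classical_set_scope.
Local Open Scope set_scope.
Local Open Scope bool_scope.
Local Open Scope ring_scope.

Local Notation graph n := {set {set 'I_n}} (only parsing).

(** * Random subsets *)

Lemma set_setU1_ind (T : finType) (P : {set T} -> Prop) :
  P set0 -> (forall x (D : {set T}), x \notin D -> P D -> P (x |: D)) -> forall D, P D.
Proof.
move=> P0 PU D; have [k] := ubnP #|D|; elim: k D => // k IH D.
rewrite ltnS => Dk; have [->//|[x xD]] := set_0Vmem D.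
rewrite -(setD1K xD); apply: PU; first by rewrite setD11.
by apply: IH; apply: leq_trans Dk; rewrite (cardsD1 x D) xD.
Qed.

Lemma disjoint_setDr (T : finType) (A B : {set T}) : [disjoint A & B :\: A].
Proof. by rewrite disjoint_sym; have /subsetDP[] := subxx (B :\: A). Qed.

Section RandomSubset.
Variables (R : realFieldType) (T : finType) (p : R).
Implicit Types (D F G H : {set T}) (f g : {set T} -> R) (A B : pred {set T}).

Definition weight D G : R := \prod_(e in D) (if e \in G then p else 1 - p).

(* Expectation of [f] for the random subset of [D] that contains each element
   independently with probability [p]. *)
Definition expect D f : R := \sum_(G in powerset D) f G * weight D G.

Definition prob D A : R := expect D (fun G => (A G)%:R).

Definition depends_on D (X : Type) (f : {set T} -> X) :=
  forall G, f (G :&: D) = f G.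

Lemma eq_expect D f g : (forall G, G \subset D -> f G = g G) -> expect D f = expect D g.
Proof. by move=> fg; apply: eq_bigr => G; rewrite inE => /fg ->. Qed.

Lemma eq_prob D A B : (forall G, G \subset D -> A G = B G) -> prob D A = prob D B.
Proof. by move=> AB; apply: eq_expect => G /AB ->. Qed.

Lemma expect_set0 f : expect set0 f = f set0.
Proof. by rewrite /expect powerset0 big_set1 /weight big_set0 mulr1. Qed.

Lemma expectD D f g : expect D (fun G => f G + g G) = expect D f + expect D g.
Proof. by rewrite -big_split; apply: eq_bigr => G _; rewrite mulrDl. Qed.

Lemma expectZ D c f : expect D (fun G => c * f G) = c * expect D f.
Proof. by rewrite /expect big_distrr; apply: eq_bigr => G _; rewrite /= mulrA. Qed.

Lemma expectZr D c f : expect D (fun G => f G * c) = expect D f * c.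
Proof. by rewrite mulrC -expectZ; apply: eq_expect => G _; rewrite mulrC. Qed.

Lemma expectB D f g : expect D (fun G => f G - g G) = expect D f - expect D g.
Proof.
rewrite -[- expect D g]mulN1r -expectZ -expectD.
by apply: eq_expect => G _; rewrite mulN1r.
Qed.

Lemma expect_sum D (I : finType) (Q : pred I) (F : I -> {set T} -> R) :
  expect D (fun G => \sum_(i | Q i) F i G) = \sum_(i | Q i) expect D (F i).
Proof. by rewrite exchange_big /=; apply: eq_bigr => G _; rewrite mulr_suml. Qed.

Lemma expect_setU1 x D f : x \notin D ->
  expect (x |: D) f = p * expect D (fun G => f (x |: G)) + (1 - p) * expect D f.
Proof.
move=> xD; have xG G : G \subset D -> x \notin G.
  by move=> /subsetP GD; apply: contra xD; exact: GD.
rewrite /expect (bigID (fun G : {set T} => x \in G)) /=; congr (_ + _).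
- rewrite (reindex_onto (fun G => x |: G) (fun G => G :\ x)) /=; last first.
    by move=> G /andP[_ ?]; rewrite setD1K.
  rewrite big_distrr /=; apply: eq_big => [G|G].
    rewrite !inE eqxx andbT subUset sub1set setU11 /=.
    apply/andP/idP => [[GD /eqP <-]|GD].
      by rewrite -(setU1K xD) setSD // subUset sub1set setU11.
    by rewrite setU1K ?xG // (subset_trans GD) ?subsetUr.
  move=> /andP[_ /eqP GE]; rewrite /weight big_setU1 //= setU11 mulrCA.
  congr (_ * (_ * _)); apply: eq_bigr => y yD; rewrite !inE.
  by case: eqVneq yD xD => // -> ->.
- rewrite big_distrr /=; apply: eq_big => [G|G /andP[_ xnG]].
    rewrite !inE; apply/andP/idP => [[GD xnG]|GD]; last first.
      by rewrite xG // (subset_trans GD) ?subsetUr.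
    by rewrite -(setU1K xD) subsetD1 GD.
  by rewrite /weight big_setU1 //= (negbTE xnG) mulrCA.
Qed.

Lemma expect_cst D (c : R) : expect D (fun=> c) = c.
Proof.
elim/set_setU1_ind: D => [|x D xD IH]; first by rewrite expect_set0.
by rewrite expect_setU1 // IH -mulrDl addrC subrK mul1r.
Qed.

Lemma probC D A : prob D (predC A) = 1 - prob D A.
Proof.
rewrite -[1](expect_cst D) -expectB; apply: eq_expect => G _ /=.
by case: (A G); rewrite ?subrr ?subr0.
Qed.

Lemma expect_setU D1 D2 f : [disjoint D1 & D2] ->
  expect (D1 :|: D2) f = expect D1 (fun G1 => expect D2 (fun G2 => f (G1 :|: G2))).
Proof.
elim/set_setU1_ind: D1 f => [|x D xD IH] f D12.
  by rewrite expect_set0 set0U; apply: eq_expect => G _; rewrite set0U.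
have xD2 : x \notin D2 by rewrite (disjointFr D12 (setU11 x D)).
have DD2 : [disjoint D & D2] := disjointWl (subsetUr _ _) D12.
rewrite -setUA expect_setU1 ?inE ?negb_or ?xD // !IH // expect_setU1 //.
by congr (_ * _ + _); apply: eq_expect => G1 _; apply: eq_expect => G2 _; rewrite setUA.
Qed.

Lemma expect_setI D D0 f : D0 \subset D ->
  expect D (fun G => f (G :&: D0)) = expect D0 f.
Proof.
move=> D0D; rewrite -{1}(setIidPr D0D) -{1}(setID D D0) expect_setU; last first.
  by rewrite (setIidPr D0D) disjoint_setDr.
rewrite (setIidPr D0D); apply: eq_expect => G1 G1D.
rewrite -[RHS](expect_cst (D :\: D0)); apply: eq_expect => G2 /subsetDP[_ G2D0]; congr f.
have /eqP G20 : G2 :&: D0 == set0 by rewrite setI_eq0.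
by rewrite setIUl G20 setU0; apply/setIidPl.
Qed.

Lemma expect_indep D D1 D2 f g : [disjoint D1 & D2] ->
  depends_on D1 f -> depends_on D2 g ->
  expect D (fun G => f G * g G) = expect D f * expect D g.
Proof.
move=> D12 fD gD; have D21 : D2 :\: D1 = D2.
  by apply/setDidPl; rewrite disjoint_sym.
have fE : expect D f = expect (D :&: D1) f.
  rewrite -(expect_setI f (subsetIl D D1)); apply: eq_expect => G GD.
  by rewrite -fD setIA (setIidPl GD).
have gE : expect D g = expect (D :\: D1) g.
  rewrite -(expect_setI g (subsetDl D D1)); apply: eq_expect => G GD.
  by rewrite -gD -[RHS]gD -setIA setIDAC -setIDA D21 setIA (setIidPl GD).
rewrite fE gE -expectZr -{1}(setID D D1) expect_setU; last first.
  exact: disjointWl (subsetIr _ _) (disjoint_setDr _ _).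
apply: eq_expect => G1; rewrite subsetI => /andP[_ G1D1].
rewrite -expectZ; apply: eq_expect => G2 /subsetDP[_ G2D1].
have /eqP G21 : G2 :&: D1 == set0 by rewrite setI_eq0.
have /eqP G12 : G1 :&: D2 == set0 by rewrite setI_eq0 (disjointWl G1D1).
rewrite -fD -(fD G1) -gD -(gD G2); congr (f _ * g _).
  by rewrite setIUl G21 setU0.
by rewrite setIUl G12 set0U.
Qed.

Lemma prob_indep D D1 D2 A B : [disjoint D1 & D2] ->
  depends_on D1 A -> depends_on D2 B -> prob D (predI A B) = prob D A * prob D B.
Proof.
move=> D12 AD BD; rewrite -(@expect_indep _ D1 D2) => [|//|G|G]; rewrite ?AD ?BD //.
by apply: eq_expect => G _ /=; rewrite -natrM mulnb.
Qed.

Lemma prob_forall_indep D (I : finType) (Y : {set I}) (E : I -> {set T})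
    (A : I -> pred {set T}) :
  {in Y, forall y, depends_on (E y) (A y)} ->
  {in Y &, forall y z, y != z -> [disjoint E y & E z]} ->
  prob D (fun G => [forall y in Y, A y G]) = \prod_(y in Y) prob D (A y).
Proof.
elim/set_setU1_ind: Y => [|y Y yY IH] AE Edisj.
  rewrite big_set0 -[RHS](expect_cst D); apply: eq_expect => G _.
  by case: forallP => // -[] x; rewrite inE.
have YS : {subset Y <= y |: Y} by move=> z zY; rewrite inE zY orbT.
rewrite big_setU1 //= -IH; last 2 first.
- by move=> z /YS; exact: AE.
- by move=> z w /YS zY /YS wY; exact: Edisj.
rewrite -(@prob_indep _ (E y) (\bigcup_(z in Y) E z)).
- apply: eq_prob => G _ /=; apply/forall_inP/andP => [AG|[Ay /forall_inP AY] z].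
    by split; [apply: AG (setU11 _ _)|apply/forall_inP => z /YS; exact: AG].
  by rewrite !inE => /orP[/eqP ->//|/AY].
- apply/bigcup_disjointP => z zY; apply: Edisj; rewrite ?setU11 ?YS //.
  by apply: contraNneq yY => ->.
- exact: AE (setU11 _ _).
- move=> G; apply: eq_forallb_in => z zY.
  by rewrite -(AE _ (YS _ zY)) -setIA (setIidPr (bigcup_sup _ zY)) AE ?YS.
Qed.

Lemma prob_in D x a : x \in D -> prob D (fun G => (x \in G) == a) = if a then p else 1 - p.
Proof.
move=> xD; rewrite /prob -(setD1K xD) expect_setU1 ?setD11 //.
rewrite (@eq_expect _ _ (fun=> (true == a)%:R)) => [|G _]; last by rewrite setU11.
rewrite [in X in _ + X](@eq_expect _ _ (fun=> (false == a)%:R)) => [|G GD]; last first.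
  by rewrite [x \in G](contraNF (subsetP GD x)) ?setD11.
by rewrite !expect_cst; case: a; rewrite /= ?mulr1 ?mulr0 ?addr0 ?add0r.
Qed.

Lemma weight_subset D F : F \subset D -> weight D F = p ^+ #|F| * (1 - p) ^+ #|D :\: F|.
Proof.
move=> FD; rewrite /weight (big_setID F) (setIidPr FD) /= -!prodr_const.
congr (_ * _); apply: eq_bigr => x; first by move=> ->.
by rewrite inE => /andP[/negbTE ->].
Qed.

Lemma prob_setI_eq D D0 F : D0 \subset D -> F \subset D0 ->
  prob D (fun G => G :&: D0 == F) = p ^+ #|F| * (1 - p) ^+ #|D0 :\: F|.
Proof.
move=> D0D FD0; rewrite -weight_subset // /prob (expect_setI (fun G => (G == F)%:R)) //.
rewrite /expect (bigD1 F) ?inE //= eqxx mul1r big1 ?addr0 // => G /andP[_ /negbTE ->].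
by rewrite mul0r.
Qed.

Lemma prob_superset D F : F \subset D -> prob D (fun G => F \subset G) = p ^+ #|F|.
Proof.
move=> FD; rewrite -[RHS]mulr1 -[X in _ * X](expr0 (1 - p)) -(cards0 T) -(setDv F).
by rewrite -(@prob_setI_eq D) //; apply: eq_prob => G _ /=; rewrite (sameP eqP setIidPr).
Qed.

Hypothesis p01 : 0 <= p <= 1.

Lemma weight_ge0 D G : 0 <= weight D G.
Proof.
have /andP[p0 p1] := p01.
by apply: prodr_ge0 => e _; case: ifP; rewrite ?subr_ge0.
Qed.

Lemma le_expect D f g : (forall G, G \subset D -> f G <= g G) -> expect D f <= expect D g.
Proof.
by move=> fg; apply: ler_sum => G; rewrite inE => /fg fgG; rewrite ler_wpM2r ?weight_ge0.
Qed.

Lemma expect_ge0 D f : (forall G, G \subset D -> 0 <= f G) -> 0 <= expect D f.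
Proof. by move=> f0; rewrite -(expect_cst D 0); exact: le_expect. Qed.

Lemma le_prob D A B : (forall G, G \subset D -> A G -> B G) -> prob D A <= prob D B.
Proof.
by move=> AB; apply: le_expect => G /AB; case: (A G) => [->|].
Qed.

Lemma prob_ge0 D A : 0 <= prob D A.
Proof. exact: expect_ge0. Qed.

Lemma prob_or_le D A B : prob D (predU A B) <= prob D A + prob D B.
Proof.
rewrite -expectD; apply: le_expect => G _ /=.
by case: (A G); case: (B G); rewrite /= ?addr0 ?add0r ?lerDl.
Qed.

Lemma prob_exists_le D (I : finType) (Q : pred I) (A : I -> pred {set T}) :
  prob D (fun G => [exists (i | Q i), A i G]) <= \sum_(i | Q i) prob D (A i).
Proof.
rewrite -expect_sum; apply: le_expect => G _.
case: existsP => [[i /andP[Qi Ai]]|_]; last by apply: sumr_ge0.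
by rewrite (bigD1 i) //= Ai lerDl sumr_ge0.
Qed.

Definition set_antitone f := forall G H, G \subset H -> f H <= f G.

Lemma harris D f g : set_antitone f -> set_antitone g ->
  expect D f * expect D g <= expect D (fun G => f G * g G).
Proof.
have /andP[p0 p1] := p01; have q0 : 0 <= 1 - p by rewrite subr_ge0.
elim/set_setU1_ind: D f g => [|x D xD IH] f g f_anti g_anti; first by rewrite !expect_set0.
pose with_x (h : {set T} -> R) G := h (x |: G).
have with_x_anti h : set_antitone h -> set_antitone (with_x h).
  by move=> h_anti G H GH; apply: h_anti; exact: setUS.
have with_x_le h : set_antitone h -> 0 <= expect D h - expect D (with_x h).
  move=> h_anti; rewrite subr_ge0; apply: le_expect => G _.
  by apply: h_anti; exact: subsetUr.
rewrite !expect_setU1 //.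
apply: (@le_trans _ _ (p * (expect D (with_x f) * expect D (with_x g)) +
                       (1 - p) * (expect D f * expect D g))); last first.
  apply: lerD; apply: ler_wpM2l => //; last exact: IH.
  by apply: IH; exact: with_x_anti.
have := mulr_ge0 (mulr_ge0 p0 q0) (mulr_ge0 (with_x_le f f_anti) (with_x_le g g_anti)).
rewrite /with_x -[in X in _ -> X]subr_ge0; congr (0 <= _); ring.
Qed.

Lemma prob_superset_none_ge D (I : finType) (Y : {set I}) (F : I -> {set T}) :
  {in Y, forall y, F y \subset D} ->
  \prod_(y in Y) (1 - p ^+ #|F y|) <=
  prob D (fun G => [forall y in Y, ~~ (F y \subset G)]).
Proof.
have indicator_anti (A : pred {set T}) : (forall G H, G \subset H -> A H -> A G) ->
    set_antitone (fun G => (A G)%:R).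
  by move=> A_anti G H GH; rewrite ler_nat; case AH: (A H); rewrite // (A_anti _ _ GH).
elim/set_setU1_ind: Y => [|y Y yY IH] FD.
  rewrite big_set0 -[leLHS](expect_cst D); apply: le_expect => G _.
  by case: forallP => // -[] x; rewrite inE.
have {}IH := IH (fun z zY => FD z (setU1r y zY)).
have probFy : 1 - p ^+ #|F y| = prob D (fun G => ~~ (F y \subset G)).
  by rewrite -(@prob_superset D) ?FD ?setU11 // -probC.
rewrite big_setU1 //= probFy; apply: (le_trans (ler_wpM2l (prob_ge0 _ _) IH)).
apply: le_trans (harris _ _ _) _.
- by apply: indicator_anti => G H GH; apply: contra => /subset_trans; apply.
- apply: indicator_anti => G H GH /forall_inP FH; apply/forall_inP => z /FH.
  by apply: contra => /subset_trans; apply.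
- apply: le_expect => G _; rewrite -natrM ler_nat mulnb.
  case: andP => // -[Fy /forall_inP FY]; rewrite lt0b; apply/forall_inP => z.
  by rewrite !inE => /orP[/eqP ->|/FY].
Qed.

Lemma cauchy_schwarz D f g :
  expect D (fun G => f G * g G) ^+ 2 <=
  expect D (fun G => f G ^+ 2) * expect D (fun G => g G ^+ 2).
Proof.
set fg := expect D (fun G => f G * g G).
set ff := expect D (fun G => f G ^+ 2); set gg := expect D (fun G => g G ^+ 2).
have lagrange : expect D (fun G => expect D (fun H => (f G * g H - g G * f H) ^+ 2)) =
    2 * (ff * gg - fg ^+ 2).
  rewrite (@eq_expect _ _
    (fun G => gg * f G ^+ 2 + (- 2 * fg * (f G * g G) + ff * g G ^+ 2))).
    by rewrite !expectD !expectZ -/fg -/ff -/gg; ring.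
  move=> G _; rewrite (@eq_expect _ _
    (fun H => f G ^+ 2 * g H ^+ 2 + (- 2 * (f G * g G) * (f H * g H) + g G ^+ 2 * f H ^+ 2))).
    by rewrite !expectD !expectZ -/fg -/ff -/gg; ring.
  by move=> H _; ring.
rewrite -subr_ge0 -(@pmulr_rge0 _ 2) // -lagrange.
by apply: expect_ge0 => G _; apply: expect_ge0 => H _; exact: sqr_ge0.
Qed.

Lemma second_moment_neq0 D f :
  expect D f ^+ 2 <= expect D (fun G => f G ^+ 2) * prob D (fun G => f G != 0).
Proof.
have -> : expect D f = expect D (fun G => f G * (f G != 0)%:R).
  by apply: eq_expect => G _; case: eqP => [->|_]; rewrite ?mul0r ?mulr1.
apply: le_trans (cauchy_schwarz _ _ _) _.
by under [X in _ * X]eq_expect => G _ do rewrite -natrX expnS expn1 mulnb andbb.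
Qed.

Lemma prob_neq0_ge D f c : 0 < expect D f ->
  expect D (fun G => f G ^+ 2) <= c * expect D f ^+ 2 -> c^-1 <= prob D (fun G => f G != 0).
Proof.
set m := expect D f; set P := prob _ _ => m0 moment2.
have m2 : 0 < m ^+ 2 by exact: exprn_gt0.
have : m ^+ 2 <= c * m ^+ 2 * P.
  by apply: le_trans (second_moment_neq0 D f) _; rewrite ler_wpM2r ?prob_ge0.
rewrite mulrAC -{1}[m ^+ 2]mul1r ler_pM2r // => cP.
have c0 : 0 < c.
  rewrite ltNge; apply/negP => c_le0; have := mulr_le0_ge0 c_le0 (prob_ge0 D (fun G => f G != 0)).
  by rewrite -/P; lra.
by rewrite -[_^-1]mulr1 ler_pdivrMl.
Qed.

Lemma chebyshev_expect D f t : 0 < t ->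
  prob D (fun G => t <= `|f G - expect D f|) <=
  (expect D (fun G => f G ^+ 2) - expect D f ^+ 2) / t ^+ 2.
Proof.
move=> t0; rewrite ler_pdivlMr ?exprn_gt0 // -expectZr.
have -> : expect D (fun G => f G ^+ 2) - expect D f ^+ 2 =
    expect D (fun G => (f G - expect D f) ^+ 2).
  rewrite [RHS](@eq_expect _ _
    (fun G => f G ^+ 2 + ((- 2 * expect D f) * f G + expect D f ^+ 2))); last by move=> G _; ring.
  by rewrite !expectD expectZ expect_cst; ring.
apply: le_expect => G _; case: (boolP (t <= _)) => [tf|_]; rewrite ?mul1r ?mul0r ?sqr_ge0 //.
by rewrite -[leRHS]real_normK ?num_real // ler_sqr ?nnegrE ?normr_ge0 // ltW.
Qed.

End RandomSubset.

Lemma expect_expR_card (R : realType) (T : finType) (p s : R) (D D0 : {set T}) : D0 \subset D ->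
  expect p D (fun G => expR (s * #|G :&: D0|%:R)) = (1 - p + p * expR s) ^+ #|D0|.
Proof.
move=> D0D; rewrite (expect_setI p (fun G => expR (s * #|G|%:R))) //.
elim/set_setU1_ind: {D0D} D0 => [|x E xE IH].
  by rewrite expect_set0 !cards0 mulr0 expR0 expr0.
rewrite expect_setU1 // cardsU1 xE add1n exprS -IH [RHS]mulrDl addrC.
congr (_ + _); rewrite -mulrA; congr (_ * _); rewrite -expectZ; apply: eq_expect => G GE.
have xG : x \notin G by apply: contra xE => /(subsetP GE).
by rewrite cardsU1 xG natrD mulrDr mulr1 expRD.
Qed.

Lemma chernoff (R : realType) (T : finType) (p s t : R) (D D0 : {set T}) : 0 <= p <= 1 ->
  D0 \subset D ->
  prob p D (fun G => t <= s * #|G :&: D0|%:R) <= expR (p * #|D0|%:R * (expR s - 1) - t).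
Proof.
move=> p01 D0D; have /andP[p0 p1] := p01.
apply: (@le_trans _ _ (expect p D (fun G => expR (- t) * expR (s * #|G :&: D0|%:R)))).
  apply: le_expect => // G _; case: (boolP (t <= _)) => [tG|_]; last by rewrite mulr_ge0 ?expR_ge0.
  by rewrite -expRD -[leLHS]expR0 ler_expR addrC subr_ge0.
rewrite expectZ expect_expR_card // expRD [leRHS]mulrC ler_wpM2l ?expR_ge0 //.
rewrite -mulrA mulrCA mulrC expRM_natl lerXn2r ?nnegrE ?expR_ge0 //.
  by rewrite addr_ge0 ?subr_ge0 // mulr_ge0 ?expR_ge0.
by apply: le_trans (expR_ge1Dx _); lra.
Qed.

(** * Ehrenfeucht games *)

Definition pattern (V : finType) (adj : rel V) (x y : V) (a b : bool) :=
  [exists z, [&& z != x, z != y, adj z x == a & adj z y == b]].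

Lemma patternC (V : finType) (adj : rel V) x y a b :
  pattern adj x y a b = pattern adj y x b a.
Proof.
by apply: eq_existsb => z; rewrite andbCA; congr [&& _, _ & _]; rewrite andbC.
Qed.

Lemma extend0 (T : Type) m (x : T) (v : 'I_m -> T) : extend x v ord0 = x.
Proof. by rewrite /extend unlift_none. Qed.

Lemma extendS (T : Type) m (x : T) (v : 'I_m -> T) (i : 'I_m) : extend x v (lift ord0 i) = v i.
Proof. by have := @liftK m.+1 ord0 i; rewrite /extend => ->. Qed.

Section Ehrenfeucht.
Variables (V W : finType) (adjV : rel V) (adjW : rel W).

Definition same_atoms m (v : 'I_m -> V) (w : 'I_m -> W) :=
  forall i j, (v i == v j) = (w i == w j) /\ adjV (v i) (v j) = adjW (w i) (w j).

(* Duplicator wins the game with [k] rounds left. *)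
Fixpoint ef k m (v : 'I_m -> V) (w : 'I_m -> W) : Prop :=
  same_atoms v w /\
  if k is k'.+1 then
    (forall x, exists y, ef k' (extend x v) (extend y w)) /\
    (forall y, exists x, ef k' (extend x v) (extend y w))
  else True.

Lemma eval_ef m (f : fo m) k (v : 'I_m -> V) (w : 'I_m -> W) :
  (qdepth f <= k)%N -> ef k v w -> eval adjV f v = eval adjW f w.
Proof.
elim: f k v w => {m} [m i j|m i j|m g IH|m g IHg h IHh|m g IHg h IHh|m g IHg h IHh|
   m g IHg h IHh|m g IH|m g IH] k v w /=.
- by case: k => [|k] _ [/(_ i j)[-> _]].
- by case: k => [|k] _ [/(_ i j)[_ ->]].
- by move=> gk vw; rewrite (IH k v w).
1-4: by rewrite geq_max => /andP[gk hk] vw; rewrite (IHg k v w) // (IHh k v w).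
- case: k => // k gk [_ [forth back]]; apply/forallP/forallP => g_all x.
    by have [y /IH <-] := back x.
  by have [y /IH ->] := forth x.
- case: k => // k gk [_ [forth back]]; apply/existsP/existsP => -[x gx].
    by have [y /IH g_eq] := forth x; exists y; rewrite -g_eq.
  by have [y /IH g_eq] := back x; exists y; rewrite g_eq.
Qed.

(* [pair_sim] and [vertex_sim] describe the positions from which Duplicator
   survives one and two more rounds. *)
Definition pair_sim (x y : V) (x' y' : W) :=
  [/\ (x == y) = (x' == y'), adjV x y = adjW x' y' &
      forall a b, pattern adjV x y a b = pattern adjW x' y' a b].

Definition vertex_sim (x : V) (x' : W) :=
  (forall y, exists y', pair_sim x y x' y') /\ (forall y', exists y, pair_sim x y x' y').

End Ehrenfeucht.

Lemma ef_sym (V W : finType) (adjV : rel V) (adjW : rel W) k m (v : 'I_m -> V) (w : 'I_m -> W) :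
  ef adjV adjW k v w -> ef adjW adjV k w v.
Proof.
elim: k m v w => [|k IH] m v w /= [vw rounds]; split=> //.
1,2: by move=> i j; have [-> ->] := vw i j.
have [forth back] := rounds.
by split=> x; [have [y] := back x|have [y] := forth x]; exists y; exact: IH.
Qed.

Section Sim.
Variables (V W : finType) (adjV : rel V) (adjW : rel W).

Lemma pair_sim_sym x y x' y' :
  pair_sim adjV adjW x y x' y' -> pair_sim adjW adjV x' y' x y.
Proof. by case=> eq_xy adj_xy pattern_xy; split=> // a b; rewrite pattern_xy. Qed.

Lemma vertex_sim_sym x x' : vertex_sim adjV adjW x x' -> vertex_sim adjW adjV x' x.
Proof.
case=> forth back; split=> y.
  by have [z /pair_sim_sym] := back y; exists z.
by have [z /pair_sim_sym] := forth y; exists z.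
Qed.

Hypotheses (symV : symmetric adjV) (irrV : irreflexive adjV).
Hypotheses (symW : symmetric adjW) (irrW : irreflexive adjW).

Lemma same_atoms_extend m (v : 'I_m -> V) (w : 'I_m -> W) x y :
  same_atoms adjV adjW v w ->
  (forall i, (x == v i) = (y == w i) /\ adjV x (v i) = adjW y (w i)) ->
  same_atoms adjV adjW (extend x v) (extend y w).
Proof.
move=> vw xy i j; rewrite /extend.
case: unliftP => [i' _|_]; case: unliftP => [j' _|_] //; last by rewrite !eqxx irrV irrW.
by have [eq_xy adj_xy] := xy i'; rewrite eq_sym eq_xy eq_sym symV adj_xy symW.
Qed.

Lemma same_atoms1 x x' :
  same_atoms adjV adjW (extend x (@no_vars V)) (extend x' (@no_vars W)).
Proof. by apply: same_atoms_extend => [|[]//]; case. Qed.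

Lemma pair_sim_atoms x y x' y' : pair_sim adjV adjW x y x' y' ->
  same_atoms adjV adjW (extend y (extend x (@no_vars V))) (extend y' (extend x' (@no_vars W))).
Proof.
move=> [eq_xy adj_xy _]; apply: same_atoms_extend (same_atoms1 _ _) _ => i.
rewrite /extend; case: unliftP => [[]//|_].
by rewrite eq_sym eq_xy eq_sym symV adj_xy symW.
Qed.

Lemma pair_sim_forth x y x' y' : pair_sim adjV adjW x y x' y' -> forall z, exists z',
  same_atoms adjV adjW (extend z (extend y (extend x (@no_vars V))))
                       (extend z' (extend y' (extend x' (@no_vars W)))).
Proof.
move=> xy z; have [eq_xy adj_xy pattern_xy] := xy.
suff [z' [eq_zx eq_zy adj_zx adj_zy]] : exists z', [/\ (z == x) = (z' == x'),
    (z == y) = (z' == y'), adjV z x = adjW z' x' & adjV z y = adjW z' y'].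
  exists z'; apply: same_atoms_extend (pair_sim_atoms xy) _ => i; rewrite /extend.
  by do 2?[case: unliftP => [{}i _|_] //]; case: i.
have [->|zx] := eqVneq z x; first by exists x'; rewrite !eqxx irrV irrW.
have [zy|zy] := eqVneq z y.
  rewrite {}zy in zx *; exists y'.
  by rewrite (eq_sym y') -eq_xy eq_sym (negbTE zx) !eqxx irrV irrW symV adj_xy symW.
have /existsP[z' /and4P[z'x z'y /eqP ax /eqP ay]] :
    pattern adjW x' y' (adjV z x) (adjV z y).
  by rewrite -pattern_xy; apply/existsP; exists z; rewrite zx zy !eqxx.
by exists z'; rewrite (negbTE z'x) (negbTE z'y).
Qed.

End Sim.

Section SimEhrenfeucht.
Variables (V W : finType) (adjV : rel V) (adjW : rel W).
Hypotheses (symV : symmetric adjV) (irrV : irreflexive adjV).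
Hypotheses (symW : symmetric adjW) (irrW : irreflexive adjW).

Lemma pair_sim_ef x y x' y' : pair_sim adjV adjW x y x' y' ->
  ef adjV adjW 1 (extend y (extend x (@no_vars V))) (extend y' (extend x' (@no_vars W))).
Proof.
move=> xy; split; first exact: pair_sim_atoms.
split=> z.
  by have [z' zz'] := pair_sim_forth symV irrV symW irrW xy z; exists z'.
have [z' zz'] := pair_sim_forth symW irrW symV irrV (pair_sim_sym xy) z.
by exists z'; apply: ef_sym.
Qed.

Lemma vertex_sim_ef x x' : vertex_sim adjV adjW x x' ->
  ef adjV adjW 2 (extend x (@no_vars V)) (extend x' (@no_vars W)).
Proof.
case=> forth back; split; first exact: same_atoms1.
by split=> y; [have [y' /pair_sim_ef] := forth y|have [y' /pair_sim_ef] := back y]; exists y'.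
Qed.

Lemma vertex_sim_holds (f : sentence) : (qdepth f <= 3)%N ->
  (forall x, exists x', vertex_sim adjV adjW x x') ->
  (forall x', exists x, vertex_sim adjV adjW x x') ->
  holds adjV f = holds adjW f.
Proof.
move=> f3 forth back; apply: (eval_ef f3); split; first by case.
by split=> x; [have [x' /vertex_sim_ef] := forth x|have [x' /vertex_sim_ef] := back x]; exists x'.
Qed.

End SimEhrenfeucht.

Lemma adj_of_sym n (G : graph n) : symmetric (adj_of G).
Proof. by move=> x y; rewrite /adj_of setUC. Qed.

Lemma pair_vpairs n (x y : 'I_n) : ([set x; y] \in vpairs n) = (x != y).
Proof. by rewrite inE cards2; case: (x != y). Qed.

Lemma adj_of_irr n (G : graph n) : G \subset vpairs n -> irreflexive (adj_of G).
Proof.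
by move=> GV x; apply/negbTE/negP => /(subsetP GV); rewrite pair_vpairs eqxx.
Qed.

(** * Events holding with high probability *)

Section WithHighProbability.
Variables (R : realType) (p : R^nat).
Hypothesis p01 : forall n, 0 <= p n <= 1.
Implicit Types A B : forall n, graph n -> Prop.

Definition gnp n (A : graph n -> Prop) : R :=
  prob (p n) (vpairs n) (fun G => `[< A G >]).

Definition whp A := (fun n => gnp (A n)) @ \oo --> (1 : R).

Lemma gnpE n (A : pred (graph n)) : gnp A = prob (p n) (vpairs n) A.
Proof. by apply: eq_prob => G _; exact: asboolb. Qed.

Lemma gnpC n (A : graph n -> Prop) : gnp (fun G => ~ A G) = 1 - gnp A.
Proof. by rewrite -probC; apply: eq_prob => G _; rewrite asbool_neg. Qed.

Lemma gnp_ge0 n (A : graph n -> Prop) : 0 <= gnp A.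
Proof. exact: prob_ge0. Qed.

Lemma le_gnp n (A B : graph n -> Prop) :
  (forall G : graph n, G \subset vpairs n -> A G -> B G) -> gnp A <= gnp B.
Proof. by move=> AB; apply: le_prob => // G GV /asboolP/(AB G GV)/asboolP. Qed.

Lemma gnp_or_le n (A B : graph n -> Prop) :
  gnp (fun G => A G \/ B G) <= gnp A + gnp B.
Proof.
by apply: le_trans (prob_or_le _ _ _ _) => //; apply: le_prob => // G _; rewrite asbool_or.
Qed.

Lemma gnp_exists_le n (I : finType) (Q : pred I) (A : I -> graph n -> Prop) :
  gnp (fun G => exists2 i, Q i & A i G) <= \sum_(i | Q i) gnp (A i).
Proof.
apply: le_trans (prob_exists_le _ _ _ _) => //; apply: le_prob => // G _ /asboolP[i Qi Ai].
by apply/existsP; exists i; rewrite Qi; exact/asboolP.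
Qed.

Lemma whp_compl A : whp A <-> (fun n => gnp (fun G => ~ A n G)) @ \oo --> (0 : R).
Proof.
have onem_cvg (u : R^nat) a : u @ \oo --> a -> 1 - u n @[n --> \oo] --> 1 - a.
  by move=> ua; apply: cvgB => //; exact: cvg_cst.
split=> [/onem_cvg|/onem_cvg]; rewrite ?subrr ?subr0; apply: cvg_trans; apply: near_eq_cvg.
  by near=> n; rewrite gnpC.
by near=> n; rewrite gnpC subKr.
Unshelve. all: by end_near. Qed.

Lemma whp_of_le A (u : R^nat) :
  (\forall n \near \oo, gnp (fun G => ~ A n G) <= u n) -> u @ \oo --> (0 : R) -> whp A.
Proof.
move=> Au u0; apply/whp_compl; apply: (squeeze_cvgr _ (cvg_cst 0) u0).
near=> n; rewrite gnp_ge0 /=; near: n; exact: Au.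
Unshelve. all: by end_near. Qed.

Lemma whp_mono A B :
  (\forall n \near \oo, forall G : graph n, G \subset vpairs n -> A n G -> B n G) ->
  whp A -> whp B.
Proof.
move=> AB /whp_compl; apply: whp_of_le; near=> n; apply: le_gnp => G GV; apply: contra_not.
by move: G GV; near: n.
Unshelve. all: by end_near. Qed.

Lemma whp_forall (I : finType) (A : I -> forall n, graph n -> Prop) :
  (forall i, whp (A i)) -> whp (fun n G => forall i, A i n G).
Proof.
move=> wA; apply: (@whp_of_le _ (fun n => \sum_(i : I) gnp (fun G => ~ A i n G))).
  near=> n; apply: le_trans (gnp_exists_le _ _).
  by apply: le_gnp => G _ /existsNP[i nA]; exists i.
rewrite [X in _ --> X](_ : 0 = \sum_(i : I) (0 : R)); last by rewrite big1.
by apply: cvg_big => [|i _]; [exact: add_continuous|apply/whp_compl].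
Unshelve. all: by end_near. Qed.

Lemma whp_and A B : whp A -> whp B -> whp (fun n G => A n G /\ B n G).
Proof.
move=> wA wB; apply: whp_mono (whp_forall (A := fun b => if b then A else B) _); last by case.
by near=> n => G _ AB; split; [exact: AB true|exact: AB false].
Unshelve. all: by end_near. Qed.

Lemma whp_near A :
  (\forall n \near \oo, forall G : graph n, G \subset vpairs n -> A n G) -> whp A.
Proof.
move=> nearA; apply: (@whp_of_le _ (fun=> 0)); last exact: cvg_cst.
near=> n; rewrite -[leRHS](expect_cst (p n) (vpairs n)).
apply: le_expect => // G GV; rewrite asboolF //.
by apply; move: G GV; near: n.
Unshelve. all: by end_near. Qed.

Lemma not_whp A (c : R) : 0 < c ->
  (\forall n \near \oo, c <= gnp (fun G => ~ A n G)) -> ~ whp A.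
Proof.
move=> c0 cA /whp_compl/cvgrPdist_lt/(_ c c0) small.
have [n [nA]] := filter_ex (filterI cA small).
by rewrite sub0r normrN ger0_norm ?gnp_ge0 // ltNge nA.
Qed.

Lemma whp_concentrated (X : forall n, graph n -> R) (delta : R^nat) (c : R) : 0 < c ->
  let mean n := expect (p n) (vpairs n) (@X n) in
  (\forall n \near \oo, 0 < mean n) ->
  (\forall n \near \oo,
     expect (p n) (vpairs n) (fun G => X n G ^+ 2) <= (1 + delta n) * mean n ^+ 2) ->
  delta @ \oo --> (0 : R) ->
  whp (fun n G => `|X n G - mean n| < c * mean n).
Proof.
move=> c0 mean mean_gt0 moment2 delta0.
apply: (@whp_of_le _ (fun n => delta n * c ^- 2)); last first.
  by rewrite -(mul0r (c ^- 2)); apply: cvgM => //; exact: cvg_cst.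
near=> n; have m0 : 0 < mean n by near: n.
apply: (@le_trans _ _ (prob (p n) (vpairs n) (fun G => c * mean n <= `|X n G - mean n|))).
  by apply: le_prob => // G _ /asboolP/negP; rewrite -leNgt.
apply: le_trans (chebyshev_expect (p01 n) _ _ (mulr_gt0 c0 m0)) _.
rewrite ler_pdivrMr ?exprn_gt0 ?mulr_gt0 // exprMn mulrA divfK ?expf_neq0 ?gt_eqF //.
rewrite lerBlDr -/(mean n) addrC -[X in X + _]mul1r -mulrDl.
by near: n.
Unshelve. all: by end_near. Qed.

Lemma aas_whp (A : forall n, rel 'I_n -> bool) :
  aas p A <-> whp (fun n (G : graph n) => A n (adj_of G)).
Proof.
have prob_eq n : Gnp_prob (p n) (@A n) = gnp (fun G : graph n => A n (adj_of G)).
  rewrite gnpE /Gnp_prob /prob /expect big_mkcondr /=; apply: eq_bigr => G _.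
  by case: (A _); rewrite ?mul1r ?mul0r.
by rewrite /aas /whp; under eq_fun do rewrite prob_eq.
Qed.

Lemma zero_one_of_whp A : whp A ->
  (forall n (G : graph n) n' (G' : graph n'),
     G \subset vpairs n -> G' \subset vpairs n' -> A n G -> A n' G' ->
     forall x, exists x', vertex_sim (adj_of G) (adj_of G') x x') ->
  zero_one_law p 3.
Proof.
move=> wA simA f f3.
have [[n0 [G0 [GV0 AG0 fG0]]]|no_model] :=
  pselect (exists n (G : graph n), [/\ G \subset vpairs n, A n G & holds (adj_of G) f]).
- left; apply/(aas_whp (fun n E => holds E f)); apply: whp_mono wA; near=> n => G GV AG.
  rewrite [holds _ _](_ : _ = holds (adj_of G0) f) //.
  apply: vertex_sim_holds; rewrite ?f3 //; try exact: adj_of_sym; try exact: adj_of_irr.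
    exact: simA.
  by move=> x0; have [x /vertex_sim_sym] := simA _ _ _ _ GV0 GV AG0 AG x0; exists x.
- right; apply/(aas_whp (fun n E => ~~ holds E f)); apply: whp_mono wA; near=> n => G GV AG.
  by apply/negP => fG; apply: no_model; exists n, G.
Unshelve. all: by end_near. Qed.

Lemma no_zero_one_law (f : sentence) (c d : R) : qdepth f = 3 -> 0 < c -> 0 < d ->
  (\forall n \near \oo, c <= gnp (fun G : graph n => holds (adj_of G) f)) ->
  (\forall n \near \oo, d <= gnp (fun G : graph n => ~ holds (adj_of G) f)) ->
  ~ zero_one_law p 3.
Proof.
move=> f3 c0 d0 true_pos false_pos law.
have [/(aas_whp (fun n E => holds E f))|/(aas_whp (fun n E => ~~ holds E f))] := law f f3.
  exact: not_whp d0 false_pos.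
apply: (not_whp c0); apply: filterS true_pos => n /le_trans; apply.
by apply: le_gnp => G _ ->.
Qed.

End WithHighProbability.

(** * Asymptotics *)

Lemma bernoulli_onem (R : realFieldType) (q : R) k : 0 <= q <= 1 -> 1 - (1 - q) ^+ k <= k%:R * q.
Proof.
move=> /andP[q0 q1]; elim: k => [|k IH]; first by rewrite expr0 subrr mul0r.
have power_le1 : (1 - q) ^+ k <= 1 by rewrite exprn_ile1 ?subr_ge0 // gerBl.
rewrite exprS -natr1; nra.
Qed.

Section Asymptotics.
Variable R : realType.
Implicit Types (q r s c M : R).

Lemma natr_powRD n r s : (0 < n)%N -> n%:R `^ r * n%:R `^ s = n%:R `^ (r + s) :> R.
Proof. by move=> n0; rewrite powRD // pnatr_eq0 -lt0n n0 implybT. Qed.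

Lemma natr_powRX n r k : (n%:R `^ r) ^+ k = n%:R `^ (r * k%:R) :> R.
Proof. by rewrite powRrM powR_mulrn // powR_ge0. Qed.

Lemma ler_natr_powR n r s : (0 < n)%N -> r <= s -> n%:R `^ r <= n%:R `^ s :> R.
Proof. by move=> n0 rs; rewrite ler_powR // ler1n. Qed.

Lemma cvgy_natr_powR r : 0 < r -> n%:R `^ r @[n --> \oo] --> +oo.
Proof.
move=> r0; apply/cvgryPge => M; pose K := Num.max M 1.
have K0 : 0 <= K by rewrite le_max ler01 orbT.
near=> n; apply: (@le_trans _ _ K); first by rewrite le_max lexx.
have -> : K = (K `^ r^-1) `^ r by rewrite -powRrM mulVf ?gt_eqF // powRr1.
apply: ge0_ler_powR; rewrite ?nnegrE ?powR_ge0 //; first exact: ltW.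
by near: n; exact: nbhs_infty_ger.
Unshelve. all: by end_near. Qed.

Lemma near_ge_natr_powR r M : 0 < r -> \forall n \near \oo, M <= n%:R `^ r.
Proof. by move=> /cvgy_natr_powR/cvgryPge; apply. Qed.

Lemma cvg_natr_powRN r : 0 < r -> n%:R `^ (- r) @[n --> \oo] --> (0 : R).
Proof.
move=> r0; under eq_fun do rewrite powRN.
apply/gtr0_cvgV0; last exact: cvgy_natr_powR.
by near=> n; rewrite powR_gt0 // ltr0n; near: n; exact: nbhs_infty_gt.
Unshelve. all: by end_near. Qed.

Lemma cvg_natr_powRNZ c r : 0 < r -> c * n%:R `^ (- r) @[n --> \oo] --> (0 : R).
Proof.
by move=> r0; rewrite -[0](mulr0 c); apply: cvgM; [exact: cvg_cst|exact: cvg_natr_powRN].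
Qed.

Lemma expRN_le_exprV (k : nat) x : 0 < x -> expR (- x) <= (k.+1)`!%:R / x ^+ k.+1 :> R.
Proof.
move=> x0; rewrite expRN -invf_div lef_pV2 ?posrE ?expR_gt0 //; last first.
  by rewrite divr_gt0 ?exprn_gt0 // ltr0n fact_gt0.
by apply: le_trans (expR_ge1Dxn k (ltW x0)); rewrite lerDr.
Qed.

Lemma cvg_natrX_expRN (k : nat) c r : 0 < c -> 0 < r ->
  n%:R ^+ k * expR (- (c * n%:R `^ r)) @[n --> \oo] --> (0 : R).
Proof.
move=> c0 r0; pose j := Num.truncn (k.+1%:R / r).
have jr : k.+1%:R <= r * j.+1%:R by rewrite -ler_pdivrMl // mulrC; apply/ltW/truncnS_gt.
apply: (squeeze_cvgr _ (cvg_cst 0) (cvg_natr_powRNZ ((j.+1)`!%:R / c ^+ j.+1) ltr01)).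
near=> n; have n0 : (0 < n)%N by near: n; exact: nbhs_infty_gt.
have nr0 : 0 < n%:R `^ r :> R by rewrite powR_gt0 ?ltr0n.
rewrite mulr_ge0 ?exprn_ge0 ?expR_ge0 //=.
apply: le_trans (ler_wpM2l (exprn_ge0 _ (ler0n _ _)) (expRN_le_exprV j (mulr_gt0 c0 nr0))) _.
rewrite exprMn invfM mulrCA -mulrA ler_wpM2l ?ler0n // mulrCA.
rewrite ler_wpM2l ?invr_ge0 ?exprn_ge0 ?(ltW c0) //.
rewrite natr_powRX -powRN -powR_mulrn ?ler0n // natr_powRD // ler_natr_powR //.
by move: jr; rewrite -natr1; lra.
Unshelve. all: by end_near. Qed.

Lemma expr_onem_le_expR q k : q <= 1 -> (1 - q) ^+ k <= expR (- (q * k%:R)).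
Proof.
move=> q1; rewrite -mulNr mulrC expRM_natl.
by apply: lerXn2r; rewrite ?nnegrE ?subr_ge0 ?expR_ge0 // expR_ge1Dx.
Qed.

Lemma expr_onem_ge_expR q k : 0 <= q -> q <= 1 / 2 ->
  expR (- (2 * q * k%:R)) <= (1 - q) ^+ k.
Proof.
move=> q0 q1; rewrite -mulNr mulrC expRM_natl.
apply: lerXn2r; rewrite ?nnegrE ?expR_ge0 //; first lra.
rewrite expRN -[leRHS]invrK lef_pV2 ?posrE ?expR_gt0 ?invr_gt0 //; last lra.
apply: le_trans (expR_ge1Dx _); rewrite -[_^-1]mul1r ler_pdivrMr; [nra|lra].
Qed.

End Asymptotics.

Section EdgeProbability.
Variables (R : realType) (alpha : R).

Definition edge_prob (n : nat) : R := n%:R `^ (- alpha).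

Lemma mulr_edge_prob n : (0 < n)%N -> n%:R * edge_prob n = n%:R `^ (1 - alpha).
Proof. by move=> n0; rewrite -{1}[n%:R]powRr1 // natr_powRD. Qed.

Lemma mulrX_edge_probX n k l : (0 < n)%N ->
  n%:R ^+ k * edge_prob n ^+ l = n%:R `^ (k%:R - alpha * l%:R).
Proof. by move=> n0; rewrite natr_powRX -powR_mulrn // natr_powRD // mulNr. Qed.

Hypothesis alpha_gt0 : 0 < alpha.

Lemma edge_prob01 n : 0 <= edge_prob n <= 1.
Proof.
rewrite powR_ge0 /=; case: n => [|n]; first by rewrite /edge_prob powR0 // oppr_eq0 gt_eqF.
by rewrite -[leRHS](powRr0 n.+1%:R) ler_natr_powR // oppr_le0 ltW.
Qed.

Lemma near_edge_prob_le M : 0 < M -> \forall n \near \oo, edge_prob n <= M.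
Proof. by move=> M0; apply: cvgr_le M0; exact: cvg_natr_powRN. Qed.

Lemma near_mulr_edge_prob_le1 c : 0 <= c -> \forall n \near \oo, c * edge_prob n <= 1.
Proof.
rewrite le_eqVlt => /predU1P[<-|c0]; first by near=> n; rewrite mul0r.
by near=> n; rewrite -ler_pdivlMl // mulr1; near: n; apply: near_edge_prob_le; rewrite invr_gt0.
Unshelve. all: by end_near. Qed.

End EdgeProbability.

(** * Adjacency patterns in the dense range *)

Lemma set2_inj (T : finType) (x : T) : injective (fun y => [set x; y]).
Proof.
move=> y z E; have : y \in [set x; z] by rewrite -E set22.
rewrite !inE => /orP[/eqP yx|/eqP //].
by have := set22 x z; rewrite -E yx setUid inE => /eqP.
Qed.

Section PatternProbability.
Variables (R : realFieldType) (n : nat) (p : R).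

Definition pair_prob (a : bool) : R := if a then p else 1 - p.

Lemma adj_of_depends (x y : 'I_n) : depends_on [set [set x; y]] (fun G => adj_of G x y).
Proof. by move=> G; rewrite /adj_of !inE eqxx andbT. Qed.

Lemma prob_adj (x y : 'I_n) a : x != y ->
  prob p (vpairs n) (fun G => adj_of G x y == a) = pair_prob a.
Proof. by move=> xy; rewrite prob_in // pair_vpairs. Qed.

Lemma prob_no_pattern (v x : 'I_n) (a b : bool) : v != x ->
  prob p (vpairs n) (fun G => ~~ pattern (adj_of G) v x a b) =
  (1 - pair_prob a * pair_prob b) ^+ (n - 2).
Proof.
move=> vx; pose matches y G := (adj_of G y v == a) && (adj_of G y x == b).
pose E y : graph n := [set [set y; v]; [set y; x]].
have yv_yx y : [set y; v] != [set y; x] by apply: contra_neq vx => /set2_inj.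
have E_disjoint y z : y \in ~: [set v; x] -> z != y -> [disjoint E y & E z].
  rewrite !inE negb_or => /andP[yv yx] zy; rewrite -setI_eq0; apply/eqP/setP => e.
  rewrite !inE; apply/negbTE/negP => /andP[ey ez].
  have : y \in e by case/orP: ey => /eqP ->; rewrite set21.
  by case/orP: ez => /eqP ->; rewrite !inE (eq_sym y z) (negbTE zy) ?(negbTE yv) ?(negbTE yx).
rewrite (@eq_prob _ _ _ _ _ (fun G => [forall y in ~: [set v; x], ~~ matches y G])); last first.
  move=> G _; rewrite negb_exists; apply: eq_forallb => y.
  by rewrite !inE negb_or implybE -negb_and -andbA.
rewrite (@prob_forall_indep _ _ _ _ _ _ E) //; first last.
- by move=> y z yvx _ yz; apply: E_disjoint; rewrite // eq_sym.
- by move=> y _ G; rewrite /matches /adj_of !inE !eqxx orbT !andbT.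
rewrite (eq_bigr (fun=> 1 - pair_prob a * pair_prob b)) => [|y].
  by rewrite prodr_const cardsCs setCK cards2 vx card_ord.
rewrite !inE negb_or => /andP[yv yx]; rewrite (@probC _ _ _ _ (matches y)).
rewrite (@prob_indep _ _ _ _ [set [set y; v]] [set [set y; x]]) ?prob_adj //.
- by rewrite disjoints1 inE.
- by move=> G; rewrite adj_of_depends.
- by move=> G; rewrite adj_of_depends.
Qed.

End PatternProbability.

Lemma pair_prob_mul_ge (R : realFieldType) (p : R) (a b : bool) : 0 <= p <= 1 / 2 ->
  p ^+ (a + b) / 4 <= pair_prob p a * pair_prob p b.
Proof.
by move=> /andP[p0 p2]; case: a; case: b;
  rewrite /= ?expr0 ?expr1 ?expr2; have := mulr_ge0 p0 p0; nra.
Qed.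

Lemma whp_pattern (R : realType) (alpha : R) (a b : bool) : 0 < alpha ->
  alpha * (a + b)%:R < 1 ->
  whp (edge_prob alpha) (fun n G => forall v x, v != x -> pattern (adj_of G) v x a b).
Proof.
move=> alpha_gt0 ab; set p := edge_prob alpha; have p01 := edge_prob01 alpha_gt0.
pose s := 1 - alpha * (a + b)%:R; have s0 : 0 < s by rewrite subr_gt0.
apply: (@whp_of_le _ _ p01 _ (fun n => n%:R ^+ 2 * expR (- (8^-1 * n%:R `^ s)))); last first.
  exact: cvg_natrX_expRN.
near=> n.
have n4 : (4 <= n)%N by near: n; exact: nbhs_infty_ge.
have [p0 p1] := andP (p01 n).
have p2 : p n <= 1 / 2 by near: n; apply: near_edge_prob_le.
pose bad (vx : 'I_n * 'I_n) (G : graph n) := ~~ pattern (adj_of G) vx.1 vx.2 a b.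
apply: (@le_trans _ _ (\sum_(vx | vx.1 != vx.2) gnp p (bad vx))).
  apply: le_trans (gnp_exists_le p01 _ _); apply: le_gnp => // G _.
  by move=> /existsNP[v /existsNP[x /not_implyP[vx /negP no]]]; exists (v, x).
apply: (@le_trans _ _ (\sum_(vx : 'I_n * 'I_n | vx.1 != vx.2) expR (- (8^-1 * n%:R `^ s)))).
  apply: ler_sum => -[v x] vx; rewrite gnpE prob_no_pattern //.
  apply: le_trans (expr_onem_le_expR _ _) _.
    by rewrite mulr_ile1 //; case: (a) (b) => -[]; rewrite /= ?subr_ge0 ?gerBl.
  rewrite ler_expR lerN2.
  have -> : n%:R `^ s = n%:R * p n ^+ (a + b).
    by rewrite -[n%:R in RHS]expr1 mulrX_edge_probX // (leq_trans _ n4).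
  have := @pair_prob_mul_ge R (p n) a b; rewrite p0 p2 => /(_ isT) q_ge.
  have n_half : n%:R / 2 <= (n - 2)%:R :> R.
    by rewrite natrB ?(leq_trans _ n4) //; have : 4 <= n%:R :> R; [rewrite ler_nat|lra].
  apply: le_trans (ler_pM _ _ q_ge n_half); rewrite ?divr_ge0 ?exprn_ge0 //.
  by rewrite le_eqVlt; apply/orP; left; apply/eqP; field.
rewrite sumr_const -[leLHS]mulr_natl ler_wpM2r ?expR_ge0 // -natrX ler_nat.
by apply: leq_trans (max_card _) _; rewrite card_prod card_ord.
Unshelve. all: by end_near. Qed.

(** * Conditioning on a neighbourhood *)

Definition nbrs n (G : graph n) (v : 'I_n) := [set y | adj_of G v y].

Definition star n (v : 'I_n) : graph n := [set e : {set 'I_n} | v \in e].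

Definition star_pairs n (v : 'I_n) : graph n := [set [set v; y] | y in [set~ v]].

Lemma nbrs_depends n (v : 'I_n) : depends_on (star v) (fun G => nbrs G v).
Proof. by move=> G; apply/setP => y; rewrite !inE /adj_of !inE eqxx andbT. Qed.

Lemma nbrs_irr n (G : graph n) v : G \subset vpairs n -> v \notin nbrs G v.
Proof. by move=> GV; rewrite inE adj_of_irr. Qed.

Lemma card_nbrs n (v : 'I_n) (G : graph n) : G \subset vpairs n ->
  #|nbrs G v| = #|G :&: star_pairs v|.
Proof.
move=> GV; rewrite -(card_imset _ (@set2_inj _ v)); apply: eq_card => e.
apply/imsetP/setIP => [[y]|[eG /imsetP[y _ ey]]].
  rewrite inE => vy ->; split=> //; apply/imsetP; exists y => //.
  by rewrite !inE; apply: contraTneq vy => ->; rewrite adj_of_irr.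
by exists y; rewrite // inE /adj_of -ey.
Qed.

Lemma star_pairs_vpairs n (v : 'I_n) : star_pairs v \subset vpairs n.
Proof.
by apply/subsetP => e /imsetP[y]; rewrite in_setC1 => yv ->; rewrite pair_vpairs eq_sym.
Qed.

Lemma card_star_pairs n (v : 'I_n) : #|star_pairs v| = n.-1.
Proof. by rewrite card_imset ?cardsC1 ?card_ord //; exact: set2_inj. Qed.

Section Neighbourhoods.
Variables (R : realType) (n : nat) (p : R).
Hypothesis p01 : 0 <= p <= 1.
Notation P := (prob p (vpairs n)).

Lemma prob_cond_nbrs (v : 'I_n) (B : {set 'I_n} -> pred (graph n)) (Q : pred {set 'I_n})
    (eps : R) : 0 <= eps ->
  (forall S : {set 'I_n}, v \notin S -> Q S ->
     depends_on (~: star v) (B S) /\ P (B S) <= eps) ->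
  P (fun G => B (nbrs G v) G) <= P (fun G => ~~ Q (nbrs G v)) + eps.
Proof.
move=> eps0 boundB; pose good S := Q S && (v \notin S).
have sum_nbrs (F : {set 'I_n} -> R) (G : graph n) : G \subset vpairs n ->
    \sum_(S | good S) (nbrs G v == S)%:R * F S = (Q (nbrs G v))%:R * F (nbrs G v).
  move=> GV; case: (boolP (Q _)) => [QN|nQN].
    rewrite (bigD1 (nbrs G v)) /good ?QN ?nbrs_irr //= eqxx big1 ?addr0 // => S /andP[_].
    by rewrite eq_sym => /negbTE ->; rewrite mul0r.
  rewrite mul0r big1 // => S /andP[QS _]; case: eqP => [NS|_]; last by rewrite mul0r.
  by rewrite NS QS in nQN.
apply: (@le_trans _ _ (P (fun G => ~~ Q (nbrs G v)) +
    expect p (vpairs n) (fun G => \sum_(S | good S) (nbrs G v == S)%:R * (B S G)%:R))).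
  rewrite -expectD; apply: le_expect => // G GV; rewrite sum_nbrs //.
  by case: (Q _); case: (B _ _); rewrite /= ?mul1r ?mul0r ?addr0 ?add0r.
rewrite lerD2l expect_sum.
apply: (@le_trans _ _ (\sum_(S | good S) P (fun G => nbrs G v == S) * eps)).
  apply: ler_sum => S /andP[QS vS]; have [dB leB] := boundB S vS QS.
  rewrite (@expect_indep _ _ _ _ (star v) (~: star v)).
  - by rewrite ler_wpM2l ?prob_ge0.
  - by rewrite -setI_eq0 setICr.
  - by move=> G; rewrite nbrs_depends.
  - by move=> G; rewrite dB.
rewrite -mulr_suml -[leRHS]mul1r ler_wpM2r // -expect_sum -[leRHS](expect_cst p (vpairs n)).
apply: le_expect => // G GV; have := sum_nbrs (fun=> 1) G GV.
by under eq_bigr do rewrite mulr1; move=> ->; rewrite mulr1; case: (Q _).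
Qed.

Lemma prob_degree_ge (v : 'I_n) :
  P (fun G => 4 * (n%:R * p) <= #|nbrs G v|%:R) <= expR (- (n%:R * p)).
Proof.
have [p0 p1] := andP p01.
apply: (@le_trans _ _ (P (fun G => 2 * (n%:R * p) <= 1 / 2 * #|G :&: star_pairs v|%:R))).
  by apply: le_prob => // G GV; rewrite card_nbrs //; lra.
apply: le_trans (chernoff _ _ p01 (star_pairs_vpairs v)) _; rewrite ler_expR card_star_pairs.
have expR_half : expR (1 / 2) <= 2 :> R.
  rewrite -[expR _]invrK -expRN -[leRHS]invrK lef_pV2 ?posrE ?invr_gt0 ?expR_gt0 //.
  by apply: le_trans (expR_ge1Dx _); lra.
have : p * n.-1%:R <= n%:R * p by rewrite mulrC ler_wpM2r // ler_nat leq_pred.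
have : 0 <= p * n.-1%:R by rewrite mulr_ge0.
have : 0 <= expR (1 / 2) :> R by exact: expR_ge0.
nra.
Qed.

Lemma prob_degree_le (v : 'I_n) : (2 <= n)%N ->
  P (fun G => #|nbrs G v|%:R <= n%:R * p / 8) <= expR (- (n%:R * p / 8)).
Proof.
move=> n2; have [p0 p1] := andP p01.
apply: (@le_trans _ _ (P (fun G => - (n%:R * p / 8) <= -1 * #|G :&: star_pairs v|%:R))).
  by apply: le_prob => // G GV; rewrite card_nbrs //; lra.
apply: le_trans (chernoff _ _ p01 (star_pairs_vpairs v)) _; rewrite ler_expR card_star_pairs.
have expR_N1 : expR (-1) <= 1 / 2 :> R.
  rewrite expRN -[leRHS]invrK lef_pV2 ?posrE ?expR_gt0 //.
  by apply: le_trans (expR_ge1Dx _); lra.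
have : n%:R * p <= 2 * (p * n.-1%:R).
  by rewrite mulrCA mulrC ler_wpM2l // -natrM ler_nat; lia.
have : 0 <= p * n.-1%:R by rewrite mulr_ge0.
nra.
Qed.

Definition typical_degree d := n%:R * p / 8 < d%:R < 4 * (n%:R * p).

Lemma prob_atypical_degree (v : 'I_n) : (2 <= n)%N ->
  P (fun G => ~~ typical_degree #|nbrs G v|) <= 2 * expR (- (n%:R * p / 8)).
Proof.
move=> n2; have [p0 p1] := andP p01; have np0 : 0 <= n%:R * p by exact: mulr_ge0.
rewrite [_ * expR _]mulr_natl mulr2n; apply: le_trans (lerD (prob_degree_le v n2) _).
  apply: le_trans (prob_or_le p01 _ _ (fun G => 4 * (n%:R * p) <= #|nbrs G v|%:R)).
  by apply: le_prob => // G _; rewrite negb_and -!leNgt.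
by apply: le_trans (prob_degree_ge v) _; rewrite ler_expR; lra.
Qed.

End Neighbourhoods.

Lemma whp_forall_nbrs (R : realType) (alpha : R)
    (B : forall n, 'I_n -> {set 'I_n} -> pred (graph n)) (eps : R^nat) :
  0 < alpha < 1 ->
  (forall n (v : 'I_n) (S : {set 'I_n}), v \notin S -> depends_on (~: star v) (B n v S)) ->
  (\forall n \near \oo, forall v (S : {set 'I_n}), v \notin S ->
     typical_degree n (edge_prob alpha n) #|S| ->
     prob (edge_prob alpha n) (vpairs n) (B n v S) <= eps n) ->
  (n%:R * eps n) @[n --> \oo] --> (0 : R) -> (forall n, 0 <= eps n) ->
  whp (edge_prob alpha) (fun n G => forall v, ~~ B n v (nbrs G v) G).
Proof.
move=> /andP[alpha_gt0 alpha_lt1] dB leB eps0 eps_ge0.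
set p := edge_prob alpha; have p01 := edge_prob01 alpha_gt0.
apply: (@whp_of_le _ _ p01 _ (fun n => 2 * (n%:R ^+ 1 * expR (- (8^-1 * n%:R `^ (1 - alpha)))) +
   n%:R * eps n)); last first.
  rewrite -[0](addr0 (0 : R)); apply: cvgD => //.
  rewrite -[0](mulr0 (2 : R)); apply: cvgM; first exact: cvg_cst.
  by apply: cvg_natrX_expRN; rewrite ?subr_gt0.
near=> n; have n2 : (2 <= n)%N by near: n; exact: nbhs_infty_ge.
apply: (@le_trans _ _ (\sum_(v in 'I_n) (2 * expR (- (8^-1 * n%:R `^ (1 - alpha))) + eps n))).
  apply: le_trans (le_trans _ (gnp_exists_le p01 predT (fun v G => B n v (nbrs G v) G))) _.
    by apply: le_gnp => // G _ /existsNP[v /negP/negPn Bv]; exists v.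
  apply: ler_sum => v _; rewrite gnpE.
  apply: le_trans (prob_cond_nbrs (p01 n) (B := B n v) (eps_ge0 n)
    (Q := fun S => typical_degree n (p n) #|S|) _) _.
    move=> S vS typS; split; first exact: dB.
    by move: v S vS typS; near: n.
  rewrite lerD2r -mulr_edge_prob ?(leq_trans _ n2) // [8^-1 * _]mulrC.
  exact: prob_atypical_degree.
by rewrite sumr_const card_ord -[leLHS]mulr_natl expr1 mulrDr mulrCA.
Unshelve. all: by end_near. Qed.

(** * Neighbours and non-neighbours with or without a common neighbour *)

Definition nbr_type (V : finType) (adj : rel V) (x : V) (a c : bool) :=
  [exists y, [&& y != x, adj x y == a & pattern adj x y true true == c]].

Definition joined n (S : {set 'I_n}) (G : graph n) x := [exists z in S, adj_of G x z].

Definition no_nbr_type a c n (v : 'I_n) (S : {set 'I_n}) (G : graph n) :=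
  [forall y in if a then S else ~: (v |: S), joined S G y != c].

Lemma nbr_typeE n (G : graph n) v a c : G \subset vpairs n ->
  nbr_type (adj_of G) v a c = ~~ no_nbr_type a c v (nbrs G v) G.
Proof.
move=> GV; have irr := adj_of_irr GV.
rewrite negb_forall; apply: eq_existsb => y; rewrite negb_imply negbK andbA; congr andb.
  by case: a; rewrite !inE ?eqb_id ?eqbF_neg ?negb_or //; case: eqP => // ->; rewrite irr.
congr (_ == c); apply: eq_existsb => z; rewrite inE !eqb_id (adj_of_sym G z v) (adj_of_sym G z y).
case: (eqVneq z v) => [->|_]; first by rewrite irr.
by case: (eqVneq z y) => [->|_]; rewrite ?irr ?andbF.
Qed.

Lemma no_nbr_type_depends a c n (v : 'I_n) (S : {set 'I_n}) : v \notin S ->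
  depends_on (~: star v) (no_nbr_type a c v S).
Proof.
move=> vS G; have neq_v y : y \in S -> y != v by apply: contraTneq => ->.
apply: eq_forallb_in => y yS; congr (_ != _); apply: eq_existsb_in => z /neq_v zv.
have yv : y != v by case: (a) yS => [/neq_v//|]; rewrite !inE negb_or => /andP[].
by rewrite /adj_of !inE negb_or (eq_sym v y) yv (eq_sym v z) zv !andbT.
Qed.

Definition pairs_in n (S : {set 'I_n}) : graph n :=
  [set e : {set 'I_n} | (e \subset S) && (#|e| == 2)].

Lemma card_pairs_in n (S : {set 'I_n}) : #|pairs_in S| = 'C(#|S|, 2).
Proof. by rewrite -cards_draws. Qed.

Lemma pairs_in_vpairs n (S : {set 'I_n}) : pairs_in S \subset vpairs n.
Proof. by apply/subsetP => e; rewrite !inE => /andP[]. Qed.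

Lemma pair_pairs_in n (S : {set 'I_n}) x y :
  ([set x; y] \in pairs_in S) = [&& x \in S, y \in S & x != y].
Proof. by rewrite inE subUset !sub1set cards2 -andbA; case: (x != y). Qed.

Lemma pairs_in_disjoint n (A B : {set 'I_n}) : [disjoint A & B] ->
  [disjoint pairs_in A & pairs_in B].
Proof.
move=> AB; rewrite -setI_eq0; apply/eqP/setP => e; rewrite !inE; apply/negbTE/negP.
move=> /andP[/andP[eA /eqP e2] /andP[eB _]].
have /card_gt0P[x xe] : (0 < #|e|)%N by rewrite e2.
by have := disjointFr AB (subsetP eA x xe); rewrite (subsetP eB x xe).
Qed.

Lemma subset_of_card (T : finType) (S : {set T}) k : (k <= #|S|)%N ->
  exists2 B : {set T}, B \subset S & #|B| = k.
Proof.
move=> kS; have /card_gt0P[B] : (0 < #|[set B : {set T} | B \subset S & #|B| == k]|)%N.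
  by rewrite cards_draws bin_gt0.
by rewrite inE => /andP[BS /eqP]; exists B.
Qed.

Lemma disjoint_blocks (T : finType) (S : {set T}) l K : (K * l <= #|S|)%N ->
  exists B : 'I_K -> {set T}, [/\ forall i, B i \subset S, forall i, #|B i| = l &
    forall i j, i != j -> [disjoint B i & B j]].
Proof.
elim: K S => [|K IH] S; first by exists (fun=> set0); split=> -[].
rewrite mulSn => KS; have [|B0 B0S cB0] := @subset_of_card _ S l.
  exact: leq_trans (leq_addr _ _) KS.
have [|B [BS cB dB]] := IH (S :\: B0).
  by rewrite cardsD (setIidPr B0S) cB0 leq_subRL // (leq_trans _ KS) ?leq_addr.
have B0B i : [disjoint B0 & B i] by rewrite (disjointWr (BS i)) ?disjoint_setDr.
exists (fun i => if unlift ord0 i is Some j then B j else B0); split=> [i|i|i j].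
- by case: unliftP => // j _; apply: subset_trans (BS j) (subsetDl _ _).
- by case: unliftP.
- case: unliftP => [i' ->|->]; case: unliftP => [j' ->|->] //; last by rewrite disjoint_sym.
  by rewrite (inj_eq lift_inj); exact: dB.
Qed.

Section NbrTypeProbability.
Variables (R : realFieldType) (n : nat) (p : R).
Hypothesis p01 : 0 <= p <= 1.
Notation P := (prob p (vpairs n)).

Lemma prob_all_joined (A S : {set 'I_n}) : [disjoint A & S] ->
  P (fun G => [forall x in A, joined S G x]) = (1 - (1 - p) ^+ #|S|) ^+ #|A|.
Proof.
move=> AS; pose E (x : 'I_n) : graph n := [set [set x; z] | z in S].
have EV x : x \in A -> E x \subset vpairs n.
  move=> xA; apply/subsetP => e /imsetP[z zS ->]; rewrite pair_vpairs.
  by apply: contraTneq zS => <-; rewrite (disjointFr AS xA).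
have joinedE G x : joined S G x = (G :&: E x != set0).
  apply/exists_inP/set0Pn => [[y yS xy]|[e /setIP[eG /imsetP[y yS ey]]]].
    by exists [set x; y]; rewrite inE [_ \in G]xy; apply/imsetP; exists y.
  by exists y; rewrite // /adj_of -ey.
rewrite (@prob_forall_indep _ _ _ _ _ _ E).
- rewrite -prodr_const; apply: eq_bigr => x xA.
  rewrite (@eq_prob _ _ _ _ _ (predC (fun G => G :&: E x == set0))) => [|G _]; last exact: joinedE.
  rewrite probC prob_setI_eq ?sub0set ?EV // cards0 expr0 mul1r setD0 card_imset //.
  exact: set2_inj.
- by move=> x _ G; rewrite !joinedE -setIA setIid.
- move=> x y xA yA xy; rewrite -setI_eq0; apply/eqP/setP => e; rewrite !inE.
  apply/negbTE/negP => /andP[/imsetP[z zS ->] /imsetP[w wS E_eq]].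
  have := set21 x z; rewrite E_eq !inE (negbTE xy) /= => /eqP xw.
  by move: (disjointFr AS xA); rewrite xw wS.
Qed.

Lemma prob_no_common_free_non_nbr (v : 'I_n) (S : {set 'I_n}) : v \notin S ->
  P (no_nbr_type false false v S) = (1 - (1 - p) ^+ #|S|) ^+ (n - #|S|.+1).
Proof.
move=> vS; have disj : [disjoint ~: (v |: S) & S].
  by rewrite disjoint_sym disjoints_subset setCK subsetUr.
have -> : (n - #|S|.+1)%N = #|~: (v |: S)| by rewrite [RHS]cardsCs setCK cardsU1 vS card_ord.
rewrite -prob_all_joined //; apply: eq_prob => G _; apply: eq_forallb => x.
by rewrite eqbF_neg negbK.
Qed.

Lemma prob_no_common_nbr (v : 'I_n) (S : {set 'I_n}) :
  P (no_nbr_type true true v S) <= (1 - p) ^+ 'C(#|S|, 2).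
Proof.
apply: (@le_trans _ _ (P (fun G => G :&: pairs_in S == set0))); last first.
  by rewrite prob_setI_eq ?sub0set ?pairs_in_vpairs // cards0 expr0 mul1r setD0 card_pairs_in.
apply: le_prob => // G _ /forall_inP noJ; apply/eqP/setP => e; rewrite in_set0.
apply/negbTE/setIP => -[eG eS]; have := eS; rewrite inE => /andP[_ /cards2P[x [y [xy exy]]]].
move: eS; rewrite exy pair_pairs_in => /and3P[xS yS _].
move/negP: (noJ x xS); apply; rewrite eqb_id.
by apply/exists_inP; exists y; rewrite // /adj_of -exy.
Qed.

Lemma prob_blocks_spanning K l (B : 'I_K -> {set 'I_n}) : (forall i, #|B i| = l) ->
  (forall i j, i != j -> [disjoint B i & B j]) ->
  P (fun G => [forall i in [set: 'I_K], G :&: pairs_in (B i) != set0]) <= (l%:R ^+ 2 * p) ^+ K.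
Proof.
move=> cB dB; rewrite (@prob_forall_indep _ _ _ _ _ _ (fun i => pairs_in (B i))); first last.
- by move=> i j _ _ /dB; exact: pairs_in_disjoint.
- by move=> i _ G; rewrite -setIA setIid.
apply: (@le_trans _ _ (\prod_(i in [set: 'I_K]) (l%:R ^+ 2 * p))); last first.
  by rewrite prodr_const cardsT card_ord.
apply: ler_prod => i _; rewrite prob_ge0 //=.
rewrite (@probC _ _ _ _ (fun G => G :&: pairs_in (B i) == set0)).
rewrite prob_setI_eq ?sub0set ?pairs_in_vpairs // cards0 expr0 mul1r setD0 card_pairs_in cB.
apply: (le_trans (bernoulli_onem _ p01)); have /andP[p0 _] := p01.
rewrite ler_wpM2r // -natrX ler_nat bin2 -divn2.
by rewrite (leq_trans (leq_div _ _)) // expnS expn1 leq_mul ?leq_pred.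
Qed.

(* Split [K] blocks of size [l] off [S]. Blocks span edges independently of each
   other, and in a block without edges every vertex needs a neighbour in the rest
   of [S], again independently. *)
Lemma prob_no_common_free_nbr (v : 'I_n) (S : {set 'I_n}) K l : (K * l <= #|S|)%N ->
  P (no_nbr_type true false v S) <=
  (l%:R ^+ 2 * p) ^+ K + K%:R * (1 - (1 - p) ^+ (#|S| - l)) ^+ l.
Proof.
move=> KS; have [B [BS cB dB]] := disjoint_blocks KS.
pose all_span G := [forall i in [set: 'I_K], G :&: pairs_in (B i) != set0].
pose attached i G := [forall x in B i, joined (S :\: B i) G x].
apply: (@le_trans _ _ (P all_span + \sum_(i : 'I_K) P (attached i))); last first.
  apply: lerD; first exact: prob_blocks_spanning.
  rewrite (eq_bigr (fun=> (1 - (1 - p) ^+ (#|S| - l)) ^+ l)).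
    by rewrite sumr_const card_ord mulr_natl.
  by move=> i _; rewrite prob_all_joined ?disjoint_setDr // cardsD (setIidPr (BS i)) cB.
apply: le_trans (lerD (lexx _) (prob_exists_le p01 _ predT attached)).
apply: le_trans (prob_or_le p01 _ _ _); apply: le_prob => // G GV /forall_inP joinS /=.
rewrite -implyNb; apply/implyP; rewrite negb_forall => /existsP[i]; rewrite inE /= negbK => Bi0.
apply/existsP; exists i; apply/forall_inP => x xB.
have := joinS x (subsetP (BS i) x xB); rewrite eqbF_neg negbK => /exists_inP[y yS xy].
apply/exists_inP; exists y => //; rewrite inE yS andbT; apply/negP => yB.
move/eqP/setP: Bi0 => /(_ [set x; y]); rewrite inE [_ \in G]xy pair_pairs_in xB yB !inE /=.
by move=> /negbFE/eqP yx; rewrite yx adj_of_irr in xy.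
Qed.

End NbrTypeProbability.

Section NbrTypeThreshold.
Variables (R : realType) (alpha : R).
Hypothesis alpha01 : 0 < alpha < 1.
Let alpha_gt0 : 0 < alpha. Proof. by have /andP[] := alpha01. Qed.
Let alpha_lt1 : alpha < 1. Proof. by have /andP[] := alpha01. Qed.
Notation p := (edge_prob alpha).

Lemma whp_nbr_type a c (eps : R^nat) :
  (\forall n \near \oo, forall v (S : {set 'I_n}), v \notin S -> typical_degree n (p n) #|S| ->
    prob (p n) (vpairs n) (no_nbr_type a c v S) <= eps n) ->
  (n%:R * eps n) @[n --> \oo] --> (0 : R) -> (forall n, 0 <= eps n) ->
  whp p (fun n G => forall v, nbr_type (adj_of G) v a c).
Proof.
move=> bound eps0 eps_ge0.
have := whp_forall_nbrs (B := no_nbr_type a c) alpha01 _ bound eps0 eps_ge0.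
move=> /(_ (no_nbr_type_depends a c)); apply: whp_mono; first exact: edge_prob01.
by near=> n => G GV typeN v; rewrite nbr_typeE.
Unshelve. all: by end_near. Qed.

Lemma whp_common_nbr : alpha < 2 / 3 ->
  whp p (fun n G => forall v, nbr_type (adj_of G) v true true).
Proof.
move=> alpha23; have np_gt0 : 0 < 1 - alpha by rewrite subr_gt0.
apply: (@whp_nbr_type _ _ (fun n => expR (- (256^-1 * n%:R `^ (2 - 3 * alpha))))).
- near=> n => v S _ /andP[S_gt _]; apply: le_trans (prob_no_common_nbr _ _ _) _.
    exact: edge_prob01.
  have n0 : (0 < n)%N by near: n; exact: nbhs_infty_gt.
  have [p0 p1] := andP (edge_prob01 alpha_gt0 n).
  apply: le_trans (expr_onem_le_expR _ p1) _; rewrite ler_expR lerN2.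
  have np16 : 16 <= n%:R * p n.
    by rewrite mulr_edge_prob //; near: n; exact: near_ge_natr_powR.
  have -> : n%:R `^ (2 - 3 * alpha) = p n * (n%:R * p n) ^+ 2.
    by rewrite mulr_edge_prob // natr_powRX natr_powRD //; congr (_ `^ _); ring.
  have S2 : 2 <= #|S|%:R :> R by lra.
  have -> : 'C(#|S|, 2)%:R = #|S|%:R * (#|S|%:R - 1) / 2 :> R.
    rewrite bin2 -[in RHS](natrB _ (n := 1)); last by rewrite -(ler_nat R); lra.
    rewrite subn1 -natrM -[X in X%:R / _]odd_double_half.
    have -> : odd (#|S| * #|S|.-1) = false by case: #|S| => // k; rewrite oddM /= andNb.
    by rewrite add0n -muln2 natrM mulfK.
  have : (n%:R * p n) ^+ 2 <= (8 * #|S|%:R) ^+ 2.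
    by apply: lerXn2r; rewrite ?nnegrE ?mulr_ge0 //; lra.
  rewrite [256^-1 * _]mulrCA ler_wpM2l //; nra.
- under eq_fun do rewrite -[n in n * _]expr1.
  by apply: cvg_natrX_expRN => //; lra.
- by move=> n; exact: expR_ge0.
Unshelve. all: by end_near. Qed.

Hypothesis alpha_ge_half : 1 / 2 <= alpha.

Lemma typical_degree_onem_ge : \forall n \near \oo, forall d,
  typical_degree n (p n) d -> expR (-8) <= (1 - p n) ^+ d.
Proof.
near=> n => d /andP[_ d_lt].
have n0 : (0 < n)%N by near: n; exact: nbhs_infty_gt.
have p2 : p n <= 1 / 2 by near: n; apply: near_edge_prob_le.
have [p0 p1] := andP (edge_prob01 alpha_gt0 n).
apply: le_trans (expr_onem_ge_expR _ p0 p2); rewrite ler_expR lerN2.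
have : n%:R * p n * p n <= 1.
  rewrite mulr_edge_prob // natr_powRD // -[leRHS](powRr0 n%:R) ler_natr_powR //.
  by have := alpha_ge_half; lra.
nra.
Unshelve. all: by end_near. Qed.

Lemma whp_common_free_non_nbr : whp p (fun n G => forall v, nbr_type (adj_of G) v false false).
Proof.
pose c : R := expR (-8); have c0 : 0 < c by exact: expR_gt0.
have c1 : c <= 1 by rewrite -[leRHS]expR0 ler_expR; lra.
apply: (@whp_nbr_type _ _ (fun n => expR (- (c / 2 * n%:R `^ 1)))).
- near=> n.
  have typical_ge d : typical_degree n (p n) d -> c <= (1 - p n) ^+ d.
    by move: d; near: n; exact: typical_degree_onem_ge.
  move=> v S vS typS; rewrite prob_no_common_free_non_nbr //.
  have n4 : (4 <= n)%N by near: n; exact: nbhs_infty_ge.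
  have p_small : p n <= 1 / 16 by near: n; apply: near_edge_prob_le => //; lra.
  have [p0 p1] := andP (edge_prob01 alpha_gt0 n).
  apply: (@le_trans _ _ ((1 - c) ^+ (n - #|S|.+1))).
    apply: lerXn2r; rewrite ?nnegrE ?subr_ge0 ?exprn_ile1 ?subr_ge0 ?gerBl //.
    by rewrite lerD2l lerN2 typical_ge.
  apply: le_trans (expr_onem_le_expR _ c1) _.
  rewrite ler_expR lerN2 powRr1 // -mulrA ler_wpM2l ?ltW // mulrC.
  have n4R : 4 <= n%:R :> R by rewrite ler_nat.
  have S_lt : #|S|%:R < n%:R / 4 :> R by have /andP[_] := typS; nra.
  have : n%:R <= (n - #|S|.+1)%:R + (#|S|%:R + 1) :> R.
    by rewrite natr1 -natrD ler_nat addnC -leq_subLR.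
  lra.
- under eq_fun do rewrite -[n in n * _]expr1.
  by apply: cvg_natrX_expRN => //; rewrite divr_gt0.
- by move=> n; exact: expR_ge0.
Unshelve. all: by end_near. Qed.

Let block_exponent : R := (1 - alpha) / 4.
Let block_size n := Num.truncn (n%:R `^ block_exponent : R).

Lemma block_size_le n : (block_size n)%:R <= n%:R `^ block_exponent.
Proof. by rewrite truncn_le // powR_ge0. Qed.

Lemma near_blocks_fit : \forall n \near \oo, forall d,
  typical_degree n (p n) d -> (5 * block_size n <= d)%N.
Proof.
have exponent_gt0 : 0 < 3 * block_exponent.
  by rewrite mulr_gt0 // divr_gt0 // subr_gt0 alpha_lt1.
near=> n => d /andP[d_gt _]; rewrite -(ler_nat R) natrM.
have n0 : (0 < n)%N by near: n; exact: nbhs_infty_gt.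
have large : 40 <= n%:R `^ (3 * block_exponent) :> R by near: n; exact: near_ge_natr_powR.
have npE : n%:R * p n = n%:R `^ block_exponent * n%:R `^ (3 * block_exponent).
  by rewrite mulr_edge_prob // natr_powRD //; congr (_ `^ _); rewrite /block_exponent; field.
have := block_size_le n; rewrite {}npE in d_gt; have := powR_ge0 (n%:R : R) block_exponent.
nra.
Unshelve. all: by end_near. Qed.

Lemma near_blocks_sparse :
  \forall n \near \oo, (block_size n)%:R ^+ 2 * p n <= n%:R `^ (- (1 / 4)).
Proof.
near=> n; have n0 : (0 < n)%N by near: n; exact: nbhs_infty_gt.
apply: (@le_trans _ _ ((n%:R `^ block_exponent) ^+ 2 * p n)).
  rewrite ler_wpM2r ?powR_ge0 // lerXn2r ?nnegrE ?powR_ge0 //; exact: block_size_le.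
rewrite natr_powRX natr_powRD // ler_natr_powR // /block_exponent.
by have := alpha_ge_half; lra.
Unshelve. all: by end_near. Qed.

Lemma whp_common_free_nbr : whp p (fun n G => forall v, nbr_type (adj_of G) v true false).
Proof.
have exponent_gt0 : 0 < block_exponent by rewrite divr_gt0 // subr_gt0 alpha_lt1.
pose c : R := expR (-8); have c0 : 0 < c by exact: expR_gt0.
have c1 : c <= 1 by rewrite -[leRHS]expR0 ler_expR; lra.
pose attached_bound n : R := expR c * expR (- (c * n%:R `^ block_exponent)).
apply: (@whp_nbr_type _ _ (fun n => n%:R `^ (- (5 / 4)) + 5 * attached_bound n)).
- near=> n.
  have sparse : (block_size n)%:R ^+ 2 * p n <= n%:R `^ (- (1 / 4)).
    by near: n; exact: near_blocks_sparse.
  have fit d : typical_degree n (p n) d -> (5 * block_size n <= d)%N.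
    by move: d; near: n; exact: near_blocks_fit.
  have typical_ge d : typical_degree n (p n) d -> c <= (1 - p n) ^+ d.
    by move: d; near: n; exact: typical_degree_onem_ge.
  have p01 := edge_prob01 alpha_gt0 n; have [p0 p1] := andP p01.
  move=> v S vS typS; apply: le_trans (prob_no_common_free_nbr p01 v (fit _ typS)) _.
  apply: lerD; last rewrite ler_wpM2l //.
    rewrite [_ `^ _](_ : _ = (n%:R `^ (- (1 / 4))) ^+ 5) ?lerXn2r ?nnegrE ?powR_ge0 //.
      by rewrite mulr_ge0 ?exprn_ge0.
    by rewrite natr_powRX; congr (_ `^ _); field.
  apply: (@le_trans _ _ ((1 - c) ^+ block_size n)).
    apply: lerXn2r; rewrite ?nnegrE ?subr_ge0 ?exprn_ile1 ?subr_ge0 ?gerBl //.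
    rewrite lerD2l lerN2; apply: le_trans (typical_ge _ typS) _.
    by rewrite ler_wiXn2l ?subr_ge0 ?gerBl ?leq_subr.
  apply: le_trans (expr_onem_le_expR _ c1) _; rewrite /attached_bound -expRD ler_expR.
  have : n%:R `^ block_exponent < (block_size n)%:R + 1 by rewrite natr1; exact: truncnS_gt.
  nra.
- rewrite [X in X @ _ --> _](_ : _ = (fun n => n%:R `^ (- (1 / 4)) + 5 * expR c *
      (n%:R ^+ 1 * expR (- (c * n%:R `^ block_exponent))))).
    rewrite -[0](addr0 (0 : R)); apply: cvgD; first by apply: cvg_natr_powRN; lra.
    rewrite -[0](mulr0 (5 * expR c)); apply: cvgM; first exact: cvg_cst.
    exact: cvg_natrX_expRN.
  apply/funext => -[|n]; first by rewrite expr1 !mul0r mulr0 addr0 powR0 //; lra.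
  rewrite expr1 /attached_bound mulrDr -{1}[n.+1%:R]powRr1 // natr_powRD //.
  by congr (_ `^ _ + _); [lra|ring].
- by move=> n; rewrite addr_ge0 ?powR_ge0 // mulr_ge0 // mulr_ge0 ?expR_ge0.
Unshelve. all: by end_near. Qed.

End NbrTypeThreshold.

(** * Triangles *)

Lemma pairs_in_subP n (A : {set 'I_n}) (G : graph n) :
  reflect {in A &, forall x y, x != y -> adj_of G x y} (pairs_in A \subset G).
Proof.
apply: (iffP subsetP) => [AG x y xA yA xy|adjA e].
  by apply: AG; rewrite pair_pairs_in xA yA.
rewrite inE => /andP[eA /cards2P[x [y [xy exy]]]]; rewrite exy.
by apply: adjA; rewrite // (subsetP eA) // exy ?set21 ?set22.
Qed.

Definition triangles n (G : graph n) :=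
  [set A : {set 'I_n} | (#|A| == 3%N) && (pairs_in A \subset G)].

Lemma triangle_set n (G : graph n) x y z : G \subset vpairs n ->
  adj_of G x y -> adj_of G y z -> adj_of G x z -> [set x; y; z] \in triangles G.
Proof.
move=> GV xy yz xz; have irr := adj_of_irr GV.
have neq a b : adj_of G a b -> a != b by apply: contraTneq => ->; rewrite irr.
rewrite inE -setUA cardsU1 cards2 !inE negb_or !neq //=; apply/pairs_in_subP => a b.
by rewrite !inE => /or3P[] /eqP -> /or3P[] /eqP ->; rewrite ?eqxx // adj_of_sym.
Qed.

Lemma in_trianglesP n (G : graph n) x A : A \in triangles G -> x \in A ->
  exists y z, [/\ adj_of G x y, adj_of G y z & adj_of G x z].
Proof.
rewrite inE => /andP[/eqP A3 /pairs_in_subP adjA] xA.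
have /eqP/cards2P[y [z [yz Ayz]]] : #|A :\ x| = 2 by move: A3; rewrite (cardsD1 x) xA => -[].
have : y \in A :\ x by rewrite Ayz set21.
have : z \in A :\ x by rewrite Ayz set22.
rewrite !inE => /andP[zx zA] /andP[yx yA].
by exists y, z; split; apply: adjA; rewrite // eq_sym.
Qed.

Lemma nbr_type_triangle n (G : graph n) v : G \subset vpairs n ->
  nbr_type (adj_of G) v true true = (v \in cover (triangles G)).
Proof.
move=> GV; have irr := adj_of_irr GV.
apply/existsP/bigcupP => [[y /and3P[_ /eqP vy /eqP/existsP[z]]]|[A AG vA]].
  move=> /and4P[_ _ /eqP zv /eqP zy]; exists [set v; y; z]; last by rewrite !inE eqxx.
  by apply: triangle_set => //; rewrite adj_of_sym.
have [y [z [vy yz vz]]] := in_trianglesP AG vA.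
exists y; rewrite vy /=; apply/andP; split.
  by apply: contraTneq vy => ->; rewrite irr.
apply/eqP/existsP; exists z; rewrite !(adj_of_sym G z) vz yz.
by rewrite !andbT; apply/andP; split; [move: vz|move: yz]; apply: contraTneq => ->; rewrite irr.
Qed.

Section TriangleMoments.
Variables (R : realFieldType) (n : nat) (p : R).
Hypothesis p01 : 0 <= p <= 1.
Notation P := (prob p (vpairs n)).
Implicit Types A B : {set 'I_n}.

Definition mean_triangles : R := 'C(n, 3)%:R * p ^+ 3.

Lemma sum_triples (c : R) : \sum_(A : {set 'I_n} | #|A| == 3%N) c = 'C(n, 3)%:R * c.
Proof.
rewrite (eq_bigl (mem [set A : {set 'I_n} | #|A| == 3%N])) => [|A]; last by rewrite !inE.
by rewrite sumr_const card_draws card_ord mulr_natl.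
Qed.

Lemma card_trianglesE (G : graph n) :
  #|triangles G|%:R = \sum_(A : {set 'I_n} | #|A| == 3%N) (pairs_in A \subset G)%:R :> R.
Proof.
rewrite -sum1_card natr_sum.
rewrite (eq_bigl (fun A : {set 'I_n} => (#|A| == 3%N) && (pairs_in A \subset G))) => [|A].
  by rewrite big_mkcondr; apply: eq_bigr => A _; case: (_ \subset _).
by rewrite inE.
Qed.

Lemma expect_triangles : expect p (vpairs n) (fun G => #|triangles G|%:R) = mean_triangles.
Proof.
rewrite (eq_expect _ (fun G _ => card_trianglesE G)) expect_sum -[RHS]sum_triples.
apply: eq_bigr => A /eqP A3.
by rewrite -/(P (fun G => pairs_in A \subset G)) prob_superset ?pairs_in_vpairs // card_pairs_in A3.
Qed.

Lemma card_triples_meeting2 A : #|A| = 3%N ->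
  (#|[set B : {set 'I_n} | (#|B| == 3%N) && (#|A :&: B| == 2%N)]| <= 3 * n)%N.
Proof.
move=> A3; pose swap ab := ab.2 |: (A :\ ab.1).
apply: (@leq_trans #|[set swap ab | ab in setX A [set: 'I_n]]|); last first.
  by apply: leq_trans (leq_imset_card _ _) _; rewrite cardsX A3 cardsT card_ord.
apply/subset_leq_card/subsetP => B; rewrite inE => /andP[/eqP B3 /eqP AB].
have /cards1P[a Aa] : #|A :\: B| == 1%N by rewrite cardsD AB A3.
have /cards1P[b Bb] : #|B :\: A| == 1%N by rewrite cardsD setIC AB B3.
have /setDP[aA _] : a \in A :\: B by rewrite Aa set11.
apply/imsetP; exists (a, b); first by rewrite !inE aA.
apply/setP => x /=; move/setP: Aa => /(_ x); move/setP: Bb => /(_ x); rewrite !inE.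
by case: (x \in A); case: (x \in B) => /= <- <-.
Qed.

Lemma prob_two_triangles_le A B : #|A| = 3%N -> #|B| = 3%N ->
  P (fun G => pairs_in A :|: pairs_in B \subset G) <=
  p ^+ 6 + ((B == A)%:R * p ^+ 3 + (#|A :&: B| == 2%N)%:R * p ^+ 5).
Proof.
have [p0 p1] := andP p01; move=> A3 B3.
rewrite prob_superset ?subUset ?pairs_in_vpairs // cardsU !card_pairs_in A3 B3.
have -> : pairs_in A :&: pairs_in B = pairs_in (A :&: B).
  by apply/setP => e; rewrite !inE subsetI andbACA andbb.
have [p3 p5 p6] : [/\ 0 <= p ^+ 3, 0 <= p ^+ 5 & 0 <= p ^+ 6] by rewrite !exprn_ge0.
rewrite card_pairs_in; have := subset_leq_card (subsetIl A B); rewrite A3.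
case AB : #|A :&: B| => [|[|[|[|//]]]] _; rewrite /= ?mul0r ?mul1r ?addr0 ?lerDl ?mulr_ge0 //.
  by rewrite -[leLHS]add0r lerD // lerDr mulr_ge0.
suff -> : B == A by rewrite mul1r lerDr.
rewrite eq_sym eqEcard A3 B3 leqnn andbT; apply/setIidPl/eqP.
by rewrite eqEcard subsetIl AB A3.
Qed.

Lemma expect_triangles_sq_le : expect p (vpairs n) (fun G => #|triangles G|%:R ^+ 2) <=
  mean_triangles ^+ 2 + mean_triangles * (1 + 3 * n%:R * p ^+ 2).
Proof.
have [p0 p1] := andP p01.
rewrite (@eq_expect _ _ p _ _ (fun G => \sum_(A : {set 'I_n} | #|A| == 3%N)
    \sum_(B : {set 'I_n} | #|B| == 3%N)
    (pairs_in A :|: pairs_in B \subset G)%:R)); last first.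
  move=> G _; rewrite card_trianglesE expr2 big_distrlr /=.
  by apply: eq_bigr => A _; apply: eq_bigr => B _; rewrite subUset -natrM mulnb.
rewrite expect_sum (_ : _ + _ = 'C(n, 3)%:R *
    (p ^+ 3 * mean_triangles + (p ^+ 3 + 3 * n%:R * p ^+ 5))); last first.
  by rewrite /mean_triangles; ring.
rewrite -sum_triples; apply: ler_sum => A /eqP A3; rewrite expect_sum.
apply: (@le_trans _ _ (\sum_(B : {set 'I_n} | #|B| == 3%N) (p ^+ 6 +
    ((B == A)%:R * p ^+ 3 + (#|A :&: B| == 2%N)%:R * p ^+ 5)))).
  by apply: ler_sum => B /eqP; exact: prob_two_triangles_le.
rewrite !big_split /= -!mulr_suml sum_triples.
apply: lerD; first by rewrite /mean_triangles le_eqVlt; apply/orP; left; apply/eqP; ring.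
apply: lerD; rewrite -natr_sum.
  by rewrite (bigD1 A) ?A3 //= eqxx big1 ?mul1r // => B /andP[_ /negbTE ->].
rewrite ler_wpM2r ?exprn_ge0 // -natrM ler_nat.
apply: leq_trans (card_triples_meeting2 A3); rewrite -sum1_card big_mkcond [leqRHS]big_mkcond /=.
by apply: leq_sum => B _; rewrite inE; case: (#|B| == _); case: (_ == _).
Qed.

End TriangleMoments.

Lemma expr3_le_bin3 n : (6 <= n)%N -> (n ^ 3 <= 24 * 'C(n, 3))%N.
Proof.
move=> n6; have := bin_ffact n 3; rewrite !ffactnS ffactn0 muln1 (_ : 3`! = 6)%N //.
case: n n6 => [|[|[|[|[|[|n]]]]]] // _ /= binE.
rewrite (_ : 24 = 4 * 6)%N // -mulnA [(6 * _)%N]mulnC binE !expnS expn0; nia.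
Qed.

Lemma bin3_le_expr3 n : (6 * 'C(n, 3) <= n ^ 3)%N.
Proof.
rewrite mulnC; have := bin_ffact n 3; rewrite (_ : 3`! = 6)%N // => ->.
rewrite !ffactnS ffactn0 muln1 !expnS expn0 muln1.
by rewrite !leq_mul // !(leq_trans (leq_pred _)).
Qed.

Section TriangleThreshold.
Variables (R : realType) (alpha : R).
Hypothesis alpha_gt0 : 0 < alpha.
Notation p := (edge_prob alpha).
Notation X := (fun G => #|triangles G|%:R).

Definition triangle_dispersion n : R :=
  24 * n%:R `^ (- (3 * (1 - alpha))) + 72 * n%:R `^ (- (2 - alpha)).

Lemma mean_triangles_gt0 n : (6 <= n)%N -> 0 < mean_triangles n (p n).
Proof.
by move=> n6; rewrite mulr_gt0 ?exprn_gt0 ?powR_gt0 // ltr0n ?bin_gt0 (leq_trans _ n6).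
Qed.

Lemma expect_triangles_sq_le_dispersion n : (6 <= n)%N ->
  expect (p n) (vpairs n) (fun G => #|triangles G|%:R ^+ 2) <=
  (1 + triangle_dispersion n) * mean_triangles n (p n) ^+ 2.
Proof.
move=> n6; apply: (le_trans (expect_triangles_sq_le _ (edge_prob01 alpha_gt0 n))).
set mu := mean_triangles n (p n); have mu0 : 0 < mu by exact: mean_triangles_gt0.
rewrite [leRHS]mulrDl mul1r lerD2l [mu ^+ 2]expr2 [leRHS]mulrCA ler_wpM2l ?(ltW mu0) //.
have n0 : (0 < n)%N by apply: leq_trans n6.
have P0 : 0 < p n by rewrite powR_gt0 ?ltr0n.
have N0 : 0 < n%:R :> R by rewrite ltr0n.
pose Q := n%:R ^+ 3 * p n ^+ 3; have Q0 : 0 < Q by rewrite mulr_gt0 ?exprn_gt0.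
have Q_le : Q <= 24 * mu.
  rewrite /Q /mu /mean_triangles mulrA ler_wpM2r ?exprn_ge0 ?(ltW P0) //.
  by rewrite -natrX -natrM ler_nat expr3_le_bin3.
rewrite /triangle_dispersion.
have -> : n%:R `^ (- (3 * (1 - alpha))) = Q^-1.
  by rewrite powRN /Q mulrX_edge_probX //; congr ((_ `^ _)^-1); ring.
have -> : n%:R `^ (- (2 - alpha)) = n%:R * p n ^+ 2 / Q.
  have -> : n%:R * p n ^+ 2 / Q = (n%:R ^+ 2 * p n ^+ 1)^-1.
    by rewrite /Q; field; rewrite !gt_eqF.
  by rewrite powRN mulrX_edge_probX // mulr1.
have : 1 <= 24 * mu / Q by rewrite ler_pdivlMr // mul1r.
have : 0 <= n%:R * p n ^+ 2 by rewrite mulr_ge0 ?exprn_ge0 ?(ltW P0).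
rewrite -!(mulrA 3); set w := n%:R * _ => w0 ratio.
rewrite [leRHS](_ : _ = (1 + 3 * w) * (24 * mu / Q)); [nra|by ring].
Qed.

Lemma whp_triangles_concentrated : alpha < 1 ->
  whp p (fun n G => `|#|triangles G|%:R - mean_triangles n (p n)| < mean_triangles n (p n)).
Proof.
move=> alpha_lt1; have p01 := edge_prob01 alpha_gt0.
apply: whp_mono (whp_concentrated p01 (X := fun n => X) (delta := triangle_dispersion)
  ltr01 _ _ _) => //.
- by near=> n => G _; rewrite expect_triangles mul1r.
- near=> n; rewrite expect_triangles mean_triangles_gt0 //.
  by near: n; exact: nbhs_infty_ge.
- near=> n; rewrite expect_triangles expect_triangles_sq_le_dispersion //.
  by near: n; exact: nbhs_infty_ge.
- by rewrite -[0](addr0 (0 : R)); apply: cvgD; apply: cvg_natr_powRNZ; lra.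
Unshelve. all: by end_near. Qed.

Lemma gnp_triangle_ge n : alpha = 1 -> (6 <= n)%N ->
  97^-1 <= gnp p (fun G : graph n => triangles G != set0).
Proof.
move=> alpha1 n6; rewrite gnpE.
rewrite (@eq_prob _ _ _ _ _ (fun G => #|triangles G|%:R != 0 :> R)) => [|G _]; last first.
  by rewrite pnatr_eq0 cards_eq0.
apply: prob_neq0_ge; rewrite ?expect_triangles ?mean_triangles_gt0 ?edge_prob01 //.
apply: le_trans (expect_triangles_sq_le_dispersion n6) _.
rewrite ler_wpM2r ?exprn_ge0 ?(ltW (mean_triangles_gt0 n6)) // /triangle_dispersion alpha1.
rewrite subrr mulr0 oppr0 powRr0.
suff : n%:R `^ (- (2 - 1)) <= 1 :> R by lra.
by rewrite -[leRHS](powRr0 n%:R) ler_natr_powR ?(leq_trans _ n6) //; lra.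
Qed.

Lemma whp_triangles_mixed : 2 / 3 <= alpha < 1 -> whp p (fun n G =>
  (exists v, nbr_type (adj_of G) v true true) /\ (exists v, ~~ nbr_type (adj_of G) v true true)).
Proof.
move=> /andP[alpha23 alpha_lt1].
apply: whp_mono (whp_triangles_concentrated alpha_lt1); first exact: edge_prob01.
near=> n => G GV; set mu := mean_triangles _ _; rewrite ltr_distl subrr => /andP[X_gt0 X_lt].
split.
  rewrite ltr0n in X_gt0; have /card_gt0P[A AG] := X_gt0.
  have /card_gt0P[v vA] : (0 < #|A|)%N by move: AG; rewrite inE => /andP[/eqP ->].
  by exists v; rewrite nbr_type_triangle //; apply/bigcupP; exists A.
apply/existsP; rewrite -negb_forall; apply/negP => /forallP in_triangle.
have : (n <= 3 * #|triangles G|)%N.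
  rewrite -{1}[n]card_ord -cardsT (_ : [set: 'I_n] = cover (triangles G)).
    apply: leq_trans (leq_card_cover _) _; rewrite mulnC -sum_nat_const.
    by apply: leq_sum => A; rewrite inE => /andP[/eqP ->].
  by apply/setP => v; rewrite inE -nbr_type_triangle ?in_triangle.
rewrite -(ler_nat R) natrM => n_le.
have : 6 * mu <= n%:R.
  have n0 : (0 < n)%N by near: n; exact: nbhs_infty_gt.
  apply: (@le_trans _ _ (n%:R ^+ 3 * p n ^+ 3)).
    rewrite /mu /mean_triangles mulrA ler_wpM2r ?exprn_ge0 ?powR_ge0 //.
    by rewrite -natrX -natrM ler_nat bin3_le_expr3.
  by rewrite mulrX_edge_probX // -[leRHS]powRr1 // ler_natr_powR //; lra.
by move: X_lt n_le; lra.
Unshelve. all: by end_near. Qed.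

End TriangleThreshold.

(** * The law for [alpha < 1] *)

Lemma exists_neq (V : finType) (x : V) : (1 < #|V|)%N -> exists y, x != y.
Proof.
move=> V1; have /card_gt0P[y] : (0 < #|predC1 x|)%N by rewrite cardC1 -subn1 subn_gt0.
by rewrite !inE eq_sym; exists y.
Qed.

Definition rich (V : finType) (adj : rel V) :=
  [/\ (1 < #|V|)%N, forall x y, x != y -> pattern adj x y true false &
      forall x y, x != y -> pattern adj x y false false].

Section Rich.
Variables (V : finType) (adj : rel V).
Hypotheses (sym : symmetric adj) (richV : rich adj).

Lemma rich_pattern x y a b : x != y -> ~~ (a && b) -> pattern adj x y a b.
Proof.
have [_ patternTF patternFF] := richV.
by case: a b => [] [] // xy _; rewrite ?patternTF ?patternFF // patternC patternTF // eq_sym.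
Qed.

Lemma rich_nbr x a : exists2 y, y != x & adj x y = a.
Proof.
have [V1 _ _] := richV; have [w xw] := exists_neq x V1.
have /existsP[u /and4P[ux _ /eqP uxa _]] : pattern adj x w a false.
  by apply: rich_pattern; rewrite ?andbF.
by exists u; rewrite // sym.
Qed.

Lemma rich_pattern_diag x a b : pattern adj x x a b = (a == b).
Proof.
apply/existsP/eqP => [[z /and4P[_ _ /eqP <- /eqP <-]]//|<-].
by have [z zx xz] := rich_nbr x a; exists z; rewrite zx sym xz eqxx.
Qed.

Lemma rich_dist2 x : nbr_type adj x false true.
Proof.
have [u ux xu] := rich_nbr x true.
have /existsP[y /and4P[yu yx /eqP yu_adj /eqP yx_nadj]] : pattern adj u x true false.
  exact: rich_pattern.
apply/existsP; exists y; rewrite yx sym yx_nadj /=; apply/eqP/existsP; exists u.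
by rewrite ux eq_sym yu sym xu sym yu_adj.
Qed.

Lemma rich_nbr_type x a c :
  (forall y, x != y -> pattern adj x y true true) -> nbr_type adj x a c = c.
Proof.
move=> common; apply/existsP/idP => [[y /and3P[yx _ /eqP <-]]|->].
  by apply: common; rewrite eq_sym.
by have [y yx xy] := rich_nbr x a; exists y; rewrite yx xy common ?eqxx // eq_sym.
Qed.

End Rich.

Lemma rich_pair_sim (V W : finType) (adjV : rel V) (adjW : rel W) x x' :
  symmetric adjV -> irreflexive adjV -> symmetric adjW -> irreflexive adjW ->
  rich adjV -> rich adjW -> (forall a c, nbr_type adjV x a c = nbr_type adjW x' a c) ->
  forall y, exists y', pair_sim adjV adjW x y x' y'.
Proof.
move=> symV irrV symW irrW richV richW same_types y; have [<-|xy] := eqVneq x y.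
  by exists x'; split=> [||a b]; rewrite ?eqxx ?irrV ?irrW // !rich_pattern_diag.
have : nbr_type adjV x (adjV x y) (pattern adjV x y true true).
  by apply/existsP; exists y; rewrite eq_sym xy !eqxx.
rewrite same_types => /existsP[y' /and3P[y'x /eqP adj_eq /eqP common_eq]].
exists y'; split=> [||a b]; rewrite ?adj_eq //; first by rewrite (negbTE xy) eq_sym (negbTE y'x).
have [/andP[-> ->]//|ab] := boolP (a && b).
by rewrite !rich_pattern // eq_sym.
Qed.

Lemma rich_vertex_sim n (G : graph n) n' (G' : graph n') x x' :
  G \subset vpairs n -> G' \subset vpairs n' -> rich (adj_of G) -> rich (adj_of G') ->
  (forall a c, nbr_type (adj_of G) x a c = nbr_type (adj_of G') x' a c) ->
  vertex_sim (adj_of G) (adj_of G') x x'.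
Proof.
move=> GV GV' richG richG' same_types.
have [sym sym'] := (@adj_of_sym _ G, @adj_of_sym _ G').
have [irr irr'] := (adj_of_irr GV, adj_of_irr GV').
split=> y; first exact: rich_pair_sim.
have [y' /pair_sim_sym yy'] := rich_pair_sim sym' irr' sym irr richG' richG
  (fun a c => esym (same_types a c)) y.
by exists y'.
Qed.

Section DenseLaw.
Variables (R : realType) (alpha : R).
Hypothesis alpha01 : 0 < alpha < 1.
Let alpha_gt0 : 0 < alpha. Proof. by have /andP[] := alpha01. Qed.
Let alpha_lt1 : alpha < 1. Proof. by have /andP[] := alpha01. Qed.
Let p01 := edge_prob01 alpha_gt0.
Notation p := (edge_prob alpha).

Lemma whp_rich : whp p (fun n G => rich (adj_of G)).
Proof.
have patternTF := whp_pattern (a := true) (b := false) alpha_gt0.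
have patternFF := whp_pattern (a := false) (b := false) alpha_gt0.
rewrite mulr1 in patternTF; rewrite mulr0 in patternFF.
apply: whp_mono (whp_and p01 (patternTF alpha_lt1) (patternFF ltr01)) => //.
near=> n => G _ [TF FF]; split=> //; rewrite card_ord.
by near: n; exact: nbhs_infty_gt.
Unshelve. all: by end_near. Qed.

Lemma zero_one_law_lt_half : alpha < 1 / 2 -> zero_one_law p 3.
Proof.
move=> alpha_lt_half; have alpha2 : alpha * 2 < 1 by lra.
have common := whp_pattern (a := true) (b := true) alpha_gt0 alpha2.
apply: (zero_one_of_whp p01 (whp_and p01 whp_rich common)).
move=> n G n' G' GV GV' [richG commonG] [richG' commonG'] x.
have [V1 _ _] := richG'; have /card_gt0P[x' _] := ltnW V1.
exists x'; apply: rich_vertex_sim => // a c.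
rewrite (rich_nbr_type (@adj_of_sym _ G) richG _ _ (commonG x)).
by rewrite (rich_nbr_type (@adj_of_sym _ G') richG' _ _ (commonG' x')).
Qed.

Definition triangle_profile n (G : graph n) :=
  if alpha < 2 / 3 then forall v, nbr_type (adj_of G) v true true
  else (exists v, nbr_type (adj_of G) v true true) /\
       (exists v, ~~ nbr_type (adj_of G) v true true).

Lemma whp_triangle_profile : whp p triangle_profile.
Proof.
rewrite /triangle_profile; case: (ltP alpha (2 / 3)) => alpha23; first exact: whp_common_nbr.
by apply: whp_triangles_mixed; rewrite ?alpha23.
Qed.

Lemma triangle_profile_match n (G : graph n) n' (G' : graph n') x : (0 < n')%N ->
  triangle_profile G -> triangle_profile G' ->
  exists x', nbr_type (adj_of G) x true true = nbr_type (adj_of G') x' true true.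
Proof.
rewrite /triangle_profile => n'0; case: ifP => _.
  by move=> all_in all_in'; exists (Ordinal n'0); rewrite all_in all_in'.
move=> _ [[y y_in] [z /negbTE z_notin]].
by case: nbr_type; [exists y|exists z].
Qed.

Lemma zero_one_law_ge_half : 1 / 2 <= alpha -> zero_one_law p 3.
Proof.
move=> alpha_ge_half.
have common_free a : whp p (fun n G => forall v, nbr_type (adj_of G) v a false).
  by case: a; [exact: whp_common_free_nbr|exact: whp_common_free_non_nbr].
have := whp_and p01 (whp_and p01 (common_free true) (common_free false)) whp_triangle_profile.
move=> /(whp_and p01 whp_rich) /(zero_one_of_whp p01); apply=> n G n' G' GV GV'.
move=> [richG [[freeT freeF] profile]] [richG' [[freeT' freeF'] profile']] x.
have n'0 : (0 < n')%N by case: richG'; rewrite card_ord => /ltnW.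
have [x' triangle_eq] := triangle_profile_match x n'0 profile profile'.
exists x'; apply: rich_vertex_sim => // -[] [] //; rewrite ?freeT ?freeF ?freeT' ?freeF' //.
by rewrite !rich_dist2 //; exact: adj_of_sym.
Qed.

Lemma zero_one_law_dense : zero_one_law p 3.
Proof.
by case: (ltP alpha (1 / 2)); [exact: zero_one_law_lt_half|exact: zero_one_law_ge_half].
Qed.

End DenseLaw.

(** * Copies of a fixed graph *)

Definition connected_graph k (H : graph k) := forall i j, connect (adj_of H) i j.

Section Copies.
Variables (k : nat) (H : graph k).
Hypothesis HV : H \subset vpairs k.

Section OneCopy.
Variables (n : nat) (G : graph n).
Implicit Types phi psi : {ffun 'I_k -> 'I_n}.

Definition image_graph phi : graph n := [set phi @: (e : {set 'I_k}) | e in H].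

Definition incident phi : graph n := [set e in vpairs n | [exists i, phi i \in e]].

Definition contains :=
  [exists phi : {ffun 'I_k -> 'I_n}, injectiveb phi && (image_graph phi \subset G)].

(* [phi] is an isomorphism from [H] onto a union of components of [G]. *)
Definition is_component phi := injectiveb phi && (G :&: incident phi == image_graph phi).

Definition components := [set phi : {ffun 'I_k -> 'I_n} | is_component phi].

Lemma card_image_graph phi : injective phi -> #|image_graph phi| = #|H|.
Proof. by move=> phi_inj; apply: card_imset; exact: imset_inj. Qed.

Lemma incident_vpairs phi : incident phi \subset vpairs n.
Proof. by apply/subsetP => e; rewrite inE => /andP[]. Qed.

Lemma image_graph_incident phi : injective phi -> image_graph phi \subset incident phi.
Proof.
move=> phi_inj; apply/subsetP => _ /imsetP[e eH ->]; have := subsetP HV e eH.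
rewrite !inE card_imset // => e2; rewrite e2.
have /card_gt0P[i ie] : (0 < #|e|)%N by rewrite (eqP e2).
by apply/existsP; exists i; exact: imset_f.
Qed.

Lemma image_graph_vpairs phi : injective phi -> image_graph phi \subset vpairs n.
Proof. by move=> /image_graph_incident/subset_trans; apply; exact: incident_vpairs. Qed.

Lemma vpairs_eq (e : {set 'I_n}) x y : e \in vpairs n -> x \in e -> y \in e -> x != y ->
  e = [set x; y].
Proof.
rewrite inE => /eqP e2 xe ye xy; apply/esym/eqP.
by rewrite eqEcard subUset !sub1set xe ye e2 cards2 xy.
Qed.

Lemma card_incident_le phi : (#|incident phi| <= k * n)%N.
Proof.
apply: (@leq_trans #|[set [set phi iy.1; iy.2] | iy in [set: 'I_k * 'I_n]]|); last first.
  by apply: leq_trans (leq_imset_card _ _) _; rewrite cardsT card_prod !card_ord.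
apply/subset_leq_card/subsetP => e; rewrite inE => /andP[eV /existsP[i ie]].
have : (0 < #|e :\ phi i|)%N.
  by move: eV; rewrite inE (cardsD1 (phi i)) ie add1n eqSS => /eqP ->.
case/card_gt0P => y; rewrite !inE => /andP[yi ye].
by apply/imsetP; exists (i, y); rewrite ?inE //=; apply: vpairs_eq; rewrite // eq_sym.
Qed.

Lemma card_incidentI_le phi psi : (forall i j, phi i != psi j) ->
  (#|incident phi :&: incident psi| <= k ^ 2)%N.
Proof.
move=> phi_psi.
apply: (@leq_trans #|[set [set phi ij.1; psi ij.2] | ij in [set: 'I_k * 'I_k]]|); last first.
  by apply: leq_trans (leq_imset_card _ _) _; rewrite cardsT card_prod !card_ord expnS expn1.
apply/subset_leq_card/subsetP => e; rewrite !inE.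
move=> /andP[/andP[eV /existsP[i ie]] /andP[_ /existsP[j je]]].
by apply/imsetP; exists (i, j); rewrite ?inE //=; apply: vpairs_eq; rewrite ?inE.
Qed.

Lemma component_adj phi i j : G \subset vpairs n -> is_component phi ->
  adj_of G (phi i) (phi j) = adj_of H i j.
Proof.
move=> GV /andP[/injectiveP phi_inj /eqP phiE].
have -> : adj_of G (phi i) (phi j) = ([set phi i; phi j] \in G :&: incident phi).
  rewrite inE /adj_of; case: (boolP (_ \in G)) => //= ijG; rewrite inE (subsetP GV) //=.
  by apply/esym/existsP; exists i; rewrite set21.
have -> : [set phi i; phi j] = phi @: [set i; j] by rewrite imsetU1 imset_set1.
by rewrite phiE mem_imset //; exact: imset_inj.
Qed.

Lemma component_closed phi i y : G \subset vpairs n -> is_component phi ->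
  adj_of G (phi i) y -> exists j, y = phi j.
Proof.
move=> GV /andP[_ /eqP phiE] iy; have : [set phi i; y] \in image_graph phi.
  rewrite -phiE inE [_ \in G]iy inE (subsetP GV) //=.
  by apply/existsP; exists i; rewrite set21.
move=> /imsetP[e _ eE]; have : y \in phi @: e by rewrite -eE set22.
by case/imsetP => j _; exists j.
Qed.

Lemma component_overlap phi psi i j : connected_graph H -> G \subset vpairs n ->
  is_component phi -> is_component psi -> phi i = psi j -> codom psi \subset codom phi.
Proof.
move=> conH GV phiG psiG ij; pose inside := [pred a | psi a \in codom phi].
have inside_closed : fingraph.closed (adj_of H) inside.
  apply: (intro_closed (sym_connect_sym (@adj_of_sym _ H))) => a b ab /codomP[c ac].
  move: ab; rewrite -(component_adj _ _ GV psiG) ac => /(component_closed GV phiG)[d bd].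
  by rewrite inE bd codom_f.
apply/subsetP => _ /codomP[j' ->]; rewrite -[_ \in _]/(j' \in inside).
by rewrite -(closed_connect inside_closed (conH j j')) inE -ij codom_f.
Qed.

Lemma card_codom_sub_le phi :
  (#|[pred psi : {ffun 'I_k -> 'I_n} | codom psi \subset codom phi]| <= k ^ k)%N.
Proof.
rewrite (@eq_card _ _ (@ffun_on 'I_k (codom phi))); last first.
  move=> psi; rewrite !inE; apply/subsetP/ffun_onP => [psi_phi j|psi_phi _ /codomP[j ->]] //.
  by apply: psi_phi; exact: codom_f.
rewrite card_ffun_on card_ord; have : (#|codom phi| <= k)%N.
  by rewrite (leq_trans (card_size _)) // size_codom card_ord.
by move: #|codom phi| => m; case: (posnP k) => [->|k0]; rewrite ?expn0 ?leq_exp2r.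
Qed.

Lemma card_components_through x : connected_graph H -> G \subset vpairs n ->
  (#|[set phi in components | x \in codom phi]| <= k ^ k)%N.
Proof.
move=> conH GV; set through := [set phi in _ | _].
have [->|[phi]] := set_0Vmem through; first by rewrite cards0.
rewrite !inE => /andP[phiG /codomP[i xi]].
apply: leq_trans (card_codom_sub_le phi); apply/subset_leq_card/subsetP => psi.
rewrite !inE => /andP[psiG /codomP[j xj]].
by apply: (component_overlap conH GV phiG psiG (i := i) (j := j)); rewrite -xi.
Qed.

Lemma component_avoiding (A : {set 'I_n}) : connected_graph H -> G \subset vpairs n ->
  (#|A| * k ^ k < #|components|)%N -> exists2 phi, is_component phi & forall i, phi i \notin A.
Proof.
move=> conH GV many; pose through x := [set phi in components | x \in codom phi].
have /subsetPn[phi] : ~~ (components \subset \bigcup_(x in A) through x).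
  apply: contraL many => /subset_leq_card; rewrite -leqNgt => /leq_trans; apply.
  apply: (@leq_trans (\sum_(x in A) #|through x|)).
    elim/big_rec2: _ => [|x m B _ cardB]; first by rewrite cards0.
    by rewrite (leq_trans (leq_card_setU _ _)) ?leq_add2l.
  rewrite -sum_nat_const; apply: leq_sum => x _; exact: card_components_through.
rewrite inE => phiG avoids; exists phi => // i; apply: contra avoids => iA.
by apply/bigcupP; exists (phi i); rewrite // !inE phiG codom_f.
Qed.

End OneCopy.

Lemma card_injections_ge n : (2 * k <= n)%N ->
  (n./2 ^ k <= #|[pred phi : {ffun 'I_k -> 'I_n} | injectiveb phi]|)%N.
Proof.
move=> kn; have := card_inj_ffuns 'I_k 'I_n; rewrite cardsE => ->; rewrite !card_ord.
elim: {1 3 4}k (leqnn k) => [|i IH] ik; first by rewrite expn0 ffactn0.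
rewrite expnSr ffactnSr leq_mul ?IH //; first exact: ltnW.
rewrite leq_subRL; last by lia.
by have := odd_double_half n; lia.
Qed.

Section CopyProbability.
Variables (R : realFieldType) (n : nat) (p : R).
Hypothesis p01 : 0 <= p <= 1.
Notation P := (prob p (vpairs n)).
Implicit Types phi psi : {ffun 'I_k -> 'I_n}.

Lemma prob_contains_le : P (@contains n) <= n%:R ^+ k * p ^+ #|H|.
Proof.
have [p0 p1] := andP p01.
apply: le_trans (prob_exists_le p01 _ predT _) _.
apply: (@le_trans _ _ (\sum_phi p ^+ #|H|)).
  apply: ler_sum => phi _; case: (boolP (injectiveb phi)) => [/injectiveP phi_inj|_] /=.
    by rewrite -(card_image_graph phi_inj) -(prob_superset p (image_graph_vpairs phi_inj)).
  by rewrite /prob expect_cst exprn_ge0.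
by rewrite sumr_const card_ffun !card_ord -natrX mulr_natl.
Qed.

Lemma prob_not_contains_ge :
  (1 - p ^+ #|H|) ^+ (n ^ k) <= P (fun G => ~~ contains G).
Proof.
have [p0 p1] := andP p01; pose inj := [set phi : {ffun 'I_k -> 'I_n} | injectiveb phi].
have injP phi : phi \in inj -> injective phi by rewrite inE => /injectiveP.
apply: (@le_trans _ _ (\prod_(phi in inj) (1 - p ^+ #|image_graph phi|))); last first.
  apply: le_trans (prob_superset_none_ge p01 _) _.
    by move=> phi /injP; exact: image_graph_vpairs.
  apply: le_prob => // G _ /forall_inP none; rewrite negb_exists; apply/forallP => phi.
  by rewrite negb_and -implybE; apply/implyP => phi_inj; apply: none; rewrite inE.
rewrite (eq_bigr (fun=> 1 - p ^+ #|H|)) => [|phi /injP phi_inj]; last by rewrite card_image_graph.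
rewrite prodr_const; apply: ler_wiXn2l; rewrite ?subr_ge0 ?exprn_ile1 ?gerBl ?exprn_ge0 //.
by apply: leq_trans (max_card _) _; rewrite card_ffun !card_ord.
Qed.

Definition component_prob phi : R := p ^+ #|H| * (1 - p) ^+ (#|incident phi| - #|H|).

Definition mean_components : R :=
  \sum_(phi : {ffun 'I_k -> 'I_n} | injectiveb phi) component_prob phi.

Notation X := (fun G : graph n => #|components G|%:R : R).
Notation component_event phi := (fun G => G :&: incident phi == image_graph phi).

Lemma component_prob_ge0 phi : 0 <= component_prob phi.
Proof. by have [p0 p1] := andP p01; rewrite mulr_ge0 ?exprn_ge0 ?subr_ge0. Qed.

Lemma card_componentsE G :
  #|components G|%:R =
  \sum_(phi : {ffun 'I_k -> 'I_n} | injectiveb phi) (component_event phi G)%:R :> R.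
Proof.
rewrite -sum1_card natr_sum big_mkcond [RHS]big_mkcond /=; apply: eq_bigr => phi _.
by rewrite inE /is_component; case: injectiveb => //=; case: (_ == _).
Qed.

Lemma prob_component phi : injective phi -> P (component_event phi) = component_prob phi.
Proof.
move=> phi_inj; have phi_inc := image_graph_incident phi_inj.
by rewrite prob_setI_eq ?incident_vpairs // cardsD (setIidPr phi_inc) card_image_graph.
Qed.

Lemma expect_components : expect p (vpairs n) X = mean_components.
Proof.
rewrite (@eq_expect _ _ p _ _ _ (fun G _ => card_componentsE G)) expect_sum.
by apply: eq_bigr => phi /injectiveP; exact: prob_component.
Qed.

Lemma mean_components_ge : (2 * k <= n)%N ->
  (n./2)%:R ^+ k * (p ^+ #|H| * (1 - p) ^+ (k * n)) <= mean_components.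
Proof.
have [p0 p1] := andP p01; have q0 : 0 <= 1 - p by rewrite subr_ge0.
move=> kn; apply: (@le_trans _ _ (\sum_(phi : {ffun 'I_k -> 'I_n} | injectiveb phi)
   (p ^+ #|H| * (1 - p) ^+ (k * n)))).
  rewrite sumr_const -[leRHS]mulr_natl ler_wpM2r ?mulr_ge0 ?exprn_ge0 // -natrX ler_nat.
  exact: card_injections_ge.
apply: ler_sum => phi _; rewrite ler_wpM2l ?exprn_ge0 //; apply: ler_wiXn2l => //.
  by rewrite gerBl.
exact: leq_trans (leq_subr _ _) (card_incident_le _).
Qed.

Lemma prob_disjoint_components_le phi psi : injective phi -> injective psi ->
  (forall i j, phi i != psi j) ->
  (1 - p) ^+ (k ^ 2) * P (predI (component_event phi) (component_event psi)) <=
  component_prob phi * component_prob psi.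
Proof.
move=> phi_inj psi_inj phi_psi; have [p0 p1] := andP p01; have q0 : 0 <= 1 - p by rewrite subr_ge0.
have phi_inc := image_graph_incident phi_inj; have psi_inc := image_graph_incident psi_inj.
have image_disjoint : [disjoint image_graph phi & image_graph psi].
  rewrite -setI_eq0; apply/eqP/setP => e; rewrite in_set0; apply/negbTE/setIP.
  move=> [/imsetP[a aH ->] /imsetP[b _ ab]].
  have /card_gt0P[i ia] : (0 < #|a|)%N by have := subsetP HV a aH; rewrite inE => /eqP ->.
  have : phi i \in psi @: b by rewrite -ab imset_f.
  by case/imsetP => j _ /eqP; rewrite (negbTE (phi_psi i j)).
have card_image : #|image_graph phi :|: image_graph psi| = (#|H| + #|H|)%N.
  by rewrite cardsU disjoint_setI0 // cards0 subn0 !card_image_graph.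
have union_inc := setUSS phi_inc psi_inc.
set both := P _; have both_le : both <= p ^+ (#|H| + #|H|) *
    (1 - p) ^+ (#|incident phi :|: incident psi| - (#|H| + #|H|)).
  rewrite -card_image -(setIidPr union_inc) -cardsD (setIidPr union_inc).
  rewrite -(@prob_setI_eq _ _ p (vpairs n)) //; last by rewrite subUset !incident_vpairs.
  by apply: le_prob => // G _ /andP[/eqP phiE /eqP psiE]; rewrite setIUr phiE psiE.
apply: (le_trans (ler_wpM2l (exprn_ge0 _ q0) both_le)).
rewrite /component_prob mulrACA -!exprD mulrCA ler_wpM2l ?exprn_ge0 // -exprD.
apply: ler_wiXn2l => //; first by rewrite gerBl.
have := card_incidentI_le phi_psi; have := subset_leq_card (subsetIl (incident phi) (incident psi)).
have := subset_leq_card phi_inc; have := subset_leq_card psi_inc.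
rewrite !card_image_graph // cardsU; lia.
Qed.

Hypothesis conH : connected_graph H.

(* Component copies of a connected graph that meet have the same vertices, and
   disjoint ones are independent up to the [k ^ 2] pairs between them. *)
Lemma prob_two_components_le phi psi : injective phi -> injective psi ->
  (1 - p) ^+ (k ^ 2) * P (predI (component_event phi) (component_event psi)) <=
  component_prob phi * component_prob psi +
  (codom psi \subset codom phi)%:R * component_prob phi.
Proof.
move=> phi_inj psi_inj; have [p0 p1] := andP p01; have q0 : 0 <= 1 - p by rewrite subr_ge0.
have [/existsP[i /existsP[j /eqP ij]]|disjoint] := boolP [exists i, [exists j, phi i == psi j]].
  case: (boolP (codom psi \subset _)) => [_|notin].
    apply: (@le_trans _ _ (P (component_event phi))); last first.
      by rewrite prob_component // mul1r lerDr mulr_ge0 ?component_prob_ge0.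
    rewrite -[leRHS]mul1r; apply: ler_pM; rewrite ?exprn_ge0 ?prob_ge0 ?exprn_ile1 ?gerBl //.
    by apply: le_prob => // G _ /andP[].
  rewrite mul0r addr0 (_ : P _ = 0); first by rewrite mulr0 mulr_ge0 ?component_prob_ge0.
  rewrite -[RHS](expect_cst p (vpairs n)); apply: eq_expect => G GV.
  case: (boolP (predI _ _ G)) => // /andP[phiE psiE]; case/negP: notin.
  by apply: (component_overlap conH GV _ _ ij); rewrite /is_component ?phiE ?psiE andbT;
    exact/injectiveP.
rewrite -[leLHS]addr0 lerD //; last by rewrite mulr_ge0 ?component_prob_ge0.
apply: prob_disjoint_components_le => // i j.
by move: disjoint; rewrite negb_exists => /forallP/(_ i); rewrite negb_exists => /forallP/(_ j).
Qed.

Lemma expect_components_sq_le :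
  (1 - p) ^+ (k ^ 2) * expect p (vpairs n) (fun G => X G ^+ 2) <=
  mean_components ^+ 2 + (k ^ k)%:R * mean_components.
Proof.
have [p0 p1] := andP p01; have q0 : 0 <= 1 - p by rewrite subr_ge0.
rewrite (@eq_expect _ _ p _ _ (fun G => \sum_(phi : {ffun 'I_k -> 'I_n} | injectiveb phi)
    \sum_(psi : {ffun 'I_k -> 'I_n} | injectiveb psi)
    (predI (component_event phi) (component_event psi) G)%:R)); last first.
  move=> G _; rewrite card_componentsE expr2 big_distrlr /=.
  by apply: eq_bigr => phi _; apply: eq_bigr => psi _; rewrite -natrM mulnb.
rewrite expect_sum mulr_sumr expr2 big_distrlr /= [in leRHS]mulr_sumr -big_split /=.
apply: ler_sum => phi /injectiveP phi_inj; rewrite expect_sum mulr_sumr.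
apply: le_trans (ler_sum _ (fun psi psi_inj =>
  prob_two_components_le phi_inj (injectiveP psi psi_inj))) _.
rewrite big_split /= lerD2l -mulr_suml ler_wpM2r ?component_prob_ge0 // -natr_sum ler_nat.
apply: leq_trans (card_codom_sub_le phi); rewrite -sum1_card big_mkcond [leqRHS]big_mkcond /=.
by apply: leq_sum => psi _; rewrite inE; case: injectiveb; case: (_ \subset _).
Qed.

End CopyProbability.
End Copies.

Section CopyThresholds.
Variables (R : realType) (alpha : R) (k : nat) (H : graph k).
Hypotheses (alpha_gt0 : 0 < alpha) (HV : H \subset vpairs k).
Notation p := (edge_prob alpha).
Notation X := (fun G => #|components H G|%:R).
Notation exponent := (k%:R - alpha * #|H|%:R).

Lemma whp_not_contains : k%:R < alpha * #|H|%:R -> whp p (fun n G => ~ contains H G).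
Proof.
move=> kH; have p01 := edge_prob01 alpha_gt0.
apply: (@whp_of_le _ _ p01 _ (fun n => n%:R `^ (- (alpha * #|H|%:R - k%:R)))); last first.
  by apply: cvg_natr_powRN; rewrite subr_gt0.
near=> n; rewrite opprB -mulrX_edge_probX; last by near: n; exact: nbhs_infty_gt.
apply: le_trans (prob_contains_le HV n (p01 n)).
by apply: le_prob => // G _ /asboolP/contrapT.
Unshelve. all: by end_near. Qed.

Lemma gnp_not_contains_ge : (0 < k)%N -> alpha * #|H|%:R = k%:R ->
  \forall n \near \oo, expR (-2) <= gnp p (fun G : graph n => ~ contains H G).
Proof.
move=> k0 kH; near=> n; have n2 : (2 <= n)%N by near: n; exact: nbhs_infty_ge.
have p01 := edge_prob01 alpha_gt0 n.
apply: (@le_trans _ _ (prob (p n) (vpairs n) (fun G => ~~ contains H G))); last first.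
  by apply: le_prob => // G _ /negP ?; exact/asboolP.
apply: le_trans (prob_not_contains_ge HV n p01).
have : (2 <= n ^ k)%N by rewrite (leq_trans n2) // -{1}[n]expn1 leq_pexp2l // (ltnW n2).
have : n%:R ^+ k * p n ^+ #|H| = 1 by rewrite mulrX_edge_probX ?(ltnW n2) // kH subrr powRr0.
have : 0 <= p n ^+ #|H| by rewrite exprn_ge0 ?powR_ge0.
rewrite -natrX -(ler_nat R); move: (p n ^+ #|H|) (n ^ k)%N => q N q0 qN N2.
have q_half : q <= 1 / 2 by nra.
by apply: le_trans (expr_onem_ge_expR _ q0 q_half); rewrite ler_expR -mulrA (mulrC q) qN mulr1.
Unshelve. all: by end_near. Qed.

Hypotheses (conH : connected_graph H) (alpha_ge1 : 1 <= alpha).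

Definition component_density : R := 4 ^- k * expR (- (2 * k%:R)).

Lemma component_density_gt0 : 0 < component_density.
Proof. by rewrite mulr_gt0 ?expR_gt0 // invr_gt0 exprn_gt0. Qed.

Lemma mean_components_ge_powR : \forall n \near \oo,
  component_density * n%:R `^ exponent <= mean_components H n (p n).
Proof.
near=> n.
have n_large : (2 * k + 2 <= n)%N by near: n; exact: nbhs_infty_ge.
have n0 : (0 < n)%N by apply: leq_trans n_large; rewrite addn2.
have p_half : p n <= 1 / 2 by near: n; exact: near_edge_prob_le.
have [p0 p1] := andP (edge_prob01 alpha_gt0 n).
apply: le_trans (mean_components_ge HV (edge_prob01 alpha_gt0 n) (leq_trans _ n_large)); last first.
  exact: leq_addr.
have half_n : (n%:R / 4) ^+ k <= (n./2)%:R ^+ k :> R.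
  apply: lerXn2r; rewrite ?nnegrE ?divr_ge0 // ler_pdivrMr // -natrM ler_nat.
  by have := odd_double_half n; move: n_large; clear; lia.
have no_other_edges : expR (- (2 * k%:R)) <= (1 - p n) ^+ (k * n).
  apply: le_trans (expr_onem_ge_expR _ p0 p_half); rewrite ler_expR lerN2 natrM.
  have np1 : n%:R * p n <= 1.
    by rewrite mulr_edge_prob // -[leRHS](powRr0 n%:R) ler_natr_powR // subr_le0.
  have : 0 <= k%:R :> R by [].
  by move: np1; set K := k%:R; set N := n%:R; nra.
rewrite -mulrX_edge_probX //.
have -> : component_density * (n%:R ^+ k * p n ^+ #|H|) =
    (n%:R / 4) ^+ k * (p n ^+ #|H| * expR (- (2 * k%:R))).
  by rewrite /component_density exprMn exprVn; move: (p n ^+ _) => q; ring.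
by apply: ler_pM; rewrite ?mulr_ge0 ?expR_ge0 ?exprn_ge0 ?ler_wpM2l ?exprn_ge0 ?divr_ge0.
Unshelve. all: by end_near. Qed.

Definition component_dispersion n : R :=
  2 * (k ^ 2)%:R * n%:R `^ (- alpha) +
  2 * ((k ^ k)%:R / component_density) * n%:R `^ (- exponent).

Lemma mean_components_gt0 : \forall n \near \oo, 0 < mean_components H n (p n).
Proof.
near=> n; have n0 : (0 < n)%N by near: n; exact: nbhs_infty_gt.
apply: (@lt_le_trans _ _ (component_density * n%:R `^ exponent)).
  by rewrite mulr_gt0 ?component_density_gt0 // powR_gt0 // ltr0n.
by near: n; exact: mean_components_ge_powR.
Unshelve. all: by end_near. Qed.

Lemma expect_components_sq_le_near : \forall n \near \oo,
  expect (p n) (vpairs n) (fun G => X G ^+ 2) <=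
  (1 + 2 * (k ^ 2)%:R * p n) *
  (mean_components H n (p n) ^+ 2 + (k ^ k)%:R * mean_components H n (p n)).
Proof.
near=> n; have p01 := edge_prob01 alpha_gt0 n; have [p0 _] := andP p01.
have small : 2 * (k ^ 2)%:R * p n <= 1 by near: n; exact: near_mulr_edge_prob_le1.
have := bernoulli_onem (k ^ 2) p01.
set w := (1 - p n) ^+ _ => w_ge.
have w_inv : 1 <= (1 + 2 * (k ^ 2)%:R * p n) * w.
  by have : 0 <= (k ^ 2)%:R * p n; [rewrite mulr_ge0|nra].
have factor_ge0 : 0 <= 1 + 2 * (k ^ 2)%:R * p n by rewrite addr_ge0 ?mulr_ge0.
apply: le_trans (ler_wpM2l factor_ge0 (expect_components_sq_le HV n p01 conH)).
by rewrite mulrA ler_peMl //; apply: expect_ge0 => // *; exact: sqr_ge0.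
Unshelve. all: by end_near. Qed.

Lemma expect_components_sq_le_dispersion : \forall n \near \oo,
  expect (p n) (vpairs n) (fun G => X G ^+ 2) <=
  (1 + component_dispersion n) * mean_components H n (p n) ^+ 2.
Proof.
near=> n; have n0 : (0 < n)%N by near: n; exact: nbhs_infty_gt.
have m0 : 0 < mean_components H n (p n) by near: n; exact: mean_components_gt0.
have m_ge : component_density * n%:R `^ exponent <= mean_components H n (p n).
  by near: n; exact: mean_components_ge_powR.
have small : 2 * (k ^ 2)%:R * p n <= 1 by near: n; exact: near_mulr_edge_prob_le1.
have tail_le : (k ^ k)%:R / mean_components H n (p n) <=
    (k ^ k)%:R / component_density * n%:R `^ (- exponent).
  rewrite -mulrA ler_wpM2l // powRN -invfM lef_pV2 ?posrE ?mulr_gt0 ?component_density_gt0 //.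
  by rewrite powR_gt0 // ltr0n.
have : expect (p n) (vpairs n) (fun G => X G ^+ 2) <= (1 + 2 * (k ^ 2)%:R * p n) *
    (mean_components H n (p n) ^+ 2 + (k ^ k)%:R * mean_components H n (p n)).
  by near: n; exact: expect_components_sq_le_near.
move/le_trans; apply; move: (mean_components _ _ _) m0 tail_le {m_ge} => m m0 tail_le.
have -> : m ^+ 2 + (k ^ k)%:R * m = (1 + (k ^ k)%:R / m) * m ^+ 2 by field; rewrite gt_eqF.
have tail_ge0 : 0 <= (k ^ k)%:R / m by rewrite divr_ge0 // ltW.
rewrite mulrA ler_wpM2r ?sqr_ge0 // /component_dispersion -/(p n).
rewrite -[2 * (_ / _) * _]mulrA; move: tail_ge0 tail_le small.
move: (_ * p n) (_ / m) (_ / _ * _) => a u v; nra.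
Unshelve. all: by end_near. Qed.

Lemma whp_many_components (t : R) : alpha * #|H|%:R < k%:R ->
  whp p (fun n G => t < #|components H G|%:R).
Proof.
move=> kH; have p01 := edge_prob01 alpha_gt0.
have exponent_gt0 : 0 < exponent by rewrite subr_gt0.
have mean_large : \forall n \near \oo, 2 * t <= mean_components H n (p n).
  near=> n; apply: (@le_trans _ _ (component_density * n%:R `^ exponent)).
    by rewrite mulrC -ler_pdivrMl ?component_density_gt0 //; near: n; exact: near_ge_natr_powR.
  by near: n; exact: mean_components_ge_powR.
have meanE n := expect_components HV n (p n).
have half_gt0 : 0 < 1 / 2 :> R by lra.
apply: whp_mono (whp_concentrated p01 (X := fun n => X) (delta := component_dispersion)
  half_gt0 _ _ _) => //.
- near=> n; have large : 2 * t <= mean_components H n (p n) by near: n.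
  move=> G _; rewrite meanE ltr_distl => /andP[X_gt _]; apply: le_lt_trans X_gt.
  by move: large; move: (mean_components _ _ _) => m; lra.
- by apply: filterS mean_components_gt0 => n; rewrite meanE.
- by apply: filterS expect_components_sq_le_dispersion => n; rewrite meanE.
- by rewrite -[0](addr0 (0 : R)); apply: cvgD; apply: cvg_natr_powRNZ.
Unshelve. all: by end_near. Qed.

Lemma gnp_component_ge : alpha * #|H|%:R = k%:R -> exists2 c : R, 0 < c &
  \forall n \near \oo, c <= gnp p (fun G : graph n => components H G != set0).
Proof.
move=> kH; have p01 := edge_prob01 alpha_gt0.
pose c : R := 2 + 2 * ((k ^ k)%:R / component_density).
have c0 : 0 < c by rewrite ltr_wpDr // mulr_ge0 // divr_ge0 ?(ltW component_density_gt0).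
exists c^-1; first by rewrite invr_gt0.
near=> n; rewrite gnpE (@eq_prob _ _ _ _ _ (fun G => X G != 0 :> R)) => [|G _]; last first.
  by rewrite pnatr_eq0 cards_eq0.
apply: prob_neq0_ge; rewrite ?expect_components //.
  by near: n; exact: mean_components_gt0.
have : expect (p n) (vpairs n) (fun G => X G ^+ 2) <=
    (1 + component_dispersion n) * mean_components H n (p n) ^+ 2.
  by near: n; exact: expect_components_sq_le_dispersion.
move=> /le_trans; apply; rewrite ler_wpM2r ?sqr_ge0 //.
rewrite /component_dispersion kH subrr oppr0 powRr0 mulr1 /c.
have : 2 * (k ^ 2)%:R * n%:R `^ (- alpha) <= 1 by near: n; exact: near_mulr_edge_prob_le1.
lra.
Unshelve. all: by end_near. Qed.

End CopyThresholds.

(** * Trees and short cycles *)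

Lemma containsI k (H : graph k) n (G : graph n) (f : 'I_k -> 'I_n) :
  H \subset vpairs k -> injective f ->
  (forall i j, adj_of H i j -> adj_of G (f i) (f j)) -> contains H G.
Proof.
move=> HV f_inj f_adj; apply/existsP; exists [ffun i => f i]; apply/andP; split.
  by apply/injectiveP => i j; rewrite !ffunE => /f_inj.
apply/subsetP => _ /imsetP[e eH ->]; have := subsetP HV e eH.
rewrite inE => /cards2P[i [j [_ e_eq]]]; rewrite {e}e_eq in eH *.
by rewrite imsetU1 imset_set1 !ffunE; exact: f_adj.
Qed.

(* A list [L] stands for the tree on the vertices [0, ..., size L] in which vertex
   [i.+1] is a child of vertex [nth 0 L i]. *)
Definition parent_list (L : seq nat) := all (fun i => nth 0 L i <= i)%N (iota 0 (size L)).

Definition tree_adj (L : seq nat) : rel nat := fun i j =>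
  ((0 < j) && (i == nth 0 L j.-1) || (0 < i) && (j == nth 0 L i.-1))%N.

Definition tree_graph (L : seq nat) : graph (size L).+1 :=
  [set [set inord (nth 0%N L i); lift ord0 i] | i : 'I_(size L)].

Section TreeGraph.
Variable L : seq nat.
Hypothesis treeL : parent_list L.

Lemma parent_leq i : (i < size L)%N -> (nth 0 L i <= i)%N.
Proof. by move=> iL; apply: (allP treeL); rewrite mem_iota. Qed.

Lemma parentK (i : 'I_(size L)) : (inord (nth 0%N L i) : 'I_(size L).+1) = nth 0%N L i :> nat.
Proof. by rewrite inordK // ltnS (leq_trans (parent_leq (ltn_ord i))) // ltnW. Qed.

Lemma parent_ltn (i : 'I_(size L)) :
  ((inord (nth 0%N L i) : 'I_(size L).+1) < lift ord0 i)%N.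
Proof. by rewrite parentK lift0 ltnS parent_leq. Qed.

Lemma tree_graph_vpairs : tree_graph L \subset vpairs (size L).+1.
Proof.
apply/subsetP => _ /imsetP[i _ ->]; rewrite pair_vpairs.
by apply: contraTneq (parent_ltn i) => ->; rewrite ltnn.
Qed.

Lemma card_tree_graph : #|tree_graph L| = size L.
Proof.
rewrite card_imset ?card_ord // => i j ij.
have : lift ord0 i \in [set inord (nth 0%N L j); lift ord0 j] by rewrite -ij set22.
have : lift ord0 j \in [set inord (nth 0%N L i); lift ord0 i] by rewrite ij set22.
rewrite !inE (inj_eq lift_inj) => /orP[/eqP ji|/eqP -> //] /orP[/eqP ji'|/eqP/lift_inj //].
have := parent_ltn j; rewrite -ji' => /(ltn_trans (parent_ltn i)).
by rewrite -ji ltnn.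
Qed.

Lemma adj_tree_graph (i j : 'I_(size L).+1) : adj_of (tree_graph L) i j = tree_adj L i j.
Proof.
have child (a b : 'I_(size L).+1) : (0 < b)%N -> a = nth 0%N L b.-1 :> nat ->
    adj_of (tree_graph L) a b.
  case: (unliftP ord0 b) => [b' ->|->//] _; rewrite lift0 /= => a_eq.
  rewrite (_ : a = inord (nth 0%N L b')); first exact: imset_f.
  by apply/val_inj; rewrite /= parentK.
apply/idP/orP => [/imsetP[a _ ij]|[]/andP[pos /eqP]]; last 2 first.
- exact: child.
- by rewrite adj_of_sym; exact: child.
have : i \in [set inord (nth 0%N L a); lift ord0 a] by rewrite -ij set21.
rewrite !inE => /orP[] /eqP i_eq; move: ij; rewrite i_eq.
  by move/set2_inj => ->; left; rewrite lift0 /= parentK.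
by rewrite [RHS]setUC => /set2_inj ->; right; rewrite lift0 /= parentK.
Qed.

Lemma connected_tree_graph : connected_graph (tree_graph L).
Proof.
have sym := sym_connect_sym (@adj_of_sym _ (tree_graph L)).
suff to_root i : connect (adj_of (tree_graph L)) i ord0.
  by move=> i j; apply: connect_trans (to_root i) _; rewrite sym.
have [m] := ubnP (i : nat); elim: m i => // m IH i; rewrite ltnS => im.
case: (unliftP ord0 i) => [i' i_eq|->]; last exact: connect0.
apply: connect_trans (connect1 _) (IH (inord (nth 0%N L i')) _).
  by rewrite i_eq adj_of_sym; exact: imset_f.
by rewrite (leq_trans _ im) // i_eq parent_ltn.
Qed.

End TreeGraph.

Definition embeds (V : eqType) (adj : rel V) (L : seq nat) := exists s : seq V,
  [/\ size s = (size L).+1, uniq s &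
      forall x i, (i < size L)%N -> adj (nth x s (nth 0%N L i)) (nth x s i.+1)].

Lemma embeds_contains n (G : graph n) L : parent_list L ->
  embeds (adj_of G) L -> contains (tree_graph L) G.
Proof.
move=> treeL [[|x s] [//= ss us adjs]].
apply: (@containsI _ _ _ _ (fun i => nth x (x :: s) i)); first exact: tree_graph_vpairs.
  move=> i j; apply: contra_eq => ij; rewrite nth_uniq ?ss //= ?ss //.
have child i j : (0 < j < size L + 1)%N -> i = nth 0%N L j.-1 ->
    adj_of G (nth x (x :: s) i) (nth x (x :: s) j).
  by case: j => // j; rewrite addn1 => jL ->; exact: adjs.
move=> i j; rewrite adj_tree_graph // => /orP[]/andP[pos /eqP]; last rewrite adj_of_sym.
  by apply: child; rewrite pos addn1 ltn_ord.
by apply: child; rewrite pos addn1 ltn_ord.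
Qed.

Section NonBacktracking.
Variables (V : eqType) (adj : rel V).
Implicit Types (x y : V) (p q : seq V).

Fixpoint nb_path x p :=
  if p is y :: q then [&& adj x y, ohead q != Some x & nb_path y q] else true.

Definition girth_gt g := forall c, ucycle adj c -> ~~ (2 < size c <= g)%N.

Lemma nb_path_path x p : nb_path x p -> path adj x p.
Proof. by elim: p x => //= y p IH x /and3P[-> _ /IH]. Qed.

Lemma nb_path_cat x p q : nb_path x (p ++ q) -> nb_path x p.
Proof.
elim: p x => //= y p IH x /and3P[-> back /IH ->]; rewrite andbT.
by case: p back {IH}.
Qed.

Lemma nb_path_catrev x p q : symmetric adj -> ohead p != ohead q ->
  nb_path x p -> nb_path x q -> nb_path (last x p) (rev (belast x p) ++ q).
Proof.
move=> sym; elim: p x q => //= y p IH x q fork /and3P[xy yx yp] xq.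
rewrite rev_cons cat_rcons; apply: IH => //.
by rewrite /= (sym y) xy eq_sym fork xq.
Qed.

Lemma nb_path_embeds x p : nb_path x p -> uniq (x :: p) -> embeds adj (iota 0 (size p)).
Proof.
move=> /nb_path_path/(pathP x) adjp up; exists (x :: p); rewrite /= size_iota; split=> //.
move=> x0 i ip; rewrite nth_iota // add0n.
by rewrite (set_nth_default x) ?ltnS ?(ltnW ip) // (set_nth_default x) //; exact: adjp.
Qed.

Lemma girth_gtW g h : (g <= h)%N -> girth_gt h -> girth_gt g.
Proof. by move=> gh girth c /girth; apply: contra => /andP[-> /leq_trans]; apply. Qed.

Section LargeGirth.
Variable g : nat.
Hypotheses (sym : symmetric adj) (irr : irreflexive adj) (girth : girth_gt g).

Lemma nb_path_uniq x p : nb_path x p -> (size p <= g)%N -> uniq (x :: p).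
Proof.
elim: p x => // y p IH x xp pg.
have up : uniq (y :: p) by apply: IH; [case/and3P: xp|exact: ltnW].
rewrite cons_uniq up andbT; apply/negP => x_in.
case/path.splitP: x_in xp up pg => p1 p2 /nb_path_cat xp1; rewrite cat_uniq => /andP[up1 _] pg.
have uc : ucycle adj (x :: p1).
  by rewrite /ucycle /= (nb_path_path xp1) -rcons_uniq.
have p1g : (size p1 < g)%N by rewrite (leq_trans _ pg) // size_cat size_rcons leq_addr.
have := girth uc; rewrite /= p1g andbT -leqNgt.
by case: p1 xp1 {up1 pg uc p1g} => [|z [|w p1]] //=; rewrite ?irr // eqxx andbF.
Qed.

Lemma path_embeds x p : nb_path x p -> (size p <= g)%N -> embeds adj (iota 0 (size p)).
Proof. by move=> xp pg; apply: nb_path_embeds (nb_path_uniq xp pg). Qed.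

Lemma fork_embeds x p q : nb_path x p -> nb_path x q -> ohead p != ohead q ->
  (size p + size q <= g)%N -> embeds adj (iota 0 (size p + size q)).
Proof.
move=> xp xq fork pq; have := nb_path_catrev sym fork xp xq.
have spq : size (rev (belast x p) ++ q) = (size p + size q)%N.
  by rewrite size_cat size_rev size_belast.
by move=> /path_embeds; rewrite spq; apply.
Qed.

Lemma tripod_embeds c a b d : nb_path c a -> nb_path c b -> adj c d ->
  ohead a != ohead b -> ohead a != Some d -> ohead b != Some d -> (size a + size b < g)%N ->
  embeds adj (rcons (iota 0 (size a + size b)) (size a)).
Proof.
move=> ca cb cd fork ad bd ab; pose s := rev (c :: a) ++ b.
have s_eq : s = last c a :: rev (belast c a) ++ b by rewrite /s lastI rev_rcons.
have ss : size s = (size a + size b).+1 by rewrite size_cat size_rev.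
have path_s := nb_path_catrev sym fork ca cb.
have us : uniq (rcons s d).
  rewrite rcons_uniq {2}s_eq nb_path_uniq ?andbT //; last first.
    by rewrite size_cat size_rev size_belast ltnW.
  rewrite mem_cat mem_rev negb_or.
  have : uniq (d :: c :: a)
    by apply: nb_path_uniq; [rewrite /= (sym d) cd ad|exact: leq_ltn_trans (leq_addr _ _) ab].
  have : uniq (d :: c :: b)
    by apply: nb_path_uniq; [rewrite /= (sym d) cd bd|exact: leq_ltn_trans (leq_addl _ _) ab].
  by rewrite !cons_uniq inE negb_or => /andP[/andP[_ ->] _] /andP[-> _].
exists (rcons s d); split=> // [|x i]; first by rewrite !size_rcons ss size_iota.
rewrite size_rcons size_iota ltnS leq_eqVlt => /predU1P[->|i_lt].
  rewrite [nth 0%N _ _]nth_rcons size_iota ltnn eqxx !nth_rcons ss ltnS leq_addr ltnn eqxx.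
  by rewrite nth_cat size_rev /= ltnS leqnn nth_rev // subnn.
rewrite [nth 0%N _ _]nth_rcons size_iota i_lt nth_iota // add0n.
rewrite !nth_rcons ss !ltnS i_lt (ltnW i_lt) s_eq /=.
have /(pathP x) := nb_path_path path_s.
by apply; rewrite size_cat size_rev size_belast.
Qed.

End LargeGirth.

End NonBacktracking.

Definition cycle_graph g : graph g := [set [set i; ordS i] | i : 'I_g].

Section CycleGraph.
Variable g : nat.
Hypothesis g_gt2 : (2 < g)%N.

Lemma ordS_neq (i : 'I_g) : ordS i != i.
Proof.
apply/eqP => /(congr1 val) /=; have := ltn_ord i.
rewrite leq_eqVlt => /predU1P[ig|ig]; last by rewrite modn_small //; lia.
by rewrite ig modnn; lia.
Qed.

Lemma ordSS_neq (i : 'I_g) : ordS (ordS i) != i.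
Proof.
apply/eqP => /(congr1 val) /=; have := ltn_ord i.
rewrite -[(_ %% _).+1]addn1 modnDml addn1 leq_eqVlt => /predU1P[ig|ig].
  by rewrite -addn1 ig modnDl modn_small; lia.
move: ig; rewrite leq_eqVlt => /predU1P[ig|ig]; last by rewrite modn_small //; lia.
by rewrite ig modnn; lia.
Qed.

Lemma cycle_graph_vpairs : cycle_graph g \subset vpairs g.
Proof. by apply/subsetP => _ /imsetP[i _ ->]; rewrite pair_vpairs eq_sym ordS_neq. Qed.

Lemma card_cycle_graph : #|cycle_graph g| = g.
Proof.
rewrite card_imset ?card_ord // => i j ij; have : i \in [set j; ordS j] by rewrite -ij set21.
rewrite !inE => /orP[/eqP //|/eqP i_eq].
move: ij; rewrite {1}i_eq [RHS]setUC => /set2_inj j_eq.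
by have := ordSS_neq j; rewrite -i_eq j_eq eqxx.
Qed.

Lemma ucycle_contains n (G : graph n) c : ucycle (adj_of G) c -> size c = g ->
  contains (cycle_graph g) G.
Proof.
case: c => [_ g0|x c /andP[/= /(pathP x) adjc uc] sc]; first by have := g_gt2; rewrite -g0.
have next (i : 'I_g) : adj_of G (nth x (x :: c) i) (nth x (x :: c) (ordS i)).
  have ic : (i < (size c).+1)%N by rewrite sc.
  have := adjc i; rewrite size_rcons => /(_ ic); rewrite -rcons_cons !nth_rcons ic /=.
  case: ltnP => ci; first by rewrite modn_small // (leq_trans _ (eq_leq sc)).
  have i_last : i = size c :> nat by apply/eqP; rewrite eqn_leq ci -ltnS ic.
  by rewrite i_last eqxx sc modnn.
apply: (@containsI _ _ _ _ (fun i => nth x (x :: c) i)); first exact: cycle_graph_vpairs.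
  by move=> i j; apply: contra_eq => ij; rewrite nth_uniq //= sc.
move=> i j /imsetP[a _ ij].
have : i \in [set a; ordS a] by rewrite -ij set21.
rewrite !inE => /orP[] /eqP i_eq; move: ij; rewrite i_eq => ij.
  by rewrite (set2_inj ij).
by move: ij; rewrite [RHS]setUC => /set2_inj ->; rewrite adj_of_sym.
Qed.

End CycleGraph.

Lemma whp_girth_gt (R : realType) (alpha : R) g : 1 < alpha ->
  whp (edge_prob alpha) (fun n G => girth_gt (adj_of G) g).
Proof.
move=> alpha_gt1; have alpha_gt0 : 0 < alpha by exact: lt_trans alpha_gt1.
have p01 := edge_prob01 alpha_gt0.
have no_cycle (l : 'I_g.+1) : whp (edge_prob alpha)
    (fun n G => (2 < l)%N -> ~ contains (cycle_graph l) G).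
  have [l_gt2|l_le2] := ltnP 2 l; last by apply: whp_near => //; near=> n.
  apply: whp_mono (whp_not_contains alpha_gt0 (cycle_graph_vpairs l_gt2) _) => //.
    by near=> n.
  by rewrite card_cycle_graph // ltr_pMl // ltr0n (leq_trans _ l_gt2).
apply: whp_mono (whp_forall p01 no_cycle) => //; near=> n => G GV no_cyc c uc.
apply/negP => /andP[c_gt2 cg].
by apply: (no_cyc (Ordinal (cg : (size c < g.+1)%N)) c_gt2); exact: ucycle_contains uc _.
Unshelve. all: by end_near. Qed.

(** * Signatures of vertices *)

Local Notation signature := (bool * bool * bool * bool * bool)%type.

Section Signature.
Variables (V : eqType) (s : seq V) (adj : rel V).
Implicit Types x y z : V.

Definition pattern_in x y a b :=
  has (fun z => [&& z != x, z != y, adj z x == a & adj z y == b]) s.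

(* In a graph without triangles: [x] has at least two neighbours. *)
Definition two_nbrs x := has (fun y => adj x y && pattern_in x y true false) s.

(* Some [y] is a neighbour of [x] (for [a = true]) or only has a common neighbour
   with [x] (for [a = false]), and [b] tells whether [y] has further neighbours. *)
Definition has_near x a b := has (fun y => [&& y != x, adj x y == a,
  pattern_in x y true true == ~~ a & pattern_in x y false true == b]) s.

Definition signature_in x : signature :=
  (two_nbrs x, has_near x true false, has_near x true true,
   has_near x false false, has_near x false true).

End Signature.

Definition vertex_signature (V : finType) (adj : rel V) x := signature_in (enum V) adj x.

Definition realizes (V : finType) (adj : rel V) (c : signature) :=
  [exists x, vertex_signature adj x == c].

Lemma has_enum (T : finType) (P : pred T) : has P (enum T) = [exists x, P x].
Proof.
by apply/hasP/existsP => [[x _ Px]|[x Px]]; exists x; rewrite ?mem_enum.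
Qed.

Lemma pattern_in_enum (V : finType) (adj : rel V) x y a b :
  pattern_in (enum V) adj x y a b = pattern adj x y a b.
Proof. exact: has_enum. Qed.

Lemma two_nbrs_enum (V : finType) (adj : rel V) x :
  two_nbrs (enum V) adj x = [exists y, adj x y && pattern adj x y true false].
Proof. by rewrite /two_nbrs has_enum; apply: eq_existsb => y; rewrite pattern_in_enum. Qed.

Lemma has_near_enum (V : finType) (adj : rel V) x a b :
  has_near (enum V) adj x a b = [exists y, [&& y != x, adj x y == a,
    pattern adj x y true true == ~~ a & pattern adj x y false true == b]].
Proof. by rewrite /has_near has_enum; apply: eq_existsb => y; rewrite !pattern_in_enum. Qed.

Section SignatureTransfer.
Variables (V W : eqType) (s : seq V) (t : seq W) (adjV : rel V) (adjW : rel W) (f : V -> W).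
Hypotheses (symW : symmetric adjW) (f_inj : {in s &, injective f}).
Hypotheses (f_t : {in s, forall x, f x \in t}).
Hypotheses (f_adj : {in s &, forall x y, adjW (f x) (f y) = adjV x y}).
Hypothesis f_closed : forall x w, x \in s -> adjW (f x) w -> exists2 y, y \in s & w = f y.

Lemma has_transfer (P : pred W) : (forall w, P w -> exists2 y, y \in s & w = f y) ->
  has P t = has (fun y => P (f y)) s.
Proof.
move=> P_range; apply/hasP/hasP => [[w _ Pw]|[y ys Py]]; last by exists (f y); rewrite ?f_t.
by have [y ys w_eq] := P_range w Pw; exists y; rewrite -?w_eq.
Qed.

Lemma pattern_in_transfer x y a b : x \in s -> y \in s -> a || b ->
  pattern_in t adjW (f x) (f y) a b = pattern_in s adjV x y a b.
Proof.
move=> xs ys ab; rewrite /pattern_in has_transfer.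
  by apply: eq_in_has => z zs; rewrite !(inj_in_eq f_inj) ?f_adj.
move=> w /and4P[_ _ /eqP wx /eqP wy]; case/orP: ab => ab.
  by apply: (f_closed xs); rewrite symW wx.
by apply: (f_closed ys); rewrite symW wy.
Qed.

Lemma two_nbrs_transfer x : x \in s -> two_nbrs t adjW (f x) = two_nbrs s adjV x.
Proof.
move=> xs; rewrite /two_nbrs has_transfer => [|w /andP[xw _]]; last exact: f_closed xw.
by apply: eq_in_has => y ys; rewrite f_adj ?pattern_in_transfer.
Qed.

Lemma has_near_transfer x a b : x \in s -> has_near t adjW (f x) a b = has_near s adjV x a b.
Proof.
move=> xs; rewrite /has_near has_transfer.
  by apply: eq_in_has => y ys; rewrite (inj_in_eq f_inj) ?f_adj ?pattern_in_transfer.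
move=> w /and4P[_ + + _]; case: a => [/eqP xw _|_ /eqP/hasP[v _]]; first exact: f_closed xw.
move=> /and4P[_ _ /eqP vx /eqP vw]; rewrite symW in vx.
by have [y ys v_eq] := f_closed xs vx; rewrite v_eq in vw; exact: f_closed vw.
Qed.

Lemma signature_transfer x : x \in s -> signature_in t adjW (f x) = signature_in s adjV x.
Proof. by move=> xs; rewrite /signature_in two_nbrs_transfer ?has_near_transfer. Qed.

End SignatureTransfer.

Definition tree_signature (L : seq nat) root := signature_in (iota 0 (size L).+1) (tree_adj L) root.

Lemma component_realizes n (G : graph n) L root : parent_list L -> (root <= size L)%N ->
  G \subset vpairs n -> components (tree_graph L) G != set0 ->
  realizes (adj_of G) (tree_signature L root).
Proof.
move=> treeL rootL GV /set0Pn[phi]; rewrite inE => phiG.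
have [/injectiveP phi_inj _] := andP phiG.
apply/existsP; exists (phi (inord root)); apply/eqP.
have inordE i : i \in iota 0 (size L).+1 -> (inord i : 'I_(size L).+1) = i :> nat.
  by rewrite mem_iota => /inordK.
apply: (@signature_transfer _ _ _ _ _ _ (fun i => phi (inord i))); last by rewrite mem_iota.
- exact: adj_of_sym.
- by move=> i j iL jL /phi_inj ij; rewrite -(inordE i iL) ij inordE.
- by move=> i _; rewrite mem_enum.
- by move=> i j iL jL; rewrite (component_adj _ _ GV phiG) adj_tree_graph // !inordE.
- move=> i w iL /(component_closed GV phiG)[j ->].
  by exists (nat_of_ord j); rewrite ?inord_val ?mem_iota ?ltn_ord.
Qed.

Section SignatureFormula.

Definition literal m (b : bool) (f : fo m) := if b then f else FNot f.

Let x1 : 'I_2 := lift ord0 ord0.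
Let y1 : 'I_2 := ord0.
Let x2 : 'I_3 := lift ord0 (lift ord0 ord0).
Let y2 : 'I_3 := lift ord0 ord0.
Let z2 : 'I_3 := ord0.

Definition pattern_formula a b : fo 2 :=
  FEx (FAnd (FNot (FEq z2 x2)) (FAnd (FNot (FEq z2 y2))
    (FAnd (literal a (FAdj z2 x2)) (literal b (FAdj z2 y2))))).

Definition two_nbrs_formula : fo 1 := FEx (FAnd (FAdj x1 y1) (pattern_formula true false)).

Definition has_near_formula a b : fo 1 :=
  FEx (FAnd (FNot (FEq y1 x1)) (FAnd (literal a (FAdj x1 y1))
    (FAnd (literal (~~ a) (pattern_formula true true)) (literal b (pattern_formula false true))))).

Definition realizes_formula (c : signature) : sentence :=
  let: (deg, end1, ext1, end2, ext2) := c in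
  FEx (FAnd (literal deg two_nbrs_formula)
    (FAnd (literal end1 (has_near_formula true false))
      (FAnd (literal ext1 (has_near_formula true true))
        (FAnd (literal end2 (has_near_formula false false))
          (literal ext2 (has_near_formula false true)))))).

Lemma qdepth_realizes_formula c : qdepth (realizes_formula c) = 3.
Proof. by case: c => [[[[[] []] []] []] []]. Qed.

Variables (V : finType) (adj : rel V).

Lemma eval_literal m b (f : fo m) v : eval adj (literal b f) v = (eval adj f v == b).
Proof. by case: b; rewrite /= ?eqb_id ?eqbF_neg. Qed.

Section Eval.
Variable v : 'I_1 -> V.
Notation x := (v ord0).

Lemma eval_pattern_formula y a b :
  eval adj (pattern_formula a b) (extend y v) = pattern adj x y a b.
Proof.
rewrite /=; apply: eq_existsb => z.
by rewrite !eval_literal /= !extendS !extend0.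
Qed.

Lemma eval_two_nbrs_formula : eval adj two_nbrs_formula v = two_nbrs (enum V) adj x.
Proof.
rewrite two_nbrs_enum; apply: eq_existsb => y.
by rewrite -eval_pattern_formula -[RHS]/(_ && _) /= extendS extend0.
Qed.

Lemma eval_has_near_formula a b : eval adj (has_near_formula a b) v = has_near (enum V) adj x a b.
Proof.
rewrite has_near_enum; apply: eq_existsb => y.
have <- : eval adj (FAdj x1 y1) (extend y v) = adj x y by rewrite /= extendS extend0.
by rewrite -!eval_pattern_formula -!eval_literal /= extendS extend0.
Qed.

End Eval.

Lemma holds_realizes_formula c : holds adj (realizes_formula c) = realizes adj c.
Proof.
case: c => [[[[deg end1] ext1] end2] ext2]; apply: eq_existsb => x.
rewrite -[x in RHS](extend0 x (@no_vars V)) /vertex_signature /signature_in !xpair_eqE -!andbA.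
by rewrite -eval_two_nbrs_formula -!eval_has_near_formula -!eval_literal.
Qed.

End SignatureFormula.

(** * Trees forced by signatures *)

Section GirthGtFour.
Variables (V : finType) (adj : rel V).
Hypotheses (sym : symmetric adj) (irr : irreflexive adj) (girth : girth_gt adj 4).
Implicit Types (x y z : V) (p q : seq V).

Definition extendable x p := [exists w, nb_path adj x (rcons p w)].

Let path_uniq x p : nb_path adj x p -> (size p <= 4)%N -> uniq (x :: p).
Proof. exact: nb_path_uniq. Qed.

Lemma adj_neq x y : adj x y -> x != y.
Proof. by apply: contraTneq => ->; rewrite irr. Qed.

Lemma no_triangle x y z : adj x y -> adj y z -> adj x z = false.
Proof.
move=> xy yz; apply/negP => xz.
have : uniq [:: x; y; z; x].
  apply: path_uniq => //=; rewrite xy yz sym xz !(inj_eq Some_inj).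
  by rewrite (adj_neq xy) eq_sym (adj_neq xz).
by rewrite /= !inE eqxx !orbT.
Qed.

Lemma no_square x y z w : nb_path adj x [:: y; z; w] -> adj x w = false.
Proof.
move=> xyzw; apply/negP => xw.
have : uniq [:: x; y; z; w; x].
  apply: path_uniq => //; move: xyzw => /= /and3P[-> zx /and3P[-> -> /andP[-> _]]].
  by rewrite zx (sym w) xw eq_sym zx.
by rewrite /= !inE eqxx !orbT.
Qed.

Lemma pattern_nbr x y : adj x y ->
  pattern adj x y true true = false /\ pattern adj x y false true = extendable x [:: y].
Proof.
move=> xy; split.
  apply/existsP => -[z /and4P[_ _ /eqP zx /eqP zy]].
  by have := no_triangle zx xy; rewrite zy.
apply: eq_existsb => z; rewrite /= xy (sym y) eqbF_neg eqb_id andbT !(inj_eq Some_inj).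
have [zy|] := boolP (adj z y); last by rewrite !andbF.
have -> : adj z x = false by apply: no_triangle zy _; rewrite sym.
by rewrite (adj_neq zy).
Qed.

Lemma pattern_second x z y : nb_path adj x [:: z; y] ->
  [/\ adj x y = false, pattern adj x y true true &
      pattern adj x y false true = extendable x [:: z; y]].
Proof.
move=> xzy; have /and3P[xz yx /andP[zy _]] := xzy; rewrite (inj_eq Some_inj) in yx.
have nxy := no_triangle xz zy; split=> //.
  by apply/existsP; exists z; rewrite sym xz zy eq_sym !adj_neq // sym.
apply: eq_existsb => w; rewrite /= xz zy eqbF_neg eqb_id !(inj_eq Some_inj) yx andbT /= (sym y).
have [wy|] := boolP (adj w y); last by rewrite !andbF.
rewrite (adj_neq wy) /= !andbT; have [->|wz] := eqVneq w z; first by rewrite sym xz andbF.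
have xw : adj x w = false.
  by apply: (@no_square x z y); rewrite /= xz zy (sym y) wy !(inj_eq Some_inj) yx wz.
by rewrite (sym w x) xw andbT; apply: contraTneq wy => ->; rewrite nxy.
Qed.

Lemma two_nbrsP x : reflect (exists y z, nb_path adj y [:: x; z]) (two_nbrs (enum V) adj x).
Proof.
rewrite two_nbrs_enum; apply: (iffP existsP) => [[y /andP[xy /existsP[z /and4P[_ zy /eqP zx _]]]]|].
  by exists y, z; rewrite /= sym xy sym zx !(inj_eq Some_inj) zy.
move=> [y [z /and3P[yx zy /andP[xz _]]]]; rewrite (inj_eq Some_inj) in zy.
exists y; rewrite sym yx; apply/existsP; exists z.
by rewrite zy eq_sym adj_neq // sym xz sym (no_triangle yx xz).
Qed.

Lemma two_nbrs_other x u : two_nbrs (enum V) adj x -> exists2 y, adj x y & y != u.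
Proof.
move=> /two_nbrsP[y [z /and3P[yx zy /andP[xz _]]]]; rewrite sym in yx.
by have [<-|yu] := eqVneq y u; [exists z|exists y].
Qed.

Lemma has_near_trueP x b :
  reflect (exists y, adj x y /\ extendable x [:: y] = b) (has_near (enum V) adj x true b).
Proof.
rewrite has_near_enum; apply: (iffP existsP) => [[y]|[y [xy ext]]].
  move=> /and4P[_ /eqP xy _ /eqP FT]; exists y; split=> //.
  by have [_ <-] := pattern_nbr xy.
have [TT FT] := pattern_nbr xy; exists y.
by rewrite eq_sym adj_neq // xy TT FT ext !eqxx.
Qed.

Lemma has_near_falseP x b :
  reflect (exists z y, nb_path adj x [:: z; y] /\ extendable x [:: z; y] = b)
    (has_near (enum V) adj x false b).
Proof.
rewrite has_near_enum; apply: (iffP existsP) => [[y]|[z [y [xzy ext]]]].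
  move=> /and4P[yx _ /eqP/existsP[z /and4P[_ _ /eqP zx /eqP zy]] /eqP FT].
  have xzy : nb_path adj x [:: z; y] by rewrite /= sym zx zy !(inj_eq Some_inj) yx.
  by exists z, y; split=> //; have [_ _ <-] := pattern_second xzy.
have [xy TT FT] := pattern_second xzy; exists y.
by have /and3P[_ yx _] := xzy; rewrite [y != x]yx xy TT FT ext !eqxx.
Qed.

Lemma dead_end_fork x y p : extendable x [:: y] = false -> nb_path adj x p -> (1 < size p)%N ->
  ohead p != Some y.
Proof.
case: p => [|z [|w p]] //= end_y /and4P[xz wx zw _] _.
rewrite (inj_eq Some_inj); apply: contraFneq end_y => <-; apply/existsP; exists w.
by rewrite /= xz wx zw.
Qed.

End GirthGtFour.

(* Each row lists the signature, the smallest tree that realizes it, and a vertex of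
   the tree with this signature. *)
Definition signature_table : seq (signature * seq nat * nat) :=
  [:: (false, false, false, false, false, iota 0 0, 0);
      (false, true,  false, false, false, iota 0 1, 0);
      (false, false, true,  true,  false, iota 0 2, 0);
      (true,  true,  false, false, false, iota 0 2, 1);
      (false, false, true,  false, true,  iota 0 3, 0);
      (true,  true,  true,  true,  false, iota 0 3, 1);
      (true,  false, true,  true,  false, iota 0 4, 2);
      (true,  true,  true,  false, true,  iota 0 4, 1);
      (false, false, true,  true,  true,  [:: 0; 1; 2; 1], 0);
      (true,  false, true,  true,  true,  iota 0 5, 2);
      (true,  true,  true,  true,  true,  [:: 0; 1; 2; 3; 2], 1);
      (true,  false, true,  false, true,  iota 0 6, 3)]%N.

Lemma signature_tableP c L root : (c, L, root) \in signature_table ->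
  [/\ parent_list L, (size L <= 6)%N, (root <= size L)%N & tree_signature L root = c].
Proof.
move=> row; suff /allP/(_ _ row)/and4P[? ? ? /eqP] : all (fun row : signature * seq nat * nat =>
  let: (c, L, root) := row in
  [&& parent_list L, size L <= 6, root <= size L & tree_signature L root == c]%N)
  signature_table by [].
by vm_compute.
Qed.

Section SignatureTable.
Variables (V : finType) (adj : rel V).
Hypotheses (sym : symmetric adj) (irr : irreflexive adj) (girth : girth_gt adj 6).
Variable x : V.
Notation deg2 := (two_nbrs (enum V) adj x).
Notation has_near := (has_near (enum V) adj x).
Notation extendable := (extendable adj x).

Let girth4 := girth_gtW (isT : 4 <= 6)%N girth.
Let has_nearTP b := has_near_trueP sym irr girth4 x b.
Let has_nearFP b := has_near_falseP sym irr girth4 x b.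
Let deg2P := two_nbrsP sym irr girth4 x.

Lemma has_near_true_cases : has_near true true = has_near false false || has_near false true.
Proof.
apply/has_nearTP/orP => [[z [xz /existsP[y xzy]]]|].
  by case ext : (extendable [:: z; y]); [right|left]; apply/has_nearFP; exists z, y.
by case=> /has_nearFP[z [y [xzy _]]]; exists z;
  (split; [case/andP: xzy|apply/existsP; exists y]).
Qed.

Lemma two_nbrs_cases : deg2 -> has_near true false || has_near true true.
Proof.
move=> /deg2P[y [_ /andP[yx _]]]; rewrite sym in yx.
by case ext : (extendable [:: y]); apply/orP; [right|left]; apply/has_nearTP; exists y.
Qed.

Lemma has_near_two_nbrs : has_near true false -> has_near true true -> deg2.
Proof.
move=> /has_nearTP[y [xy end_y]] /has_nearTP[a [xa /existsP[b xab]]].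
apply/deg2P; exists y, a; rewrite /= sym xy xa andbT.
by rewrite (dead_end_fork end_y xab).
Qed.

Lemma vertex_signature_in_table : vertex_signature adj x \in [seq row.1.1 | row <- signature_table].
Proof.
rewrite /vertex_signature /signature_in; have := has_near_two_nbrs; have := two_nbrs_cases.
rewrite has_near_true_cases.
by case: deg2; case: has_near; case: has_near; case: has_near => //= deg end_ext;
  rewrite ?(deg isT) ?(end_ext isT isT).
Qed.

Lemma nbr_extendable y : has_near true false = false -> adj x y ->
  exists z, nb_path adj x [:: y; z].
Proof.
move=> no_end xy; apply/existsP; apply: contraFT no_end => /negbTE ext.
by apply/has_nearTP; exists y.
Qed.

Lemma second_extendable y z : has_near false false = false -> nb_path adj x [:: y; z] ->
  exists w, nb_path adj x [:: y; z; w].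
Proof.
move=> no_end xyz; apply/existsP; apply: contraFT no_end => /negbTE ext.
by apply/has_nearFP; exists y, z.
Qed.

Lemma path4_embeds : deg2 -> has_near true false = false -> embeds adj (iota 0 4).
Proof.
move=> /deg2P[y [z /and3P[yx zy /andP[xz _]]]] no_end; rewrite sym in yx.
have [y' xy] := nbr_extendable no_end yx; have [z' xz'] := nbr_extendable no_end xz.
by apply: (fork_embeds sym irr girth xy xz'); rewrite //= eq_sym.
Qed.

Lemma path5_embeds : deg2 -> has_near true false = false -> has_near false true ->
  embeds adj (iota 0 5).
Proof.
move=> deg no_end /has_nearFP[u [v [_ /existsP[w xuvw]]]].
have [b xb bu] := two_nbrs_other sym irr girth4 u deg.
have [a xba] := nbr_extendable no_end xb.
exact: (fork_embeds sym irr girth xba xuvw).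
Qed.

Lemma path6_embeds : deg2 -> has_near true false = false -> has_near false false = false ->
  embeds adj (iota 0 6).
Proof.
move=> /deg2P[y [z /and3P[yx zy /andP[xz _]]]] no_end1 no_end2; rewrite sym in yx.
have [y1 xy1] := nbr_extendable no_end1 yx; have [z1 xz1] := nbr_extendable no_end1 xz.
have [y2 xy2] := second_extendable no_end2 xy1; have [z2 xz2] := second_extendable no_end2 xz1.
by apply: (fork_embeds sym irr girth xy2 xz2); rewrite //= eq_sym.
Qed.

Lemma leaf_fork_embeds p : has_near true false -> nb_path adj x p -> (1 < size p < 6)%N ->
  embeds adj (iota 0 (size p).+1).
Proof.
move=> /has_nearTP[y [xy end_y]] xp /andP[p_gt1 p_lt6].
rewrite -addn1; apply: (fork_embeds sym irr girth xp (q := [:: y])); rewrite ?addn1 //= ?xy //.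
exact: dead_end_fork end_y xp p_gt1.
Qed.

Lemma tripod3_embeds : deg2 = false -> has_near false false -> has_near false true ->
  embeds adj [:: 0; 1; 2; 1]%N.
Proof.
move=> /negbT/deg2P deg1 /has_nearFP[z [u [xzu end_u]]] /has_nearFP[z' [v [_ /existsP[w xzvw]]]].
have zz : z' = z.
  apply: contra_notP deg1 => /eqP zz; exists z, z'.
  by move: xzu xzvw; rewrite /= sym => /andP[-> _] /andP[-> _]; rewrite (inj_eq Some_inj) zz.
rewrite {z'}zz in xzvw; have uv : v != u.
  by apply: contraFneq end_u => <-; apply/existsP; exists w.
have /and3P[xz ux /andP[zu _]] := xzu; have /and3P[_ vx zvw] := xzvw.
have := @tripod_embeds _ _ _ sym irr girth z [:: x] [:: v; w] u; rewrite /= sym xz.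
by apply; rewrite // eq_sym.
Qed.

Lemma tripod4_embeds : has_near true false -> has_near false false -> has_near false true ->
  embeds adj [:: 0; 1; 2; 3; 2]%N.
Proof.
move=> /has_nearTP[y [xy end_y]] /has_nearFP[z [u [xzu end_u]]].
move=> /has_nearFP[z' [v [_ /existsP[w xzvw]]]].
have zy := dead_end_fork end_y xzu isT; have z'y := dead_end_fork end_y xzvw isT.
have [zz|zz] := eqVneq z z'; last first.
  have := @tripod_embeds _ _ _ sym irr girth x [:: z; u] [:: z'; v] y; apply=> //.
  exact: (@nb_path_cat _ _ x [:: z'; v] [:: w]).
rewrite -{z'}zz in xzvw z'y.
have uv : v != u.
  by apply: contraFneq end_u => <-; apply/existsP; exists w.
have /and3P[xz ux /andP[zu _]] := xzu; have /and3P[_ vx zvw] := xzvw.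
have := @tripod_embeds _ _ _ sym irr girth z [:: x; y] [:: v; w] u; rewrite /= sym xz xy.
by apply=> //; rewrite ?andbT eq_sym.
Qed.

Lemma signature_table_embeds c L root :
  (c, L, root) \in signature_table -> vertex_signature adj x = c -> embeds adj L.
Proof.
rewrite /signature_table !inE; do ?[case/orP]; move=> /eqP[-> -> _] [deg end1 ext1 end2 ext2].
- by exists [:: x].
- have /has_nearTP[y [xy _]] : has_near true false by rewrite end1.
  by apply: (path_embeds irr girth (x := x) (p := [:: y])); rewrite //= xy.
- have /has_nearTP[y [_ /existsP[z xyz]]] : has_near true true by rewrite ext1.
  exact: (path_embeds irr girth xyz).
- have /deg2P[y [z yxz]] : deg2 by rewrite deg.
  exact: (path_embeds irr girth yxz).
- have /has_nearFP[y [z [_ /existsP[w xyzw]]]] : has_near false true by rewrite ext2.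
  exact: (path_embeds irr girth xyzw).
- have /has_nearTP[y [_ /existsP[z xyz]]] : has_near true true by rewrite ext1.
  exact: leaf_fork_embeds end1 xyz isT.
- exact: path4_embeds.
- have /has_nearFP[y [z [_ /existsP[w xyzw]]]] : has_near false true by rewrite ext2.
  exact: leaf_fork_embeds end1 xyzw isT.
- exact: tripod3_embeds.
- exact: path5_embeds.
- exact: tripod4_embeds.
- exact: path6_embeds.
Qed.

End SignatureTable.

(** * Similarity of vertices in sparse graphs *)

Definition has_nbr (V : finType) (adj : rel V) x := [exists y, adj x y].

(* [y] is neither a neighbour of [x] nor at distance 2, and [b] tells whether [y] has
   neighbours. *)
Definition far (V : finType) (adj : rel V) x y b :=
  [/\ y != x, adj x y = false, pattern adj x y true true = false &
      pattern adj x y false true = b].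

Definition many_isolated (V : finType) (adj : rel V) :=
  forall x y, exists z, [/\ z != x, z != y & forall w, adj z w = false].

Section SparseSim.
Variables (V : finType) (adj : rel V).
Hypotheses (sym : symmetric adj) (irr : irreflexive adj) (girth : girth_gt adj 4).
Hypothesis isolated : many_isolated adj.
Implicit Types x y z : V.

Lemma pattern_ff x y : pattern adj x y false false.
Proof.
by have [z [zx zy iso]] := isolated x y; apply/existsP; exists z; rewrite zx zy !iso.
Qed.

Lemma far_isolated x : exists y, far adj x y false.
Proof.
have [y [yx _ iso]] := isolated x x; exists y; split=> //; first by rewrite sym.
all: by apply/existsP => -[z /and4P[_ _ _ /eqP]]; rewrite sym iso.
Qed.

Lemma pattern_diag x a b : pattern adj x x a b = (a == b) && (a ==> has_nbr adj x).
Proof.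
case: a b => [] [] /=; last exact: pattern_ff.
- apply/existsP/existsP => [[z /and4P[_ _ /eqP zx _]]|[z xz]]; exists z; first by rewrite sym.
  by rewrite eq_sym (adj_neq irr xz) sym xz.
- by apply/existsP => -[z /and4P[_ _ /eqP ->]].
- by apply/existsP => -[z /and4P[_ _ /eqP ->]].
Qed.

Lemma has_nbr_near x :
  has_nbr adj x = has_near (enum V) adj x true false || has_near (enum V) adj x true true.
Proof.
apply/existsP/orP => [[y xy]|].
  case ext : (extendable adj x [:: y]); [right|left];
    by apply/(has_near_trueP sym irr girth); exists y.
by case=> /(has_near_trueP sym irr girth)[y [xy _]]; exists y.
Qed.

Lemma pattern_tf x y : y != x -> pattern adj x y true false =
  if adj x y || pattern adj x y true true then two_nbrs (enum V) adj x else has_nbr adj x.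
Proof.
move=> yx; have patternI z : adj x z -> z != y -> adj y z = false -> pattern adj x y true false.
  move=> xz zy yz; apply/existsP; exists z.
  by rewrite zy eq_sym (adj_neq irr xz) (sym z x) xz (sym z y) yz.
have patternE : pattern adj x y true false -> exists z, [/\ adj x z, z != y & adj y z = false].
  by move=> /existsP[z /and4P[_ zy /eqP zx /eqP zy']]; exists z; rewrite sym zx sym zy'.
have [xy|nxy] := boolP (adj x y).
  apply/idP/idP => [/patternE[z [xz zy _]]|/(two_nbrs_other sym irr girth y)[z xz zy]].
    by apply/(two_nbrsP sym irr girth); exists y, z; rewrite /= sym xy xz (inj_eq Some_inj) zy.
  by apply: patternI zy _ => //; apply: (no_triangle sym irr girth) xz; rewrite sym.
have [/existsP[u /and4P[_ _ /eqP ux /eqP uy]]|noTT] /= := boolP (pattern adj x y true true).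
  apply/idP/idP => [/patternE[z [xz zy yz]]|/(two_nbrs_other sym irr girth u)[z xz zu]].
    apply/(two_nbrsP sym irr girth); exists u, z; rewrite /= ux xz (inj_eq Some_inj) !andbT.
    by apply: contraFneq yz => ->; rewrite sym.
  apply: (patternI z) => //; first by apply: contraNneq nxy => <-.
  apply: (@no_square _ _ sym irr girth y u x z).
  by rewrite /= sym uy ux xz !(inj_eq Some_inj) zu eq_sym yx.
apply/idP/existsP => [/patternE[z [xz _ _]]|[z xz]]; first by exists z.
apply: (patternI z) => //; first by apply: contraNneq nxy => <-.
apply: contraNF noTT => yz; apply/existsP; exists z.
by rewrite !(eq_sym z) (adj_neq irr xz) (adj_neq irr yz) !(sym z) xz yz.
Qed.

End SparseSim.

Section SparseVertexSim.
Variables (V W : finType) (adjV : rel V) (adjW : rel W).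
Hypotheses (symV : symmetric adjV) (irrV : irreflexive adjV) (girthV : girth_gt adjV 4).
Hypotheses (symW : symmetric adjW) (irrW : irreflexive adjW) (girthW : girth_gt adjW 4).
Hypotheses (isolatedV : many_isolated adjV) (isolatedW : many_isolated adjW).
Variables (x : V) (x' : W).
Hypothesis same_signature : vertex_signature adjV x = vertex_signature adjW x'.

Lemma same_has_nbr : has_nbr adjV x = has_nbr adjW x'.
Proof. by case: same_signature => _ end_eq ext_eq _ _; rewrite !has_nbr_near // end_eq ext_eq. Qed.

Lemma pair_simI y y' : y != x -> y' != x' -> adjV x y = adjW x' y' ->
  pattern adjV x y true true = pattern adjW x' y' true true ->
  pattern adjV x y false true = pattern adjW x' y' false true ->
  pair_sim adjV adjW x y x' y'.
Proof.
move=> yx yx' adj_eq TT FT; split=> [|//|[] []//].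
- by rewrite !(eq_sym x) !(eq_sym x') (negbTE yx) (negbTE yx').
- by rewrite !pattern_tf // adj_eq TT same_has_nbr; case: same_signature => -> _.
- by rewrite !pattern_ff.
Qed.

Lemma same_has_near a b : has_near (enum V) adjV x a b = has_near (enum W) adjW x' a b.
Proof. by case: same_signature => _ ? ? ? ?; case: a b => -[]. Qed.

Lemma sparse_pair_sim : (forall y, far adjV x y true -> exists y', far adjW x' y' true) ->
  forall y, exists y', pair_sim adjV adjW x y x' y'.
Proof.
move=> far_match y; have [->|yx] := eqVneq y x.
  exists x'; split=> [||a b]; rewrite ?eqxx ?irrV ?irrW //.
  by rewrite !pattern_diag // same_has_nbr.
have near a : adjV x y = a -> pattern adjV x y true true = ~~ a ->
    exists y', pair_sim adjV adjW x y x' y'.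
  move=> xy TT; have : has_near (enum V) adjV x a (pattern adjV x y false true).
    by rewrite has_near_enum; apply/existsP; exists y; rewrite yx xy TT !eqxx.
  rewrite same_has_near has_near_enum => /existsP[y' /and4P[yx' /eqP xy' /eqP TT' /eqP FT']].
  by exists y'; apply: pair_simI; rewrite ?xy ?TT.
case xy : (adjV x y); first by apply: (near true) => //; have [] := pattern_nbr symV irrV girthV xy.
case TT : (pattern adjV x y true true); first exact: (near false).
suff [y' [yx' xy' TT' FT']] : exists y', far adjW x' y' (pattern adjV x y false true).
  by exists y'; apply: pair_simI; rewrite ?xy ?TT.
case FT : (pattern adjV x y false true); last exact: far_isolated.
by apply: (far_match y).
Qed.

End SparseVertexSim.

Lemma sparse_vertex_sim (V W : finType) (adjV : rel V) (adjW : rel W) x x' :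
  symmetric adjV -> irreflexive adjV -> girth_gt adjV 4 -> many_isolated adjV ->
  symmetric adjW -> irreflexive adjW -> girth_gt adjW 4 -> many_isolated adjW ->
  (exists y, far adjV x y true) <-> (exists y', far adjW x' y' true) ->
  vertex_signature adjV x = vertex_signature adjW x' -> vertex_sim adjV adjW x x'.
Proof.
move=> symV irrV girthV isoV symW irrW girthW isoW far_iff same_signature; split=> y.
  by apply: sparse_pair_sim => // z xz; apply/far_iff; exists z.
have [z /pair_sim_sym yz] : exists z, pair_sim adjW adjV x' y x z; last by exists z.
by apply: sparse_pair_sim => // z xz; apply/far_iff; exists z.
Qed.

(** * The law for [1 < alpha] *)

Section FarComponent.
Variables (k : nat) (H : graph k) (n : nat) (G : graph n) (phi : {ffun 'I_k -> 'I_n}) (x : 'I_n).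
Hypotheses (GV : G \subset vpairs n) (phiG : is_component H G phi).
Hypothesis avoids : forall i, phi i != x.

Lemma component_nonadj i : adj_of G (phi i) x = false.
Proof. by apply/negP => /(component_closed GV phiG)[j xj]; have := avoids j; rewrite xj eqxx. Qed.

Lemma component_far i : far (adj_of G) x (phi i) [exists j, adj_of H i j].
Proof.
split; [exact: avoids|by rewrite adj_of_sym component_nonadj| |].
  apply/existsP => -[z /and4P[_ _ /eqP zx /eqP]].
  by rewrite adj_of_sym => /(component_closed GV phiG)[j zj]; rewrite zj component_nonadj in zx.
apply/existsP/existsP => [[z /and4P[_ _ _ /eqP zi]]|[j ij]].
  rewrite adj_of_sym in zi; have [j zj] := component_closed GV phiG zi.
  by exists j; rewrite -(component_adj _ _ GV phiG) -zj.
rewrite -(component_adj _ _ GV phiG) in ij; exists (phi j).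
by rewrite avoids eq_sym (adj_neq (adj_of_irr GV) ij) component_nonadj adj_of_sym ij.
Qed.

End FarComponent.

Lemma components_isolated n (G : graph n) : G \subset vpairs n ->
  (2 < #|components (tree_graph [::]) G|)%N -> many_isolated (adj_of G).
Proof.
move=> GV many x y.
have [|phi phiG avoids] := component_avoiding (A := [set x; y])
  (@connected_tree_graph [::] isT) GV _.
  by apply: leq_ltn_trans many; rewrite /= muln1 cards2; case: (x != y).
have := avoids ord0; rewrite !inE negb_or => /andP[phix phiy].
exists (phi ord0); split=> // w; apply/negP => phiw.
have [j wj] := component_closed GV phiG phiw.
by move: phiw; rewrite wj (ord1 j) adj_of_irr.
Qed.

Lemma components_far n (G : graph n) : G \subset vpairs n ->
  (4 < #|components (tree_graph [:: 0%N]) G|)%N -> forall x, exists y, far (adj_of G) x y true.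
Proof.
move=> GV many x.
have [|phi phiG avoids] := component_avoiding (A := [set x])
  (@connected_tree_graph [:: 0%N] isT) GV _.
  by rewrite cards1.
have {}avoids i : phi i != x by have := avoids i; rewrite inE.
exists (phi ord0); have := component_far GV phiG avoids ord0.
suff -> : [exists j, adj_of (tree_graph [:: 0%N]) ord0 j] by [].
by apply/existsP; exists ord_max; rewrite adj_tree_graph.
Qed.

Section SparseLaw.
Variables (R : realType) (alpha : R).
Hypothesis alpha_gt1 : 1 < alpha.
Let alpha_gt0 : 0 < alpha. Proof. exact: lt_trans alpha_gt1. Qed.
Let p01 := edge_prob01 alpha_gt0.
Notation p := (edge_prob alpha).

Lemma whp_many_tree_components L (t : nat) : parent_list L ->
  alpha * (size L)%:R < (size L).+1%:R ->
  whp p (fun n G => (t < #|components (tree_graph L) G|)%N).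
Proof.
move=> treeL; rewrite -{1}(card_tree_graph treeL) => alphaL.
have := whp_many_components alpha_gt0 (tree_graph_vpairs treeL)
  (connected_tree_graph treeL) (ltW alpha_gt1) t%:R alphaL.
by apply: whp_mono => //; near=> n => G _; rewrite ltr_nat.
Unshelve. all: by end_near. Qed.

Lemma whp_many_isolated : whp p (fun n G => many_isolated (adj_of G)).
Proof.
apply: whp_mono (@whp_many_tree_components [::] 2 isT _) => //; last by rewrite mulr0.
by near=> n => G GV; exact: components_isolated.
Unshelve. all: by end_near. Qed.

Definition far_profile n (G : graph n) :=
  if alpha < 2 then forall x, exists y, far (adj_of G) x y true
  else forall x y, adj_of G x y = false.

Lemma whp_far_profile : alpha != 2 -> whp p far_profile.
Proof.
rewrite /far_profile; case: (ltgtP alpha 2) => // [alpha_lt2|alpha_gt2] _.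
  apply: whp_mono (@whp_many_tree_components [:: 0%N] 4 isT _) => //; last by rewrite mulr1.
  by near=> n => G GV; exact: components_far.
apply: whp_mono (whp_not_contains alpha_gt0 (@tree_graph_vpairs [:: 0%N] isT) _) => //; last first.
  by rewrite card_tree_graph // mulr1.
near=> n => G GV no_edge x y; apply/negP => xy; apply: no_edge.
apply: embeds_contains => //; apply: (@nb_path_embeds _ _ x [:: y]); rewrite /= ?xy //.
by rewrite inE (adj_neq (adj_of_irr GV) xy).
Unshelve. all: by end_near. Qed.

Lemma far_profile_match n (G : graph n) n' (G' : graph n') x x' :
  far_profile G -> far_profile G' ->
  (exists y, far (adj_of G) x y true) <-> (exists y', far (adj_of G') x' y' true).
Proof.
rewrite /far_profile; case: ifP => _ profile profile'; first by split.
by split=> -[y [_ _ _ /existsP[z /and4P[_ _ _]]]]; rewrite ?profile ?profile'.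
Qed.

Lemma signature_table_contains n (G : graph n) c L root : G \subset vpairs n ->
  girth_gt (adj_of G) 6 -> (c, L, root) \in signature_table -> realizes (adj_of G) c ->
  contains (tree_graph L) G.
Proof.
move=> GV girth row /existsP[x /eqP sig_x]; have [treeL _ _ _] := signature_tableP row.
exact: embeds_contains (signature_table_embeds (@adj_of_sym _ G) (adj_of_irr GV) girth row sig_x).
Qed.

Lemma realizes_dichotomy c : (forall k : nat, (k <= 6)%N -> alpha * k%:R != k.+1%:R) ->
  whp p (fun n G => realizes (adj_of G) c) \/ whp p (fun n G => ~ realizes (adj_of G) c).
Proof.
move=> off_threshold; have girth := whp_girth_gt 6 alpha_gt1.
have [/mapP[[[c' L] root] row /= c_eq]|nc] := boolP (c \in [seq row.1.1 | row <- signature_table]).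
  rewrite -{c'}c_eq in row; have [treeL L6 rootL sigL] := signature_tableP row.
  have := off_threshold _ L6; rewrite neq_lt => /orP[below|above]; [left|right].
    apply: whp_mono (whp_many_tree_components 0 treeL below) => //.
    by near=> n => G GV; rewrite card_gt0 -sigL; exact: component_realizes.
  have no_copy := whp_not_contains alpha_gt0 (tree_graph_vpairs treeL).
  rewrite card_tree_graph // in no_copy.
  apply: whp_mono (whp_and p01 girth (no_copy above)) => //.
  by near=> n => G GV [girthG]; apply: contra_not; exact: signature_table_contains row.
right; apply: whp_mono girth => //; near=> n => G GV girthG /existsP[x /eqP sig_x].
case/negP: nc; rewrite -sig_x.
exact: (vertex_signature_in_table (@adj_of_sym _ G) (adj_of_irr GV) girthG).
Unshelve. all: by end_near. Qed.

Lemma zero_one_law_sparse : (forall k : nat, (k <= 6)%N -> alpha * k%:R != k.+1%:R) ->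
  zero_one_law p 3.
Proof.
move=> off_threshold; pose occurs c := `[< whp p (fun n G => realizes (adj_of G) c) >].
have same_signatures : whp p (fun n G => forall c, realizes (adj_of G) c = occurs c).
  apply: whp_forall => // c; rewrite /occurs; case: asboolP => [|often].
    by apply: whp_mono => //; near=> n.
  case: (realizes_dichotomy c off_threshold) => // /whp_mono; apply=> //.
  by near=> n => G _ /negP/negbTE.
have alpha_neq2 : alpha != 2 by have := off_threshold 1%N isT; rewrite mulr1.
have := whp_and p01 (whp_and p01 (whp_girth_gt 6 alpha_gt1) whp_many_isolated)
  (whp_and p01 (whp_far_profile alpha_neq2) same_signatures).
move=> /(zero_one_of_whp p01); apply=> n G n' G' GV GV' [[girth iso] [profile sigs]].
move=> [[girth' iso'] [profile' sigs']] x.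
have /existsP[x' /eqP sig_x'] : realizes (adj_of G') (vertex_signature (adj_of G) x).
  by rewrite sigs' -sigs; apply/existsP; exists x.
exists x'; apply: sparse_vertex_sim => //; try exact: adj_of_sym; try exact: adj_of_irr.
1,2: exact: (@girth_gtW _ _ 4 6).
exact: far_profile_match.
Unshelve. all: by end_near. Qed.

(** * Failure at the thresholds *)

Lemma no_law_at_tree_threshold c L root : (c, L, root) \in signature_table -> (0 < size L)%N ->
  alpha * (size L)%:R = (size L).+1%:R -> ~ zero_one_law p 3.
Proof.
move=> row L0; have [treeL _ rootL sigL] := signature_tableP row.
rewrite -{1}(card_tree_graph treeL) => threshold.
have [d d0 realized_pos] := gnp_component_ge alpha_gt0 (tree_graph_vpairs treeL)
  (connected_tree_graph treeL) (ltW alpha_gt1) threshold.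
have no_copy_pos := gnp_not_contains_ge alpha_gt0 (tree_graph_vpairs treeL) isT threshold.
have e0 : 0 < expR (-2) / 2 :> R by rewrite divr_gt0 ?expR_gt0.
apply: (no_zero_one_law p01 (qdepth_realizes_formula c) d0 e0).
- apply: filterS realized_pos => n /le_trans; apply; apply: le_gnp => // G GV comp.
  by rewrite holds_realizes_formula -sigL; exact: component_realizes.
- have /whp_compl/cvgrPdist_lt/(_ _ e0) girth := whp_girth_gt 6 alpha_gt1.
  apply: filterS2 girth no_copy_pos => n.
  rewrite sub0r normrN ger0_norm ?gnp_ge0 // => girth no_copy.
  have : gnp p (fun G : graph n => ~ contains (tree_graph L) G) <=
      gnp p (fun G : graph n => ~ holds (adj_of G) (realizes_formula c)) +
      gnp p (fun G : graph n => ~ girth_gt (adj_of G) 6).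
    apply: le_trans (gnp_or_le _ _ _) => //; apply: le_gnp => // G GV no_copy_G.
    have [girthG|] := pselect (girth_gt (adj_of G) 6); [left|by right].
    rewrite holds_realizes_formula; apply: contra_not no_copy_G.
    exact: signature_table_contains row.
  by move: girth no_copy; lra.
Qed.

End SparseLaw.

Definition triangle_formula : sentence :=
  let x : 'I_3 := lift ord0 (lift ord0 ord0) in
  let y : 'I_3 := lift ord0 ord0 in
  let z : 'I_3 := ord0 in
  FEx (FEx (FEx (FAnd (FAdj x y) (FAnd (FAdj y z) (FAdj x z))))).

Lemma holds_triangle_formula (V : finType) (adj : rel V) : holds adj triangle_formula =
  [exists x, [exists y, [exists z, [&& adj x y, adj y z & adj x z]]]].
Proof.
apply: eq_existsb => x; apply: eq_existsb => y; apply: eq_existsb => z.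
by rewrite /= !extendS !extend0.
Qed.

Lemma triangle_formula_triangles n (G : graph n) :
  triangles G != set0 -> holds (adj_of G) triangle_formula.
Proof.
move=> /set0Pn[A AG]; have /card_gt0P[x xA] : (0 < #|A|)%N.
  by move: AG; rewrite inE => /andP[/eqP ->].
have [y [z [xy yz xz]]] := in_trianglesP AG xA; rewrite holds_triangle_formula.
by apply/existsP; exists x; apply/existsP; exists y; apply/existsP; exists z; rewrite xy yz.
Qed.

Lemma triangle_formula_contains n (G : graph n) : G \subset vpairs n ->
  holds (adj_of G) triangle_formula -> contains (cycle_graph 3) G.
Proof.
move=> GV; rewrite holds_triangle_formula => /existsP[x /existsP[y /existsP[z /and3P[xy yz xz]]]].
have neq := adj_neq (adj_of_irr GV); apply: (@ucycle_contains 3 isT n G [:: x; y; z]) => //.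
by rewrite /ucycle /= !inE negb_or xy yz adj_of_sym xz !neq.
Qed.

Lemma no_law_at_one (R : realType) : ~ zero_one_law (edge_prob (1 : R)) 3.
Proof.
have p01 := @edge_prob01 R 1 ltr01.
apply: (@no_zero_one_law _ _ p01 triangle_formula (97^-1) (expR (-2)) erefl);
  rewrite ?invr_gt0 ?expR_gt0 //.
- near=> n.
  apply: (@le_trans _ _ (gnp (edge_prob (1 : R)) (fun G : graph n => triangles G != set0))).
    by apply: gnp_triangle_ge => //; near: n; exact: nbhs_infty_ge.
  by apply: le_gnp => // G _; exact: triangle_formula_triangles.
- have : 1 * #|cycle_graph 3|%:R = 3%:R :> R by rewrite card_cycle_graph // mul1r.
  move=> /(gnp_not_contains_ge ltr01 (@cycle_graph_vpairs 3 isT) isT).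
  apply: filterS => n /le_trans; apply; apply: le_gnp => // G GV.
  by apply: contra_not; exact: triangle_formula_contains.
Unshelve. all: by end_near. Qed.

Definition threshold (R : numDomainType) (alpha : R) :=
  alpha = 1 \/ exists2 k : nat, (0 < k <= 6)%N & alpha * k%:R = k.+1%:R.

Lemma thresholdP (R : realFieldType) (alpha : R) :
  alpha \in [:: 1; 7 / 6; 6 / 5; 5 / 4; 4 / 3; 3 / 2; 2] <-> threshold alpha.
Proof.
split.
  rewrite !inE; case/or4P => [/eqP->|/eqP->|/eqP->|/or4P[]/eqP->]; first by left.
  - by right; exists 6%N => //; lra.
  - by right; exists 5%N => //; lra.
  - by right; exists 4%N => //; lra.
  - by right; exists 3%N => //; lra.
  - by right; exists 2%N => //; lra.
  - by right; exists 1%N => //; lra.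
case=> [->|[k]]; first by rewrite inE eqxx.
have div (m : nat) : (0 < m)%N -> alpha * m%:R = m.+1%:R -> alpha = m.+1%:R / m%:R.
  by move=> m0 <-; rewrite mulfK // pnatr_eq0 -lt0n.
case: k => // k; do 6?[case: k => [_ /div -> //|k]]; last by [].
all: by rewrite !inE ?divr1 !eqxx ?orbT.
Qed.

Lemma threshold_tree k : (k <= 6)%N -> exists c root, (c, iota 0 k, root) \in signature_table.
Proof.
move=> k6; have /hasP[[[c L] root] row /eqP L_eq] :
    has (fun row => row.1.2 == iota 0 k) signature_table.
  by case: k k6 => [|[|[|[|[|[|[|]]]]]]].
by exists c, root; rewrite -L_eq.
Qed.

Lemma no_law_at_threshold (R : realType) (alpha : R) :
  threshold alpha -> ~ zero_one_law (edge_prob alpha) 3.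
Proof.
case=> [->|[k /andP[k0 k6] alpha_k]]; first exact: no_law_at_one.
have [c [root row]] := threshold_tree k6.
apply: (no_law_at_tree_threshold _ row); rewrite ?size_iota //.
by rewrite -(@ltr_pM2r _ k%:R) ?ltr0n // mul1r alpha_k ltr_nat.
Qed.

Lemma law_off_thresholds (R : realType) (alpha : R) : 0 < alpha ->
  ~ threshold alpha -> zero_one_law (edge_prob alpha) 3.
Proof.
move=> alpha_gt0 off; have [lt1|gt1|eq1] := ltgtP alpha 1.
- by apply: zero_one_law_dense; rewrite alpha_gt0.
- apply: zero_one_law_sparse gt1 _ => k k6; apply/eqP => alpha_k; apply: off; right.
  exists k => //; rewrite k6 andbT lt0n; apply: contra_eq_neq alpha_k => ->.
  by rewrite mulr0 eq_sym oner_neq0.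
- by case: off; left.
Qed.

Theorem theorem5 (R : realType) (alpha : R) (alpha_gt0 : 0 < alpha) :
  ~ zero_one_law (fun n : nat => n%:R `^ (- alpha)) 3 <->
  alpha \in [:: 1; 7 / 6; 6 / 5; 5 / 4; 4 / 3; 3 / 2; 2].
Proof.
split=> [no_law|/thresholdP]; last exact: no_law_at_threshold.
apply/thresholdP; apply: contra_notP no_law; exact: law_off_thresholds.
Qed.
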